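(* Let $(W_\Pi,\Pi)$ be a Coxeter system and let $J\subseteq\Pi$ be a subdiagram of type $D_5$ or of type $A_m$ with $m$ odd. Let $\Gamma_{\max}$ (the non-reflection part of $N_{W_\Pi}(W_J)$) and its subgroup $\Gamma_{\max}^\vee$ be as defined in the context. Then $\Gamma_{\max}^\vee$ is a free group, and it has index $1$ or $2$ in $\Gamma_{\max}$. Therefore $\Gamma_{\max}$ has a free subgroup of index $1$ or $2$.
   Context: Setting. $(W_\Pi,\Pi)$ is a Coxeter system; its Coxeter diagram has node set $\Pi$, with an edge between $s_i,s_j\in\Pi$ labeled by the order $m_{ij}$ of $s_is_j$ when $m_{ij}>2$. A subdiagram is a subset of $\Pi$ with the induced diagram; it is spherical if the subgroup of $W_\Pi$ it generates is finite. For $J\subseteq\Pi$, $W_J$ is the subgroup generated by $J$. $V_\Pi$ is the real vector space with basis $\Pi$ (the simple roots $\alpha_s$, identified with the generators $s$), with the symmetric bilinear form $(\alpha_{s_i},\alpha_{s_j})=-\cos(\pi/m_{ij})$ ($=1$ if $i=j$, $=-1$ if $m_{ij}=\infty$); $W_\Pi$ acts on $V_\Pi$ isometrically with $s$ acting by the reflection in $\alpha_s$, and acts dually on $V_\Pi^*$. A root is a $W_\Pi$-image of a simple root. The fundamental chamber is $C_\Pi=\{f\in V_\Pi^*: f(\alpha)\ge 0 \text{ for all }\alpha\in\Pi,\ \{\alpha\in\Pi: f(\alpha)=0\}\text{ is spherical}\}$, and $K=W_\Pi\cdot C_\Pi$ is the (open) Tits cone, an open convex subset of $V_\Pi^*$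 on which $W_\Pi$ acts properly discontinuously with fundamental chamber $C_\Pi$. For a root $\alpha$, $\alpha^\perp$ is the fixed-point set in $K$ of the reflection associated to $\alpha$. Let $J\subseteq\Pi$ be spherical, regarded also as a set of simple roots. Put $J^\perp=\bigcap_{\alpha\in J}\alpha^\perp\subseteq K$. An element of $W_\Pi$ preserving the set $J$ of roots acts on $J^\perp$ by a reflection if it acts on the linear subspace $\{f\in V_\Pi^*: f(\alpha)=0\ \forall\alpha\in J\}$ (whose intersection with $K$ is $J^\perp$) as an involution with fixed subspace of codimension $1$; its mirror in $J^\perp$ is its fixed-point set there. $W_{\max}$ is the subgroup of $W_\Pi$ generated by all elements of $W_\Pi$ that preserve the set of roots $J$ and act on $J^\perp$ by reflections. $C_{\max}^\circ$ is a chosen component of the complement in $J^\perp$ of the mirrors of the elements of $W_{\max}$ acting on $J^\perp$ by reflections, and $C_{\max}$ is its closure in $J^\perp$. $\Gamma_{\max}$ is the subgroup of $W_\Pi$ of elements that preserve $J$ (as a set of roots) and send $C_{\max}$ to itself. $\Gamma_{\max}^\vee$ is the subgroup of $\Gamma_{\max}$ acting trivially on $J$. The trivial group counts as free. *)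

(* Defs.v *)
From mathcomp Require Import all_boot all_order all_algebra finmap.
From mathcomp Require Import -(notations) monalg.
From mathcomp Require Import all_classical all_reals all_analysis.
Set Implicit Arguments.
Unset Strict Implicit.
Unset Printing Implicit Defensive.

Import Order.TTheory GRing.Theory Num.Theory.
Import numFieldNormedType.Exports.
Local Open Scope classical_set_scope.
Local Open Scope card_scope.
Local Open Scope ring_scope.

Section GroupNotions.
Context {G : groupType}.
Implicit Types (H K : set G) (g x : G).

Definition is_subgroup H : Prop :=
  [/\ H 1%g, (forall x y, H x -> H y -> H (x * y)%g)
    & (forall x, H x -> H (x^-1)%g)].

Definition generated (A : set G) : set G := smallest is_subgroup A.

(* 0 stands for infinite order *)
Definition elt_order (g : G) : nat :=
  if pselect (exists n, (0 < n)%N && (g ^+ n == 1)%g) is left e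
  then ex_minn e else 0%N.

(* K has n left cosets g H with g in K *)
Definition has_index H K (n : nat) : Prop :=
  [set [set (g * h)%g | h in H] | g in K] #= `I_n.

(* (x, false) stands for x and (x, true) for the inverse of x *)
Definition letter_val (a : G * bool) : G := if a.2 then (a.1^-1)%g else a.1.

Definition reduced_word (u : seq (G * bool)) : bool :=
  sorted (fun a b => ~~ ((a.1 == b.1) && (a.2 != b.2))) u.

Definition is_free_group H : Prop :=
  exists B : set G, generated B = H /\
    forall u : seq (G * bool),
      (forall a, a \in u -> B a.1) -> reduced_word u -> u != [::] ->
      (\prod_(a <- u) letter_val a)%g <> 1%g.

End GroupNotions.

Section CoxeterSystem.
Context {Pi : choiceType} {W : groupType} (s : Pi -> W).

Definition coxeter_matrix (i j : Pi) : nat := elt_order (s i * s j)%g.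

(* Congruence on words generated by (i j)^m_ij ~ 1.  The case i = j of
   [word_rel] is i i ~ 1, as m_ii = 1 for a Coxeter system; the case
   m_ij = 0 (infinite order) is void. *)
Inductive word_eqv : seq Pi -> seq Pi -> Prop :=
| word_refl u : word_eqv u u
| word_sym u v : word_eqv u v -> word_eqv v u
| word_trans u v w : word_eqv u v -> word_eqv v w -> word_eqv u w
| word_rel u v i j :
    word_eqv (u ++ flatten (nseq (coxeter_matrix i j) [:: i; j]) ++ v) (u ++ v).

Definition word_val (l : seq Pi) : W := (\prod_(i <- l) s i)%g.

(* W is presented by the generators s_i and the relations
   (s_i s_j)^m_ij = 1 where m_ij is the order of s_i s_j.  As the generators
   are involutions, words in the s_i alone suffice. *)
Definition is_coxeter_system : Prop :=
  [/\ injective s,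
      (forall i, (s i * s i = 1)%g),
      (forall w, exists l, w = word_val l)
    & (forall l, word_val l = 1%g -> word_eqv l [::])].

Definition parabolic (F : set Pi) : set W := generated (s @` F).

Definition spherical (F : set Pi) : Prop := finite_set (parabolic F).

(* The diagram induced on J is simply laced with edges given by e. *)
Definition diagram_of_type (n : nat) (e : rel 'I_n) (J : set Pi) : Prop :=
  exists phi : 'I_n -> Pi,
    [/\ injective phi, range phi = J
      & forall a b, a != b ->
          coxeter_matrix (phi a) (phi b) = if e a b then 3%N else 2%N].

Definition type_A (m : nat) : set Pi -> Prop :=
  diagram_of_type (fun a b : 'I_m => (a.+1 == b) || (b.+1 == a)).

(* Edges 0-1, 1-2, 2-3 and 2-4. *)
Definition type_D5 : set Pi -> Prop :=
  diagram_of_type (fun a b : 'I_5 =>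
    ((a : nat), (b : nat)) \in
      [:: (0, 1); (1, 0); (1, 2); (2, 1); (2, 3); (3, 2); (2, 4); (4, 2)]%N).

End CoxeterSystem.

Section TitsCone.
Context (R : realType) {Pi : choiceType} {W : groupType} (s : Pi -> W).

(* Finitely supported functions Pi -> R: the space with basis Pi. *)
Definition rootspace : lmodType R := @malg Pi R.

Definition simple_root (i : Pi) : rootspace := mkmalgU i 1.

Definition gram (i j : Pi) : R :=
  if coxeter_matrix s i j is m.+1 then - cos (pi / m.+1%:R) else -1.

Definition root_form (u v : rootspace) : R :=
  \sum_(i <- msupp u) \sum_(j <- msupp v) mcoeff i u * mcoeff j v * gram i j.

(* Reflection in a vector a with (a, a) = 1. *)
Definition reflection (a v : rootspace) : rootspace :=
  v - (2 * root_form a v) *: a.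

Definition some_word (w : W) : seq Pi := xget [::] [set l | w = word_val s l].

(* The linear action of W in which s_i acts by the reflection in the simple
   root i.  The choice of a word for w is immaterial, since the simple
   reflections satisfy the Coxeter relations. *)
Definition act (w : W) (v : rootspace) : rootspace :=
  foldr (fun i => reflection (simple_root i)) v (some_word w).

(* A functional is encoded by its values on the simple roots, the space of
   functionals carrying the topology of pointwise convergence (the usual
   one when Pi is finite). *)
Definition dualspace : topologicalType := {ptws Pi -> R}.

Definition pairing (f : dualspace) (v : rootspace) : R :=
  \sum_(i <- msupp v) mcoeff i v * f i.

Definition dual_act (w : W) (f : dualspace) : dualspace :=
  fun i => pairing f (act (w^-1)%g (simple_root i)).

Definition chamber : set dualspace :=
  [set f | (forall i, 0 <= pairing f (simple_root i)) /\
           spherical s [set i | pairing f (simple_root i) = 0]].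

Definition tits_cone : set dualspace :=
  [set f | exists w, exists2 c, chamber c & f = dual_act w c].

Definition dual_reflection (a : rootspace) (f : dualspace) : dualspace :=
  fun i => pairing f (reflection a (simple_root i)).

Definition root_perp (a : rootspace) : set dualspace :=
  [set f | tits_cone f /\ dual_reflection a f = f].

Context (J : set Pi).

(* Intersected with the cone, so that the value is right for empty J. *)
Definition Jperp : set dualspace :=
  tits_cone `&` \bigcap_(i in J) root_perp (simple_root i).

Definition Jannihilator : set dualspace :=
  [set f | forall i, J i -> pairing f (simple_root i) = 0].

Definition preserves_J (w : W) : Prop :=
  act w @` (simple_root @` J) = simple_root @` J.

(* The last clause says that the fixed subspace has codimension 1 in the
   annihilator of J: f0 spans a complement of it. *)
Definition acts_by_reflection (w : W) : Prop :=
  [/\ preserves_J w,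
      (forall f, Jannihilator f -> dual_act w (dual_act w f) = f)
    & exists f0, [/\ Jannihilator f0, dual_act w f0 <> f0
        & forall f, Jannihilator f -> exists c : R,
            let g : dualspace := fun i => f i - c * f0 i in
            dual_act w g = g]].

Definition mirror (w : W) : set dualspace :=
  [set f | Jperp f /\ dual_act w f = f].

Definition W_max : set W := generated acts_by_reflection.

Definition mirror_complement : set dualspace :=
  Jperp `\` \bigcup_(w in W_max `&` acts_by_reflection) mirror w.

Definition is_C_max_open (C0 : set dualspace) : Prop :=
  exists2 f, mirror_complement f &
    C0 = connected_component mirror_complement f.

Context (C0 : set dualspace).

Definition C_max : set dualspace :=
  closure C0 `&` Jperp.

Definition Gamma_max : set W :=
  [set w | preserves_J w /\ dual_act w @` C_max = C_max].

Definition Gamma_max_vee : set W :=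
  [set w | Gamma_max w /\
           forall i, J i -> act w (simple_root i) = simple_root i].

End TitsCone.

Arguments dualspace R Pi : clear implicits.

(* Main.v *)
Require Import Defs.
From mathcomp Require Import all_boot all_order all_algebra finmap.
From mathcomp Require Import -(notations) monalg.
From mathcomp Require Import all_classical all_reals all_analysis.
From mathcomp Require Import zify ring lra.

(** The subspace J^perp is tiled by the chambers w C_K with K a set of simple
roots and w K = J, and C_max is a union of such chambers: two chambers sharing
a wall lie in the same C_max exactly when crossing the wall changes the type K.
For K of type A_m with m odd or D5 a type-changing wall occurs only inside
A_(m+1) (or a dihedral diagram if m = 1), respectively E6; the oddness of m is
what excludes D_(m+1).  Hence no two walls of a chamber of C_max can both
separate it from another chamber of C_max: the two extra nodes would create a
cycle or an affine diagram of type E6~, or crossing one wall would turn the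
other one into a mirror.  So the adjacency graph of the chambers of C_max is a
tree.  Gamma_max^vee acts on it by left translation, freely and, as the type of
a chamber is invariant, without inversions; therefore it is free.  Its index is
at most 2 because the diagram J has at most one nontrivial automorphism. *)

Set Implicit Arguments.
Unset Strict Implicit.
Unset Printing Implicit Defensive.

Import Order.TTheory GRing.Theory Num.Theory.
Import numFieldNormedType.Exports.
Local Open Scope classical_set_scope.
Local Open Scope ring_scope.

(** * Groups acting freely on trees *)

(** The tree is not built as a graph. Distance is the Coxeter length of w^-1 u, and being a tree is
    expressed through descents: for every u exactly one neighbour of w is closer to u. Freeness
    comes from a convex set S that meets each orbit once; the edges leaving S give the basis. [Pi]
    may be infinite, and K with one more node t may generate an infinite group, so neither longest
    elements nor positive definite forms are at hand. For L = K + t spherical the crossing is w_K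
    w_L; in general it is described by the signs it gives to the roots of L and is found from a
    shortest coset representative. An affine diagram is refuted by a nonnegative antidominant
    vector. For m + 1 even the longest element of D_(m+1) is -1, so crossings there keep the type;
    the proof meets this as a parity obstruction. In E6 the longest element exchanges the two
    subdiagrams D5. The link with the topology is one of signs: an element preserving C_max sends
    the centre of the base chamber into the closure of the component, where no mirror root changes
    sign. *)

Section Tree.
Local Open Scope group_scope.
Context {G : groupType} (H X : set G) (x0 : G).
Context (adj : G -> G -> Prop) (d : G -> G -> nat).

(** The first step of the geodesic from w to u. The function [d] need not be the graph distance; it
    will be a Coxeter length. *)
Definition next (u w w' : G) := [/\ X w', adj w w' & (d w' u < d w u)%N].

Hypothesis H_subgroup : is_subgroup H.
Hypothesis X_act : forall h x, H h -> X x -> X (h * x).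
Hypothesis X_base : X x0.
Hypothesis adj_sym : forall w w', X w -> X w' -> adj w w' -> adj w' w.
Hypothesis adj_act : forall h w w', H h -> adj w w' -> adj (h * w) (h * w').
Hypothesis d_act : forall h w w', H h -> d (h * w) (h * w') = d w w'.
Hypothesis d_refl : forall w, d w w = 0%N.
Hypothesis next_ex : forall w u, X w -> X u -> w <> u -> exists w', next u w w'.
Hypothesis next_uniq : forall u w w1 w2, X w -> X u ->
  next u w w1 -> next u w w2 -> w1 = w2.
Hypothesis adj_d : forall w w' u, X w -> X w' -> X u -> adj w w' -> d w u <> d w' u.
Hypothesis not_adj_orbit : forall h w, H h -> X w -> ~ adj w (h * w).

Let H1 : H 1. Proof. by case: H_subgroup. Qed.
Let HM x y : H x -> H y -> H (x * y). Proof. by case: H_subgroup => _ + _; apply. Qed.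
Let HV x : H x -> H x^-1. Proof. by case: H_subgroup => _ _; apply. Qed.

Lemma next_refl u w : ~ next u u w.
Proof. by case=> _ _; rewrite d_refl ltn0. Qed.

Lemma next_or u w w' : X w -> X w' -> X u -> adj w w' ->
  next u w w' \/ next u w' w.
Proof.
move=> Xw Xw' Xu a; case: (ltngtP (d w u) (d w' u)) => [lt|lt|eq].
- by right; split=> //; apply: adj_sym.
- by left; split.
- by case: (adj_d Xw Xw' Xu a).
Qed.

Lemma next_adj w u : X w -> X u -> adj w u -> next u w u.
Proof.
move=> Xw Xu a; case: (next_or Xw Xu Xu a) => // n; by case: (next_refl n).
Qed.

Lemma next_back u w w' : X w -> X w' -> X u -> adj w w' -> ~ next u w w' ->
  next u w' w.
Proof. by move=> Xw Xw' Xu a n; case: (next_or Xw Xw' Xu a). Qed.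

Lemma next_act h u w w' : H h -> next u w w' -> next (h * u) (h * w) (h * w').
Proof.
by move=> hh [Xw' a lt]; split; [exact: X_act|exact: adj_act|rewrite !d_act].
Qed.

(** In a tree these are the subtrees: the geodesic between two points of S stays in S. *)
Definition convex (S : set G) :=
  S `<=` X /\ forall z q z', S z -> S q -> next q z z' -> S z'.

Lemma convex_act h S : H h -> convex S -> convex [set h * x | x in S].
Proof.
move=> hh [SX cS]; split=> [_ [x Sx <-]|_ _ z' [z Sz <-] [q Sq <-] n].
  exact/X_act/SX.
exists (h^-1 * z'); last by rewrite mulVKg.
by apply: (cS z q) => //; have := next_act (HV hh) n; rewrite !mulKg.
Qed.

(* The geodesics from points of a convex set S to a point u leave S through the single gate q. *)
Lemma convex_gate S q u r z z' : convex S -> X u -> S q -> next u q r -> ~ S r ->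
  S z -> next q z z' -> next u z z'.
Proof.
move=> [SX cS] Xu Sq nr Sr.
have [n] := ubnP (d z q); elim: n z z' => // n IH z z' len Sz nz.
have Sz' := cS _ _ _ Sz Sq nz; have [Xz' a lt] := nz.
have az : adj z' z by apply: adj_sym => //; exact: SX.
apply: (next_back Xz' _ Xu az); first exact: SX.
case: (pselect (z' = q)) => [e|ne] nz'.
  by move: nz'; rewrite e => nz'; apply: Sr; rewrite (next_uniq (SX _ Sq) Xu nr nz').
have [z'' nz''] := next_ex Xz' (SX _ Sq) ne.
have nu : next u z' z'' by apply: IH => //; exact: leq_trans lt _.
have e := next_uniq Xz' Xu nu nz'; case: nz'' => _ _; rewrite e => lt'.
by have := ltn_trans lt lt'; rewrite ltnn.
Qed.

(** A lift through [x0] of a subtree of the quotient by H; a maximal one lifts a spanning tree. *)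
Definition section_set (S : set G) :=
  [/\ convex S, S x0 & forall h x, H h -> S x -> S (h * x) -> h = 1].

(** If a maximal section missed an orbit, then on the way to [x0] there would be an edge from a
    missed vertex to a translate of S. Its outer end, translated back, could be added to S as a
    leaf. *)
Lemma section_exists : exists2 S, section_set S &
  forall x, X x -> exists h y, [/\ H h, S y & x = h * y].
Proof.
(* [x0] is adjoined outside the variable set so that the union of the empty chain is admissible
   too. *)
have [F totF tot|A [PA maxA]] := @Zorn_bigcup G (fun S => section_set (x0 |` S)).
  have aux z q : (x0 |` \bigcup_(B in F) B) z -> (x0 |` \bigcup_(B in F) B) q ->
      (z = x0 /\ q = x0) \/ exists B, [/\ F B, (x0 |` B) z & (x0 |` B) q].
    case=> [->|[B FB Bz]]; case=> [->|[C FC Cq]]; first by left.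
    - by right; exists C; split; [|left|right].
    - by right; exists B; split; [|right|left].
    - right; case: (tot _ _ FB FC) => s.
        by exists C; split; [|right; apply: s|right].
      by exists B; split; [|right|right; apply: s].
  split; first split.
  - move=> x [->//|[B FB Bx]]; case: (totF _ FB) => [[+ _] _ _]; apply; by right.
  - move=> z q z' Sz Sq n; case: (aux z q Sz Sq) => [[ez eq]|[B [FB Bz Bq]]].
      by move: n; rewrite ez eq => /next_refl.
    case: (totF _ FB) => [[_ cB] _ _]; case: (cB _ _ _ Bz Bq n) => [->|Bz']; first by left.
    by right; exists B.
  - by left.
  - move=> h x hh Sx Shx; case: (aux _ _ Sx Shx) => [[ex ehx]|[B [FB Bx Bhx]]].
      by apply: (mulIg x); rewrite mul1g ehx ex.
    by case: (totF _ FB) => _ _; apply; [exact: hh|exact: Bx|].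
exists (x0 |` A) => //; set S := x0 |` A; case: PA => cS Sx0 uS.
have [SX cS'] := cS.
move=> x; have [n] := ubnP (d x x0); elim: n x => // n IH x len Xx.
case: (pselect (x = x0)) => [->|ne]; first by exists 1, x0; rewrite mul1g.
have [x' [Xx' a lt]] := next_ex Xx X_base ne.
have [h [y [hh Sy e]]] := IH x' (leq_trans lt len) Xx'.
apply: contrapT => nex.
(* Moved back by h, the edge from x to x' joins v to the point y of S, and no translate of S
   contains v. *)
pose v := h^-1 * x.
have Xv : X v by apply: X_act => //; exact: HV.
have Xy := SX _ Sy.
have avy : adj v y by have := adj_act (HV hh) a; rewrite e mulKg.
have ayv := adj_sym Xv Xy avy.
have nvo g s : H g -> S s -> v <> g * s.
  move=> hg Ss ev; apply: nex; exists (h * g), s; split=> //; first exact: HM.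
  by rewrite -mulgA -ev mulVKg.
have Sv : ~ S v by move=> Sv; apply: (nvo 1 v) => //; rewrite mul1g.
apply: (maxA (v |` A)); first by rewrite properEneq; split; [
  apply/eqP => e'; apply: Sv; right; rewrite e'; left | move=> ? ?; right].
have -> : x0 |` (v |` A) = v |` S by rewrite /S setUCA.
split.
- split=> [z [->//|/SX//]|z q z' [->|Sz] [->|Sq] nz].
  + by case: (next_refl nz).
  + right; case: (pselect (q = y)) => [eq|neq].
      by move: nz; rewrite eq => nz; rewrite (next_uniq Xv Xy nz (next_adj Xv Xy avy)).
    suff nvy : next q v y by rewrite (next_uniq Xv (SX _ Sq) nz nvy).
    apply: next_back => //; first exact: SX.
    by move=> nn; apply/Sv/(cS' _ _ _ Sy Sq nn).
  + have nyv := next_adj Xy Xv ayv.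
    case: (pselect (z = y)) => [ez|nezy].
      by left; move: nz; rewrite ez => nz; rewrite (next_uniq Xy Xv nz nyv).
    have [z1 nz1] := next_ex (SX _ Sz) Xy nezy.
    have nz1' := convex_gate cS Xv Sy nyv Sv Sz nz1.
    right; rewrite (next_uniq (SX _ Sz) Xv nz nz1').
    exact: cS' Sz Sy nz1.
  + right; exact: cS' Sz Sq nz.
- by right.
- move=> g z hg [->|Sz] [gz|Sgz].
  + by apply: (mulIg v); rewrite gz mul1g.
  + by case: (nvo g^-1 (g * v) (HV hg) Sgz); rewrite mulKg.
  + by case: (nvo g z hg Sz).
  + exact: uS hg Sz Sgz.
Qed.


(** * Generators read off from the edges that leave a section *)

Section Generators.
Context (S : set G) (secS : section_set S).
Hypothesis coverS : forall x, X x -> exists h y, [/\ H h, S y & x = h * y].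

Let SX : S `<=` X. Proof. by case: secS => -[]. Qed.
Let cS : convex S. Proof. by case: secS. Qed.
Let Sx0 : S x0. Proof. by case: secS. Qed.
Let uS h x : H h -> S x -> S (h * x) -> h = 1. Proof. by case: secS => _ _; apply. Qed.

(** The translates of S partition the vertices; contracting each of them turns the tree into the
    Cayley graph of H for these elements. *)
Definition edge_gen : set G :=
  [set h | [/\ H h, h <> 1 & exists a b, [/\ S a, S b & adj a (h * b)]]].

Lemma edge_genV h : edge_gen h -> edge_gen h^-1.
Proof.
case=> hh h1 [a [b [Sa Sb ab]]]; split; first exact: HV.
  by move=> e; apply: h1; rewrite -(invgK h) e invg1.
exists b, a; split=> //; have := adj_act (HV hh) ab; rewrite mulKg.
by apply: adj_sym; [apply: X_act; [exact: HV|exact: SX]|exact: SX].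
Qed.

(** Each step of the geodesic from [x0] to g x0 stays in a translate of S or passes to a
    neighbouring one, which contributes a generator. *)
Lemma edge_gen_generates : generated edge_gen = H.
Proof.
apply/seteqP; split=> [x gx|g hg].
  by apply: gx; split=> // h [].
pose K := generated edge_gen.
have [K1 KM KV] : is_subgroup K.
  split=> [B [[]]//|x y Kx Ky B BB|x Kx B BB]; have [[_ m v] _] := BB.
    by apply: m; [exact: Kx|exact: Ky].
  by apply: v; exact: Kx.
have KE h : edge_gen h -> K h by move=> eh B [_]; apply.
suff aux n w h y : (d w (g * x0) < n)%N -> X w -> H h -> S y -> w = h * y -> K (h^-1 * g).
  have := aux _ x0 1 x0 (leqnn _) X_base H1 Sx0; rewrite invg1 !mul1g; exact.
elim: n w h y => // n IH w h y len Xw hh Sy e.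
case: (pselect (w = g * x0)) => [ew|ne].
  have -> : h^-1 * g = 1; last by [].
  apply: (@uS _ x0) => //; first by apply: HM => //; exact: HV.
  by rewrite -mulgA -ew e mulKg.
have [w' [Xw' a lt]] := next_ex Xw (X_act hg X_base) ne.
have [h' [y' [hh' Sy' e']]] := coverS Xw'.
have Kh' := IH _ _ _ (leq_trans lt len) Xw' hh' Sy' e'.
have -> : h^-1 * g = (h^-1 * h') * (h'^-1 * g) by rewrite mulgA mulgK.
apply: KM => //; case: (pselect (h^-1 * h' = 1)) => [->//|n1].
apply: KE; split=> //; first by apply: HM => //; exact: HV.
exists y, y'; split=> //; have := adj_act (HV hh) a.
by rewrite e e' mulKg mulgA.
Qed.

(* A walk has moved away from x0 when it last left g l^-1 S for g S; this persists along reduced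
words, so such a walk never comes back to S. *)
Definition entered (g l : G) := H g /\ exists q r,
  [/\ [set g * x | x in S] q, next x0 q r, ~ [set g * x | x in S] r
    & [set g * l^-1 * x | x in S] r].

Lemma entered_start a : edge_gen a -> entered a a.
Proof.
case=> ha a1 [x [y [Sx Sy axy]]]; split=> //; exists (a * y), x.
have nax : ~ [set a * x | x in S] x.
  by case=> z Sz e; apply: a1; apply: (uS ha Sz); rewrite e.
split=> //; first by exists y.
  apply: next_back => //; [exact: SX|apply: X_act => //; exact: SX|].
  move=> n; apply: a1; apply: (uS ha Sy).
  by case: cS => _ /(_ x x0 (a * y)); apply.
by exists x => //; rewrite mulgV mul1g.
Qed.

(** Suppose the edge from g S to g a S led towards [x0]. All geodesics from g S to [x0] leave at q
    for r, so the edge would end at r, in g l^-1 S, and this forces l a = 1. *)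
Lemma entered_step g l a : edge_gen a -> H l -> l * a <> 1 -> entered g l ->
  entered (g * a) a.
Proof.
case=> ha a1 [x [y [Sx Sy axy]]] hl la [hg [q [r [Sq nr nSr [p Sp ep]]]]].
have hga : H (g * a) by exact: HM.
have Xx := SX Sx; have Xy := SX Sy.
split=> //; exists (g * a * y), (g * x).
have adj' : adj (g * x) (g * a * y) by rewrite -mulgA; exact: adj_act.
have nS z : S z -> g * a * y <> g * z.
  move=> Sz e; apply: a1; apply: (uS ha Sy).
  by move: e; rewrite -mulgA => /mulgI ->.
split=> //.
- by exists y.
- apply: next_back => //; [exact: X_act|exact: X_act|].
  move=> n; case: (pselect (g * x = q)) => [e|ne].
    move: n; rewrite e => n.
    have Xq : X q by rewrite -e; exact: X_act.
    have := next_uniq Xq X_base nr n; rewrite -ep -!mulgA => /mulgI e2.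
    apply: la; apply: (uS _ Sy); first exact: HM.
    by rewrite -mulgA -e2 mulVKg.
  have cgS := convex_act hg cS.
  have Xgx : X (g * x) by exact: X_act.
  have Xq : X q by case: cgS => + _; apply.
  have [z1 n1] := next_ex Xgx Xq ne.
  have gx : [set g * x | x in S] (g * x) by exists x.
  have n2 := convex_gate cgS X_base Sq nr nSr gx n1.
  case: cgS => _ /(_ _ _ _ gx Sq n1) [z Sz ez].
  by apply: (nS z Sz); rewrite ez; exact: (next_uniq Xgx X_base n n2).
- case=> z Sz; rewrite -mulgA => /mulgI e; apply: a1; apply: (uS ha Sz).
  by rewrite e.
- by exists x => //; rewrite mulgK.
Qed.

Lemma entered_neq1 g l : entered g l -> g <> 1.
Proof.
case=> _ [q [r [Sq nr nSr _]]] g1; apply: nSr; move: Sq; rewrite g1.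
case=> z Sz; rewrite mul1g => ez; exists r; rewrite ?mul1g //.
by case: cS => _ /(_ q x0 r); apply => //; rewrite -ez.
Qed.

Lemma reduced_prod_neq1 (l : seq G) : l != [::] ->
  (forall a, a \in l -> edge_gen a) -> sorted (fun a b => a * b != 1) l ->
  \prod_(a <- l) a <> 1.
Proof.
case: l => // a l _ gl srt; rewrite big_cons.
have /entered_start ent : edge_gen a by apply: gl; rewrite mem_head.
have Ha : H a by have [] : edge_gen a by apply: gl; rewrite mem_head.
have {}gl b : b \in l -> edge_gen b by move=> bl; apply: gl; rewrite inE bl orbT.
move: srt; rewrite /=; suff aux g : entered g a -> path (fun a b => a * b != 1) a l ->
  g * \prod_(j <- l) j <> 1 by exact: aux.
elim: l a g gl Ha {ent} => [|b l IH] a g gl Ha ent.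
  by rewrite big_nil mulg1 => _; exact: entered_neq1 ent.
move=> /= /andP[/eqP ab pth].
have gb : edge_gen b by apply: gl; rewrite mem_head.
rewrite big_cons mulgA; apply: (IH b) => //.
- by move=> c cl; apply: gl; rewrite inE cl orbT.
- by case: gb.
- exact: entered_step ent.
Qed.

(* An edge between S and aS is unique; if a were an involution then it would invert that edge. *)
Lemma edge_gen_not_involution a : edge_gen a -> a * a <> 1.
Proof.
move=> [ha a1 [x [y [Sx Sy axy]]]] aa.
have Xx := SX Sx; have Xy := SX Sy.
have Xay : X (a * y) by exact: X_act.
have Xax : X (a * x) by exact: X_act.
have aV : a^-1 = a by apply: mulg1_eq.
have ayx : adj y (a * x).
  have := adj_act ha axy; rewrite mulgA aa mul1g => h; exact: adj_sym.
have naS z : S z -> ~ S (a * z) by move=> Sz Saz; apply: a1; exact: uS ha Sz Saz.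
have [e|ne] := pselect (x = y).
  by apply: (not_adj_orbit ha Xx); rewrite {2}e.
have nx := next_adj Xx Xay axy.
have [z1 n1] := next_ex Xy Xx (nesym ne).
have n2 := convex_gate cS Xay Sx nx (naS _ Sy) Sy n1.
have Sz1 : S z1 by case: cS => _ /(_ y x z1); apply.
have n3 : next (a * y) (a * x) y.
  apply: next_back => // n; apply: (naS _ Sx).
  by rewrite -(next_uniq Xy Xay n2 n).
case: (convex_act ha cS) => _ /(_ (a * x) (a * y) y) h.
have [||z Sz e] := h _ _ n3; [by exists x|by exists y|].
by apply: (naS z Sz); rewrite e.
Qed.

(** Chooses one of h and h^-1, the same for both, so that the basis contains one element of each
    inverse pair. *)
Definition canon (h : G) : G := choose [pred z | (z == h) || (z == h^-1)] h.

Lemma canonV h : canon h^-1 = canon h.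
Proof.
rewrite /canon invgK (@eq_choose _ _ [pred z | (z == h) || (z == h^-1)]); last first.
  by move=> z /=; rewrite orbC.
by apply: choose_id; rewrite /= eqxx ?orbT.
Qed.

Lemma canonP h : canon h = h \/ canon h = h^-1.
Proof.
have : [pred z | (z == h) || (z == h^-1)] (canon h) by apply: chooseP; rewrite /= eqxx.
by case/orP=> /eqP; [left|right].
Qed.

Lemma tree_section_free : is_free_group H.
Proof.
exists [set h | edge_gen h /\ canon h = h]; split.
  rewrite -[RHS]edge_gen_generates; apply/seteqP; split=> x gx B [sB BB].
    by apply: gx; split=> // h [eh _]; apply: BB.
  apply: gx; split=> // h eh; case: (canonP h) => e; first by apply: BB.
  case: sB => _ _ /(_ h^-1); rewrite invgK; apply; apply: BB; split.
    exact: edge_genV.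
  by rewrite canonV.
move=> u uB ru un; rewrite -(big_map letter_val predT id).
apply: reduced_prod_neq1.
- by case: u un {uB ru}.
- move=> b /mapP[c cu ->]; have [ec _] := uB _ cu; rewrite /letter_val.
  by case: c.2 => //; exact: edge_genV.
rewrite sorted_map; apply: (sub_in_sorted (P := mem u) _ _ ru); last exact/allP.
move=> [x e] [y f] xu yu /=; rewrite negb_and negbK => xy.
have [gx cx] := uB _ xu; have [gy cy] := uB _ yu; rewrite /= in gx cx gy cy.
apply/eqP; rewrite /letter_val /=.
have gx2 := edge_gen_not_involution gx.
case: (pselect (x = y)) xy => [exy|nxy].
  rewrite exy eqxx /= => /eqP <-; case: (e) => h; apply: gx2; rewrite exy //.
  by move/(congr1 (fun z => z^-1)): h; rewrite invgF invgK invg1.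
move=> _ h; apply: nxy; rewrite -cx -cy.
case: (e) (f) h => -[] /mulg1_eq.
- by rewrite invgK => ->; rewrite canonV.
- by rewrite invgK => ->.
- by move/invg_inj => ->.
- by move=> <-; rewrite canonV.
Qed.

End Generators.

Theorem tree_action_free : is_free_group H.
Proof. by have [S secS coverS] := section_exists; exact: tree_section_free coverS. Qed.

End Tree.

(** * Vectors of finite support and their pairing with functionals *)

Section Coefficients.
Context {R : realType} {Pi : choiceType}.
Notation V := (@rootspace R Pi).
Implicit Types (u v w : V) (i j : Pi) (c : R).

Definition vcoef i v : R := mcoeff i v.

Lemma vcoefD i u v : vcoef i (u + v) = vcoef i u + vcoef i v.
Proof. exact: mcoeffD. Qed.

Lemma vcoefN i v : vcoef i (- v) = - vcoef i v.
Proof. exact: mcoeffN. Qed.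

Lemma vcoefB i u v : vcoef i (u - v) = vcoef i u - vcoef i v.
Proof. exact: mcoeffB. Qed.

Lemma vcoefZ i c v : vcoef i (c *: v) = c * vcoef i v.
Proof. exact: mcoeffZ. Qed.

Lemma vcoef0 i : vcoef i 0 = 0.
Proof. exact: mcoeff0. Qed.

Lemma vcoef_simple i j : vcoef i (simple_root R j) = (i == j)%:R.
Proof. by rewrite /vcoef /simple_root mcoeffU eq_sym. Qed.

Lemma vcoef_sum i (I : Type) (r : seq I) (P : pred I) (F : I -> V) :
  vcoef i (\sum_(x <- r | P x) F x) = \sum_(x <- r | P x) vcoef i (F x).
Proof. by elim/big_rec2: _ => [|x a b _ <-]; rewrite ?vcoef0 // vcoefD. Qed.

Lemma vcoefP u v : (forall i, vcoef i u = vcoef i v) -> u = v.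
Proof. by move=> h; apply/malgP. Qed.

Lemma rootspaceE v : v = \sum_(i <- msupp v) vcoef i v *: simple_root R i.
Proof.
apply: vcoefP => k; rewrite vcoef_sum.
under eq_bigr do rewrite vcoefZ vcoef_simple.
have [kv|kv] := boolP (k \in msupp v).
  rewrite (big_rem k) //= eqxx mulr1 big_seq big1 ?addr0 // => i.
  by rewrite mem_rem_uniq // inE => /andP[/negbTE ik _]; rewrite eq_sym ik mulr0.
rewrite big_seq big1 => [|i iv]; first exact: mcoeff_outdom.
by case: eqP => [ki|_]; rewrite ?mulr0 //; case/negP: kv; rewrite ki.
Qed.

Lemma rootspace_ind (P : V -> Prop) : P 0 ->
  (forall c i v, P v -> P (c *: simple_root R i + v)) -> forall v, P v.
Proof.
by move=> P0 PS v; rewrite (rootspaceE v); elim/big_rec: _ => // i x _ Px; apply: PS.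
Qed.

Lemma pairing_linear (f : dualspace R Pi) c u v :
  pairing f (c *: u + v) = c * pairing f u + pairing f v.
Proof.
rewrite /pairing -!(@mmapE Pi R R idfun f).
etransitivity; first exact: mmapD.
congr (_ + _); rewrite mulr_sumr; etransitivity.
  exact: (mmapEw (f := idfun) (d := msupp u) (msuppZ_le c u)).
by apply: eq_bigr => i _; rewrite [mcoeff _ _]vcoefZ mulrA.
Qed.

Lemma pairing0 (f : dualspace R Pi) : pairing f 0 = 0.
Proof. by have := pairing_linear f (-1) 0 0; rewrite scaler0 addr0; lra. Qed.

Lemma pairingD f u v : pairing f (u + v) = pairing f u + pairing f v.
Proof. by have := pairing_linear f 1 u v; rewrite scale1r mul1r. Qed.

Lemma pairingZ f c v : pairing f (c *: v) = c * pairing f v.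
Proof. by have := pairing_linear f c v 0; rewrite pairing0 !addr0. Qed.

Lemma pairingN f v : pairing f (- v) = - pairing f v.
Proof. by rewrite -scaleN1r pairingZ mulN1r. Qed.

Lemma pairingB f u v : pairing f (u - v) = pairing f u - pairing f v.
Proof. by rewrite pairingD pairingN. Qed.

Lemma pairing_simple f i : pairing f (simple_root R i) = f i.
Proof. by rewrite /pairing /simple_root msuppU oner_eq0 big_seq_fset1 mcoeffUU mul1r. Qed.

Lemma pairing_sum f (I : Type) (r : seq I) (P : pred I) (F : I -> V) :
  pairing f (\sum_(x <- r | P x) F x) = \sum_(x <- r | P x) pairing f (F x).
Proof. by elim/big_rec2: _ => [|x a b _ <-]; rewrite ?pairing0 // pairingD. Qed.

End Coefficients.

(** * The geometric representation *)

Section Order.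
Context {G : groupType}.

Lemma elt_order_pos (g : G) n : (0 < n)%N -> (g ^+ n = 1)%g ->
  [/\ (0 < elt_order g)%N, (g ^+ elt_order g = 1)%g & (elt_order g <= n)%N].
Proof.
move=> n0 gn; rewrite /elt_order; case: pselect => [e|[]]; last by exists n; rewrite n0 gn eqxx.
by case: ex_minnP => m /andP[m0 /eqP gm] mn; split=> //; apply: mn; rewrite n0 gn eqxx.
Qed.

Lemma elt_orderX (g : G) : (g ^+ elt_order g = 1)%g.
Proof.
rewrite /elt_order; case: pselect => [e|_] //.
by case: ex_minnP => m /andP[_ /eqP].
Qed.

Lemma elt_order1 : elt_order (1%g : G) = 1%N.
Proof.
have [] := @elt_order_pos 1%g 1%N isT (expg1n _ _).
by case: elt_order => [|[|]].
Qed.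

Lemma elt_orderV (g : G) : elt_order (g^-1)%g = elt_order g.
Proof.
have le (h : G) : (elt_order h^-1%g <= elt_order h)%N.
  have [h0|h0] := posnP (elt_order h).
    have [->//|k0] := posnP (elt_order h^-1%g).
    have := elt_orderX h^-1%g; rewrite expVgn => /(congr1 (fun x => x^-1%g)).
    by rewrite invgK invg1 => /(elt_order_pos k0) []; rewrite h0.
  have [] // := @elt_order_pos h^-1%g _ h0.
  by rewrite expVgn elt_orderX invg1.
by apply/eqP; rewrite eqn_leq le /= -{1}(invgK g) le.
Qed.

End Order.

Section RootForm.
Context {R : realType} {Pi : choiceType} {W : groupType} (s : Pi -> W).
Notation V := (@rootspace R Pi).
Notation "''a_' i" := (simple_root R i) (at level 8, i at level 2, format "''a_' i").
Notation gram := (gram R s).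
Implicit Types (u v w : V) (i j : Pi) (c : R).

(** The double sum is an iterated pairing, so bilinearity is inherited from the linearity of
    [pairing]. *)
Lemma root_formE u v :
  root_form s u v = pairing (fun i => pairing (fun j => gram i j) v) u.
Proof.
rewrite /root_form /pairing; apply: eq_bigr => i _; rewrite mulr_sumr.
by apply: eq_bigr => j _; rewrite mulrA.
Qed.

Lemma rformDl u v w : root_form s (u + v) w = root_form s u w + root_form s v w.
Proof. by rewrite !root_formE pairingD. Qed.

Lemma rformZl c u v : root_form s (c *: u) v = c * root_form s u v.
Proof. by rewrite !root_formE pairingZ. Qed.

Lemma rform0l v : root_form s 0 v = 0.
Proof. by rewrite root_formE pairing0. Qed.

Lemma gram_sym (s2 : forall i, (s i * s i = 1)%g) i j : gram i j = gram j i.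
Proof.
rewrite /Defs.gram /coxeter_matrix -elt_orderV.
have gen_inv k : ((s k)^-1 = s k)%g by exact: mulg1_eq.
by rewrite invgM !gen_inv.
Qed.

Hypothesis s2 : forall i, (s i * s i = 1)%g.

Lemma rformC u v : root_form s u v = root_form s v u.
Proof.
rewrite /root_form exchange_big /=; apply: eq_bigr => i _; apply: eq_bigr => j _.
by rewrite (gram_sym s2) [mcoeff j u * _]mulrC.
Qed.

Lemma rformDr u v w : root_form s w (u + v) = root_form s w u + root_form s w v.
Proof. by rewrite rformC rformDl !(rformC w). Qed.

Lemma rformZr c u v : root_form s v (c *: u) = c * root_form s v u.
Proof. by rewrite rformC rformZl rformC. Qed.

Lemma rform0r v : root_form s v 0 = 0.
Proof. by rewrite rformC rform0l. Qed.

Lemma rformNr u v : root_form s v (- u) = - root_form s v u.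
Proof. by rewrite -scaleN1r rformZr mulN1r. Qed.

Lemma rformBr u v w : root_form s w (u - v) = root_form s w u - root_form s w v.
Proof. by rewrite rformDr rformNr. Qed.

Lemma rformBl u v w : root_form s (u - v) w = root_form s u w - root_form s v w.
Proof. by rewrite rformC rformBr !(rformC w). Qed.

Lemma rform_sumr (I : Type) (r : seq I) (P : pred I) (F : I -> V) v :
  root_form s v (\sum_(x <- r | P x) F x) = \sum_(x <- r | P x) root_form s v (F x).
Proof. by elim/big_rec2: _ => [|x a b _ <-]; rewrite ?rform0r // rformDr. Qed.

Lemma rform_simple i j : root_form s 'a_i 'a_j = gram i j.
Proof. by rewrite root_formE !pairing_simple. Qed.

Lemma gram_diag i : gram i i = 1.
Proof. by rewrite /Defs.gram /coxeter_matrix s2 elt_order1 divr1 cospi opprK. Qed.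

Definition simple_reflection i v : V := v - (2 * root_form s 'a_i v) *: 'a_i.

Lemma reflE i : reflection s 'a_i = simple_reflection i. Proof. by []. Qed.

Lemma srefl_linear i c u v : simple_reflection i (c *: u + v) = c *: simple_reflection i u + simple_reflection i v.
Proof.
rewrite /simple_reflection rformDr rformZr; apply: vcoefP => k.
by rewrite !(vcoefD, vcoefN, vcoefZ); ring.
Qed.

Lemma sreflK i : involutive (simple_reflection i).
Proof.
move=> v; rewrite /simple_reflection rformBr rformZr rform_simple gram_diag.
by apply: vcoefP => k; rewrite !(vcoefB, vcoefZ); ring.
Qed.

Lemma srefl_form i u v : root_form s (simple_reflection i u) (simple_reflection i v) = root_form s u v.
Proof.
rewrite /simple_reflection !(rformBl, rformBr, rformZl, rformZr) rform_simple gram_diag.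
by rewrite (rformC u 'a_i); ring.
Qed.

Definition word_rep (l : seq Pi) (v : V) : V := foldr simple_reflection v l.

Lemma rep_linear l c u v : word_rep l (c *: u + v) = c *: word_rep l u + word_rep l v.
Proof. by elim: l => //= i l ->; rewrite srefl_linear. Qed.

Lemma rep0 l : word_rep l 0 = 0.
Proof. by have := rep_linear l (-1) 0 0; rewrite scaler0 addr0 scaleN1r addNr. Qed.

Lemma repD l u v : word_rep l (u + v) = word_rep l u + word_rep l v.
Proof. by have := rep_linear l 1 u v; rewrite !scale1r. Qed.

Lemma repZ l c v : word_rep l (c *: v) = c *: word_rep l v.
Proof. by have := rep_linear l c v 0; rewrite rep0 !addr0. Qed.

Lemma rep_cat l l' v : word_rep (l ++ l') v = word_rep l (word_rep l' v).
Proof. by rewrite /word_rep foldr_cat. Qed.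

Lemma rep_form l u v : root_form s (word_rep l u) (word_rep l v) = root_form s u v.
Proof. by elim: l => //= i l IH; rewrite srefl_form. Qed.

Lemma rep_revK l v : word_rep l (word_rep (rev l) v) = v.
Proof.
elim/last_ind: l v => // l i IH v.
by rewrite rev_rcons /= -cats1 rep_cat /= sreflK IH.
Qed.

End RootForm.

(** * Chebyshev polynomials for rank two *)

Section Dihedral.
Context {R : realType}.

(** [chebU c n] is U_(n-1)(c / 2), a Chebyshev polynomial of the second kind. The recursion has
    depth two, hence the pair. *)
Fixpoint cheb (c : R) (n : nat) : R * R :=
  if n is n'.+1 then let p := cheb c n' in (p.2, c * p.2 - p.1) else (0, 1).

Definition chebU c n := (cheb c n).1.

Lemma chebU0 c : chebU c 0 = 0. Proof. by []. Qed.
Lemma chebU1 c : chebU c 1 = 1. Proof. by []. Qed.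
Lemma chebUSS c n : chebU c n.+2 = c * chebU c n.+1 - chebU c n.
Proof. by []. Qed.

Lemma chebU_sin (t : R) n : chebU (2 * cos t) n * sin t = sin (n%:R * t).
Proof.
have [m] := ubnP n; elim: m n => // m IH [|[|n]] lt.
- by rewrite mul0r mul0r sin0.
- by rewrite !mul1r.
rewrite chebUSS mulrBl -[X in X - _]mulrA !IH //; last by rewrite ltnW.
have -> : n.+2%:R * t = n.+1%:R * t + t by rewrite -(natr1 n.+1); ring.
have -> : n%:R * t = n.+1%:R * t - t by rewrite -(natr1 n); ring.
by rewrite !sinD sinN cosN; ring.
Qed.

(** The value c = 2 belongs to infinite order, where the angle is 0 and [chebU_sin] gives no
    information. *)
Lemma chebU_2 n : chebU 2 n = n%:R.
Proof.
have [m] := ubnP n; elim: m n => // m IH [|[|n]] lt //.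
by rewrite chebUSS !IH //; [rewrite -(natr1 n.+1) -(natr1 n); ring|rewrite ltnW].
Qed.

End Dihedral.

(** * The linear action of W and the length function *)

Section Representation.
Context {R : realType} {Pi : choiceType} {W : groupType} (s : Pi -> W).
Hypothesis hW : is_coxeter_system s.
Notation V := (@rootspace R Pi).
Notation "''a_' i" := (simple_root R i) (at level 8, i at level 2, format "''a_' i").
Notation gram := (gram R s).
Notation rep := (@word_rep R Pi W s).
Notation srefl := (@simple_reflection R Pi W s).
Implicit Types (u v : V) (w : W) (i j : Pi) (c : R).

Let s_inj : injective s. Proof. by case: hW. Qed.
Lemma gen_sq i : (s i * s i = 1)%g. Proof. by case: hW. Qed.

Lemma gen_inv i : ((s i)^-1 = s i)%g. Proof. by apply: mulg1_eq; exact: gen_sq. Qed.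

(** Minus an entry of the Cartan matrix: 2 cos(pi / m), or 2 for infinite order. *)
Definition gramc i j : R := - (2 * gram i j).

Lemma gramcC i j : gramc i j = gramc j i.
Proof. by rewrite /gramc (gram_sym gen_sq). Qed.

Lemma coxeter_matrixC i j : coxeter_matrix s i j = coxeter_matrix s j i.
Proof. by rewrite /coxeter_matrix -elt_orderV invgM !gen_inv. Qed.

Lemma coxeter_matrix_neq1 i j : i != j -> coxeter_matrix s i j != 1%N.
Proof.
move=> ij; apply/eqP => e; have := elt_orderX (s i * s j)%g.
rewrite -/(coxeter_matrix s i j) e expg1 => /mulg1_eq.
by rewrite gen_inv => /s_inj /eqP; rewrite (negbTE ij).
Qed.

Lemma gramE i j : (0 < coxeter_matrix s i j)%N ->
  gram i j = - cos (pi / (coxeter_matrix s i j)%:R).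
Proof. by rewrite /Defs.gram; case: coxeter_matrix. Qed.

Lemma gramc_inf i j : coxeter_matrix s i j = 0%N -> gramc i j = 2.
Proof. by rewrite /gramc /Defs.gram => ->; ring. Qed.

Lemma sin_pi_div m : (1 < m)%N -> 0 < sin (pi / m%:R : R).
Proof.
move=> m1; have m0 : 0 < m%:R :> R by rewrite ltr0n ltnW.
apply: sin_gt0_pi; rewrite divr_gt0 ?pi_gt0 //= ltr_pdivrMr // ltr_pMr ?pi_gt0 //.
by rewrite ltr1n.
Qed.

Lemma chebU_coxeter i j n : (1 < coxeter_matrix s i j)%N ->
  chebU (gramc i j) n =
  sin (n%:R * (pi / (coxeter_matrix s i j)%:R)) / sin (pi / (coxeter_matrix s i j)%:R).
Proof.
move=> m1; rewrite /gramc gramE ?(ltnW m1) // mulrN opprK -chebU_sin mulfK //.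
by rewrite gt_eqF // sin_pi_div.
Qed.

(** For n <= m the angle n pi / m lies in [0, pi]; for infinite order the value is n. *)
Lemma chebU_ge0 i j n : i != j ->
  (coxeter_matrix s i j = 0)%N \/ (n <= coxeter_matrix s i j)%N ->
  0 <= chebU (gramc i j) n.
Proof.
move=> ij; have [m0 _|m0 [m0'|nm]] := posnP (coxeter_matrix s i j).
- by rewrite gramc_inf // chebU_2 ler0n.
- by rewrite m0' in m0.
have m1 : (1 < coxeter_matrix s i j)%N by have := coxeter_matrix_neq1 ij; lia.
rewrite chebU_coxeter //; apply: divr_ge0; last exact/ltW/sin_pi_div.
have m0r : 0 < (coxeter_matrix s i j)%:R :> R by rewrite ltr0n.
apply: sin_ge0_pi; rewrite mulr_ge0 ?divr_ge0 ?pi_ge0 ?ler0n //=.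
rewrite mulrCA ler_piMr ?pi_ge0 // ler_pdivrMr // mul1r ler_nat //.
Qed.

Lemma gram_lt i j : i != j -> (0 < coxeter_matrix s i j)%N -> gram i j ^+ 2 != 1.
Proof.
move=> ij m0; have m1 : (1 < coxeter_matrix s i j)%N.
  by have := coxeter_matrix_neq1 ij; lia.
rewrite gramE // sqrrN; have := cos2Dsin2 (pi / (coxeter_matrix s i j)%:R : R).
have := sin_pi_div m1 => sp; apply: contra_eq_neq => ->.
rewrite -subr_eq0 addrC addKr sqrf_eq0; exact: lt0r_neq0.
Qed.

Definition alt i j n := if odd n then j else i.

(** Alternating words are anchored at the right: the last letter is j for every n > 0, while the
    first one depends on the parity of n. *)
Fixpoint altw i j n : seq Pi :=
  if n is n'.+1 then alt i j n :: altw i j n' else [::].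

Lemma altS i j n : alt i j n.+1 = alt j i n.
Proof. by rewrite /alt /=; case: odd. Qed.

Lemma altw_rcons i j n : altw i j n.+1 = altw j i n ++ [:: j].
Proof.
elim: n => [|n IH] //.
by rewrite -[LHS]/(alt i j n.+2 :: altw i j n.+1) IH altS.
Qed.

Lemma size_altw i j n : size (altw i j n) = n.
Proof. by elim: n => //= n ->. Qed.

Lemma altw_split i j n N : (n <= N)%N ->
  exists A, size A = (N - n)%N /\ altw i j N = A ++ altw i j n.
Proof.
elim: N => [|N IH]; first by rewrite leqn0 => /eqP->; exists [::].
rewrite leq_eqVlt => /orP[/eqP->|nN]; first by exists [::]; rewrite subnn.
by have [A [sA eA]] := IH nN; exists (alt i j N.+1 :: A); rewrite /= sA eA subSn.
Qed.

Lemma flatten_nseq_altw i j m : flatten (nseq m [:: i; j]) = altw i j m.*2.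
Proof. by elim: m => //= m ->; rewrite /alt /= odd_double. Qed.

Lemma srefl_simple i j : srefl i 'a_j = 'a_j + gramc i j *: 'a_i.
Proof. by rewrite /simple_reflection rform_simple scaleNr. Qed.

Lemma srefl_self i : srefl i 'a_i = - 'a_i.
Proof.
rewrite srefl_simple /gramc (gram_diag gen_sq); apply: vcoefP => k.
by rewrite vcoefD vcoefN vcoefZ; ring.
Qed.

(** One more reflection changes only the coefficient of its own simple root, and does so by the
    Chebyshev recursion. *)
Lemma rep_altw i j n :
  rep (altw i j n) 'a_i = chebU (gramc i j) n.+1 *: 'a_(alt i j n)
                          + chebU (gramc i j) n *: 'a_(alt i j n.+1).
Proof.
elim: n => [|n IH]; first by rewrite /= chebU0 chebU1 scale1r scale0r addr0.
rewrite [LHS]/= -/(rep _ _) IH (srefl_linear gen_sq).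
have := repZ gen_sq [:: alt i j n.+1] (chebU (gramc i j) n) 'a_(alt i j n.+1).
rewrite /= srefl_self => ->.
rewrite srefl_simple.
have -> : gramc (alt i j n.+1) (alt i j n) = gramc i j.
  by rewrite /alt /=; case: odd => //; rewrite gramcC.
have -> : alt i j n.+2 = alt i j n by rewrite /alt /= negbK.
rewrite chebUSS; apply: vcoefP => k.
by rewrite !(vcoefD, vcoefN, vcoefZ); ring.
Qed.

Lemma braid_simple i j : i != j -> (0 < coxeter_matrix s i j)%N ->
  rep (altw i j (coxeter_matrix s i j).*2) 'a_i = 'a_i /\
  rep (altw i j (coxeter_matrix s i j).*2) 'a_j = 'a_j.
Proof.
move=> ij m0; have m1 : (1 < coxeter_matrix s i j)%N.
  by have := coxeter_matrix_neq1 ij; lia.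
set m := coxeter_matrix s i j in m0 m1 *.
have sn0 : sin (pi / m%:R : R) != 0 by rewrite gt_eqF // sin_pi_div.
have mr : m%:R != 0 :> R by rewrite pnatr_eq0 -lt0n.
have U0 : chebU (gramc i j) m.*2 = 0.
  rewrite chebU_coxeter // -/m.
  have -> : m.*2%:R * (pi / m%:R) = pi *+ 2 :> R by rewrite -muln2 natrM mulr2n; field.
  by rewrite sin2pi mul0r.
have U1 : chebU (gramc i j) m.*2.+1 = 1.
  rewrite chebU_coxeter // -/m.
  have -> : m.*2.+1%:R * (pi / m%:R) = pi / m%:R + pi *+ 2 :> R.
    by rewrite -muln2 -natr1 natrM mulr2n; field.
  by rewrite sinD2pi divff.
have Um : chebU (gramc i j) m.*2.-1 = -1.
  have := chebUSS (gramc i j) m.*2.-1; rewrite !prednK ?double_gt0 //; try lia.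
  by rewrite U0 U1 mulr0 add0r => ->; rewrite opprK.
split.
  by rewrite rep_altw // U0 U1 scale1r scale0r addr0 /alt odd_double.
have -> : m.*2 = m.*2.-1.+1 by lia.
rewrite altw_rcons rep_cat /= srefl_self -scaleN1r (repZ gen_sq) rep_altw //.
rewrite gramcC prednK ?double_gt0 // U0 Um !scale0r add0r.
have -> : alt j i m.*2 = j by rewrite /alt odd_double.
by rewrite scalerA mulrNN mulr1 scale1r.
Qed.

Lemma srefl_orthogonal i v : root_form s 'a_i v = 0 -> srefl i v = v.
Proof. by rewrite /simple_reflection => ->; rewrite mulr0 scale0r subr0. Qed.

Lemma altw_orthogonal i j n v : root_form s 'a_i v = 0 -> root_form s 'a_j v = 0 ->
  rep (altw i j n) v = v.
Proof.
move=> oi oj; elim: n => [//|n IH].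
rewrite [LHS]/= -/(rep _ _) IH; apply: srefl_orthogonal.
by rewrite /alt; case: odd.
Qed.

(** For finite order m and i != j the Gram determinant 1 - g^2 of the plane is nonzero, so V is the
    sum of the plane, treated by [braid_simple], and its orthogonal complement, which both
    reflections fix. *)
Lemma braid i j v : rep (flatten (nseq (coxeter_matrix s i j) [:: i; j])) v = v.
Proof.
case: (eqVneq i j) => [<-|ij].
  by rewrite /coxeter_matrix gen_sq elt_order1 /= (sreflK gen_sq).
have [->//|m0] := posnP (coxeter_matrix s i j).
have [ei ej] := braid_simple ij m0; rewrite flatten_nseq_altw.
have g1 := gram_lt ij m0.
pose g := gram i j; pose D : R := 1 - g ^+ 2.
have D0 : D != 0 by rewrite subr_eq0 eq_sym.
pose bi := root_form s 'a_i v; pose bj := root_form s 'a_j v.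
(* By Cramer's rule x and y make the remainder [v0] orthogonal to both simple roots. *)
pose x := (bi - g * bj) / D; pose y := (bj - g * bi) / D.
pose v0 := v - x *: 'a_i - y *: 'a_j.
have vE : v = x *: 'a_i + (y *: 'a_j + v0).
  by apply: vcoefP => k; rewrite !(vcoefD, vcoefB); ring.
have o : root_form s 'a_i v0 = 0 /\ root_form s 'a_j v0 = 0.
  rewrite /v0 !(rformBr gen_sq) !(rformZr gen_sq) !rform_simple !(gram_diag gen_sq).
  rewrite (gram_sym gen_sq j i) -/g -/bi -/bj /x /y; split; rewrite /D in D0 *.
  - by field.
  - by field.
have e0 := altw_orthogonal (coxeter_matrix s i j).*2 (proj1 o) (proj2 o).
clearbody v0; by rewrite {1}vE !(repD gen_sq) !(repZ gen_sq) ei ej e0 -vE.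
Qed.

Lemma rep_word_eqv l l' : word_eqv s l l' -> rep l =1 rep l'.
Proof.
elim=> {l l'} [//|l l' _ IH v|l l' l'' _ IH _ IH' v|l l' i j v]; first by rewrite IH.
  by rewrite IH IH'.
by rewrite !rep_cat braid.
Qed.

Lemma word_val_cat l l' : word_val s (l ++ l') = (word_val s l * word_val s l')%g.
Proof. by rewrite /word_val big_cat. Qed.

Lemma word_val_cons i l : word_val s (i :: l) = (s i * word_val s l)%g.
Proof. by rewrite /word_val big_cons. Qed.

Lemma word_val_nil : word_val s [::] = 1%g.
Proof. by rewrite /word_val big_nil. Qed.

Lemma word_val1 i : word_val s [:: i] = s i.
Proof. by rewrite word_val_cons word_val_nil mulg1. Qed.

Lemma word_val_rev l : word_val s (rev l) = (word_val s l)^-1%g.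
Proof.
elim: l => [|i l IH]; first by rewrite word_val_nil invg1.
by rewrite rev_cons -cats1 word_val_cat IH word_val1 word_val_cons invgM gen_inv.
Qed.

Lemma word_exists w : exists l, w = word_val s l.
Proof. by case: hW => _ _ + _; apply. Qed.

Lemma word_val_eqv l l' : word_val s l = word_val s l' -> word_eqv s (l ++ rev l') [::].
Proof.
move=> e; case: hW => _ _ _; apply.
by rewrite word_val_cat word_val_rev e mulgV.
Qed.

Lemma rep_word_val l l' : word_val s l = word_val s l' -> rep l =1 rep l'.
Proof.
move=> /word_val_eqv /rep_word_eqv e v.
have := e (rep l' v); rewrite rep_cat.
by have := rep_revK gen_sq (rev l') v; rewrite revK => ->.
Qed.

(** The word picked by [some_word] may differ from l, but the presentation and [braid] make them act
    alike. *)
Lemma act_word l v : act s (word_val s l) v = rep l v.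
Proof.
have e : word_val s (some_word s (word_val s l)) = word_val s l.
  by symmetry; apply: (@xgetPex _ [::] [set l0 | word_val s l = word_val s l0]); exists l.
exact: rep_word_val e v.
Qed.

Lemma actM w w' v : act s (w * w')%g v = act s w (act s w' v).
Proof.
have [[l ->] [l' ->]] := (word_exists w, word_exists w').
by rewrite -word_val_cat !act_word rep_cat.
Qed.

Lemma act1 v : act s 1%g v = v.
Proof. by rewrite -word_val_nil act_word. Qed.

Lemma act_s i v : act s (s i) v = srefl i v.
Proof. by rewrite -word_val1 act_word. Qed.

Lemma actK w v : act s w^-1%g (act s w v) = v.
Proof. by rewrite -actM mulVg act1. Qed.

Lemma actKV w v : act s w (act s w^-1%g v) = v.
Proof. by rewrite -actM mulgV act1. Qed.

Lemma act_inj w : injective (@act R Pi W s w).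
Proof. exact: can_inj (actK w). Qed.

Lemma act_form w u v : root_form s (act s w u) (act s w v) = root_form s u v.
Proof. by have [l ->] := word_exists w; rewrite !act_word (rep_form gen_sq). Qed.

Lemma act_linear w c u v : act s w (c *: u + v) = c *: act s w u + act s w v.
Proof. by have [l ->] := word_exists w; rewrite !act_word (rep_linear gen_sq). Qed.

Lemma actD w u v : act s w (u + v) = act s w u + act s w v.
Proof. by have := act_linear w 1 u v; rewrite !scale1r. Qed.

Lemma act0 w : act s w (0 : V) = 0.
Proof. by have [l ->] := word_exists w; rewrite act_word (rep0 gen_sq). Qed.

Lemma actZ w c v : act s w (c *: v) = c *: act s w v.
Proof. by have := act_linear w c v 0; rewrite act0 !addr0. Qed.

Lemma actN w v : act s w (- v) = - act s w v.
Proof. by rewrite -scaleN1r actZ scaleN1r. Qed.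

Lemma act_sum w (I : Type) (r : seq I) (P : pred I) (F : I -> V) :
  act s w (\sum_(x <- r | P x) F x) = \sum_(x <- r | P x) act s w (F x).
Proof. by elim/big_rec2: _ => [|x a b _ <-]; rewrite ?act0 // actD. Qed.

Definition len w : nat :=
  xget 0%N [set n | (exists2 l, w = word_val s l & size l = n) /\
                    forall l, w = word_val s l -> (n <= size l)%N].

Lemma lenP w : (exists2 l, w = word_val s l & size l = len w) /\
  forall l, w = word_val s l -> (len w <= size l)%N.
Proof.
rewrite /len; set P := [set n | _]; apply: (@xgetPex _ 0%N P).
have ex : exists n, `[< exists2 l, w = word_val s l & size l = n >].
  by have [l ->] := word_exists w; exists (size l); apply/asboolP; exists l.
have := ex_minnP ex; case=> n /asboolP h nmin; exists n; split=> // l e.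
by apply: nmin; apply/asboolP; exists l.
Qed.

Lemma len_le l : (len (word_val s l) <= size l)%N.
Proof. by have [_] := lenP (word_val s l); apply. Qed.

Lemma len1 : len 1%g = 0%N.
Proof. by have := len_le [::]; rewrite word_val_nil leqn0 => /eqP. Qed.

Lemma len_mul_word w l : (len (w * word_val s l)%g <= len w + size l)%N.
Proof.
have [[l' -> <-] _] := lenP w.
by rewrite -word_val_cat -size_cat len_le.
Qed.

Lemma lenV w : len w^-1%g = len w.
Proof.
have le x : (len x^-1%g <= len x)%N.
  by have [[l -> <-] _] := lenP x; rewrite -word_val_rev -size_rev len_le.
by apply/eqP; rewrite eqn_leq le -{1}(invgK w) le.
Qed.

(** Relators have even length. Hence multiplying by a generator never leaves the length
    unchanged. *)
Lemma odd_word_eqv l l' : word_eqv s l l' -> odd (size l) = odd (size l').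
Proof.
elim=> {l l'} // [l l' l'' _ -> _ -> //|l l' i j].
by rewrite !size_cat flatten_nseq_altw size_altw !oddD odd_double addFb.
Qed.

Lemma len_mulg_s_neq w i : len (w * s i)%g <> len w.
Proof.
have [[l -> <-] _] := lenP w; have [[l' e <-] _] := lenP (word_val s l * s i)%g.
move: e; rewrite -{1}word_val1 -word_val_cat => /word_val_eqv /odd_word_eqv /=.
by rewrite !size_cat size_rev /= !oddD => /eqP h e; move: h; rewrite e; case: odd.
Qed.

Lemma mulg_sK i w : (w * s i * s i)%g = w.
Proof. by rewrite -mulgA gen_sq mulg1. Qed.

Lemma len_mulg_s w i : len (w * s i)%g = (len w).+1 \/ len w = (len (w * s i)%g).+1.
Proof.
have := len_mul_word w [:: i]; have := len_mul_word (w * s i)%g [:: i].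
rewrite !word_val1 mulg_sK /= !addn1; have := @len_mulg_s_neq w i; lia.
Qed.

Lemma len_descent w : w <> 1%g -> exists i, (len (w * s i) < len w)%N.
Proof.
have [[l e sl] _] := lenP w; case/lastP: l e sl => [-> _ //|l i e sl _].
  by rewrite word_val_nil.
exists i; rewrite -sl size_rcons ltnS e -cats1 word_val_cat word_val1 mulg_sK.
exact: len_le.
Qed.

Definition nonneg v := forall i, 0 <= vcoef i v.
Definition nonpos v := forall i, vcoef i v <= 0.

End Representation.

(** * Positivity of roots in terms of the length *)

Section Positivity.
Context {R : realType} {Pi : choiceType} {W : groupType} (s : Pi -> W).
Hypothesis hW : is_coxeter_system s.
Notation V := (@rootspace R Pi).
Notation "''a_' i" := (simple_root R i) (at level 8, i at level 2, format "''a_' i").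
Notation len := (len s).
Notation act := (act s).
Implicit Types (u v : V) (w : W) (i j : Pi) (c : R).

Lemma nonneg0 : nonneg (0 : V). Proof. by move=> k; rewrite vcoef0. Qed.

Lemma nonnegD u v : nonneg u -> nonneg v -> nonneg (u + v).
Proof. by move=> hu hv k; rewrite vcoefD addr_ge0. Qed.

Lemma nonnegZ c u : 0 <= c -> nonneg u -> nonneg (c *: u).
Proof. by move=> hc hu k; rewrite vcoefZ mulr_ge0. Qed.

Lemma nonneg_simple i : nonneg 'a_i.
Proof. by move=> k; rewrite vcoef_simple ler0n. Qed.

Lemma nonposN u : nonpos (- u) <-> nonneg u.
Proof.
by split=> h k; have := h k; rewrite vcoefN ?oppr_le0 // ?oppr_ge0.
Qed.

Lemma nonnegN u : nonneg (- u) <-> nonpos u.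
Proof. by rewrite -nonposN opprK. Qed.

Lemma word_val_flatten_nseq n l : word_val s (flatten (nseq n l)) = (word_val s l ^+ n)%g.
Proof. by elim: n => [|n IH]; rewrite ?word_val_nil //= word_val_cat IH expgS. Qed.

(** The relator has length 2 m, so the last m + 1 letters may be replaced by the inverse of the
    other m - 1. *)
Lemma altw_long i j k (m := coxeter_matrix s i j) : (0 < m)%N -> (m < k)%N ->
  exists2 l, word_val s (altw j i k) = word_val s l & (size l + 2 <= k)%N.
Proof.
move=> m0 mk; have [A [sA ->]] := altw_split j i mk.
have [|B [sB eB]] := @altw_split _ j i m.+1 m.*2; first lia.
have rel : word_val s (altw j i m.*2) = 1%g.
  rewrite -flatten_nseq_altw /m (coxeter_matrixC hW) /coxeter_matrix.
  by rewrite word_val_flatten_nseq word_val_cons word_val1 elt_orderX.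
exists (A ++ rev B); last by rewrite size_cat size_rev sA sB; lia.
rewrite !word_val_cat (word_val_rev hW); congr (_ * _)%g.
by symmetry; apply: mulg1_eq; rewrite -word_val_cat -eB.
Qed.

Lemma altw_swap i j k (e := alt i j k) : [\/ e = i | e = j].
Proof. by rewrite /e /alt; case: odd; [right|left]. Qed.

(* v is what remains of w after the longest alternating suffix ending in s_j. *)
Lemma dihedral_factor w i j : (len (w * s j)%g < len w)%N ->
  exists (k : nat) (v : W), [/\ (0 < k)%N, w = (v * word_val s (altw i j k))%g,
    len w = (len v + k)%N & (len v < len (v * s i)%g)%N /\ (len v < len (v * s j)%g)%N].
Proof.
move=> lt.
pose P k := `[< exists v : W, w = (v * word_val s (altw i j k))%g /\ len w = (len v + k)%N >].
have P1 : P 1%N.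
  apply/asboolP; exists (w * s j)%g; rewrite /= word_val1 (mulg_sK hW); split=> //.
  by case: (len_mulg_s hW w j); lia.
have exP : exists k, P k by exists 1%N.
have bound k : P k -> (k <= len w)%N by move=> /asboolP[v [_ ->]]; lia.
case: (ex_maxnP exP bound) => k /asboolP[v [ew lw]] kmax.
have k0 : (0 < k)%N by have := kmax _ P1.
exists k, v; split=> //.
have h1 : (len v < len (v * s (alt i j k))%g)%N.
  case: k k0 ew lw {kmax} => // k _ ew lw.
  have := len_mul_word hW (v * s (alt i j k.+1))%g (altw i j k).
  by rewrite -mulgA -word_val_cons -/(altw i j k.+1) -ew lw size_altw; lia.
have h2 : (len v < len (v * s (alt i j k.+1))%g)%N.
  case: (len_mulg_s hW v (alt i j k.+1)) => [->//|e].
  suff /kmax : P k.+1 by rewrite ltnn.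
  apply/asboolP; exists (v * s (alt i j k.+1))%g; split; last by lia.
  by rewrite /= word_val_cons mulgA (mulg_sK hW).
by move: h1 h2; rewrite altS /alt; case: odd.
Qed.

(** Write w as v times an alternating word of length k in i and j. The shorter v keeps both simple
    roots nonnegative by induction, and k < m, since otherwise [altw_long] would shorten w s_i. So
    the Chebyshev coefficients are nonnegative. *)
Theorem len_nonneg w i : (len w < len (w * s i)%g)%N -> nonneg (act w 'a_i).
Proof.
have [n] := ubnP (len w); elim: n w i => // n IH w i; rewrite ltnS => len_n lt.
case: (pselect (w = 1%g)) => [->|/(len_descent hW) [j ltj]].
  by rewrite (act1 hW); exact: nonneg_simple.
have ij : i != j by apply: contraTneq lt => ->; rewrite -leqNgt ltnW.
have [k [v [k0 ew lw [vi vj]]]] := dihedral_factor i ltj.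
have hvi : nonneg (act v 'a_i) by apply: IH => //; lia.
have hvj : nonneg (act v 'a_j) by apply: IH => //; lia.
have hk : coxeter_matrix s i j = 0%N \/ (k.+1 <= coxeter_matrix s i j)%N.
  have [m0|m0] := posnP (coxeter_matrix s i j); first by left.
  right; rewrite leqNgt; apply/negP => mk.
  have [l e sl] := altw_long m0 mk.
  have : (len (w * s i)%g <= len v + size l)%N.
    rewrite ew -mulgA -(word_val1 s i) -word_val_cat -altw_rcons e.
    exact: len_mul_word.
  lia.
rewrite ew (actM hW) (act_word hW) (rep_altw hW) (actD hW) !(actZ hW).
apply: nonnegD; apply: nonnegZ; try (apply: (chebU_ge0 hW) => //).
- by case: (altw_swap i j k) => ->.
- by case: hk; [left|right; exact: ltnW].
- by case: (altw_swap i j k.+1) => ->.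
Qed.

End Positivity.

(** * Roots and parabolic subgroups *)

Section Roots.
Context {R : realType} {Pi : choiceType} {W : groupType} (s : Pi -> W).
Hypothesis hW : is_coxeter_system s.
Notation V := (@rootspace R Pi).
Notation "''a_' i" := (simple_root R i) (at level 8, i at level 2, format "''a_' i").
Notation len := (len s).
Notation act := (act s).
Implicit Types (u v : V) (w x y z : W) (i j t : Pi) (c : R) (F K : set Pi).

Lemma nonneg_nonpos v : nonneg v -> nonpos v -> v = 0.
Proof.
by move=> p n; apply: vcoefP => k; apply/eqP; rewrite vcoef0 eq_le p n.
Qed.

Lemma len_nonpos w i : (len (w * s i)%g < len w)%N -> nonpos (act w 'a_i).
Proof.
move=> lt; have := len_nonneg hW (w := (w * s i)%g) (i := i) (R := R).
rewrite (mulg_sK hW) => /(_ lt).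
by rewrite (actM hW) (act_s hW) (srefl_self hW) (actN hW) nonnegN.
Qed.

Definition coxroot v := exists w i, v = act w 'a_i.

Lemma root_simple i : coxroot 'a_i.
Proof. by exists 1%g, i; rewrite (act1 hW). Qed.

Lemma root_act w v : coxroot v -> coxroot (act w v).
Proof. by case=> x [i ->]; exists (w * x)%g, i; rewrite (actM hW). Qed.

Lemma root_norm v : coxroot v -> root_form s v v = 1.
Proof.
case=> w [i ->]; rewrite (act_form hW) rform_simple gram_diag //; exact: gen_sq hW.
Qed.

Lemma root_neq0 v : coxroot v -> v <> 0.
Proof.
move=> rv v0; have := root_norm rv; rewrite v0 rform0l => /eqP.
by rewrite eq_sym oner_eq0.
Qed.

Lemma root_sign v : coxroot v -> nonneg v \/ nonpos v.
Proof.
case=> w [i ->]; case: (len_mulg_s hW w i) => e.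
  by left; apply: (len_nonneg hW); rewrite e.
by right; apply: len_nonpos; rewrite e.
Qed.

Lemma root_not_both v : coxroot v -> nonneg v -> nonpos v -> False.
Proof. by move=> rv p n; apply: (root_neq0 rv); exact: nonneg_nonpos. Qed.

Lemma simple_root_inj : injective (simple_root R : Pi -> V).
Proof.
move=> i j /(congr1 (vcoef i)); rewrite !vcoef_simple eqxx.
by case: eqP => // _ /eqP; rewrite oner_eq0.
Qed.

Lemma simple_not_nonpos i : ~ nonpos 'a_i.
Proof. exact: root_not_both (root_simple i) (@nonneg_simple _ _ i). Qed.

Lemma act_expand w v k : vcoef k (act w v) = \sum_(i <- msupp v) vcoef i v * vcoef k (act w 'a_i).
Proof.
rewrite {1}(rootspaceE v) (act_sum hW) vcoef_sum; apply: eq_bigr => i _.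
by rewrite (actZ hW) vcoefZ.
Qed.

Lemma act_nonneg w v : nonneg v -> (forall i, vcoef i v != 0 -> nonneg (act w 'a_i)) ->
  nonneg (act w v).
Proof.
move=> p h k; rewrite act_expand; apply: sumr_ge0 => i _.
by case: (eqVneq (vcoef i v) 0) => [->|/h hi]; rewrite ?mul0r // mulr_ge0.
Qed.

Definition supported F v := forall i, ~ F i -> vcoef i v = 0.

Lemma supported_simple F i : F i -> supported F 'a_i.
Proof. by move=> Fi j Fj; rewrite vcoef_simple; case: eqP => // e; case: Fj; rewrite e. Qed.

Lemma supportedN F v : supported F v -> supported F (- v).
Proof. by move=> h i Fi; rewrite vcoefN h ?oppr0. Qed.

Lemma supportedP F v i : supported F v -> vcoef i v != 0 -> F i.
Proof. by move=> h; apply: contra_neqP => /h. Qed.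

Lemma parabolic_subgroup F : is_subgroup (parabolic s F).
Proof.
split=> [B [[]]//|x y Fx Fy B BB|x Fx B BB]; have [[_ m v] _] := BB.
  by apply: m; [exact: Fx|exact: Fy].
by apply: v; exact: Fx.
Qed.

Lemma parabolic1 F : parabolic s F 1%g.
Proof. by have [] := parabolic_subgroup F. Qed.

Lemma parabolicM F x y : parabolic s F x -> parabolic s F y -> parabolic s F (x * y)%g.
Proof. by have [_ + _] := parabolic_subgroup F; apply. Qed.

Lemma parabolicV F x : parabolic s F x -> parabolic s F x^-1%g.
Proof. by have [_ _] := parabolic_subgroup F; apply. Qed.

Lemma parabolic_s F i : F i -> parabolic s F (s i).
Proof. by move=> Fi B [_]; apply; exists i. Qed.

Lemma parabolic_sub F K : F `<=` K -> parabolic s F `<=` parabolic s K.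
Proof.
move=> FK; apply: smallest_sub; first exact: parabolic_subgroup.
by move=> _ [i /FK Ki <-]; exact: parabolic_s.
Qed.

(** A generator in F changes a vector only by a multiple of its own simple root. This invariance of
    the coordinates outside F serves throughout to locate roots. *)
Lemma parabolic_vcoef F y v i : parabolic s F y -> ~ F i -> vcoef i (act y v) = vcoef i v.
Proof.
move=> Fy Fi.
suff : [set y | forall v, vcoef i (act y v) = vcoef i v] y by [].
apply: Fy; split; first split=> [u|a b ha hb u|a ha u] /=.
- by rewrite (act1 hW).
- by rewrite (actM hW) ha hb.
- by rewrite -{2}(actKV hW a u) ha.
move=> _ [j Fj <-] u /=; rewrite (act_s hW) /simple_reflection vcoefB vcoefZ vcoef_simple.
by case: eqP => [e|_]; [case: Fi; rewrite e|rewrite mulr0 subr0].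
Qed.

Lemma parabolic_supported F y v : parabolic s F y -> supported F v -> supported F (act y v).
Proof. by move=> Fy h i Fi; rewrite (parabolic_vcoef _ Fy) ?h. Qed.

(** At a descent i outside F the nonpositive root y a_i would still have coefficient 1 at i. *)
Lemma parabolic_descent F y : parabolic s F y -> y <> 1%g ->
  exists i, F i /\ (len (y * s i)%g < len y)%N.
Proof.
move=> Fy /(len_descent hW) [i lt]; exists i; split=> //.
apply: contrapT => Fi; have := len_nonpos lt i.
by rewrite (parabolic_vcoef _ Fy) // vcoef_simple eqxx ler10.
Qed.

Lemma parabolic_ind F (P : W -> Prop) : P 1%g ->
  (forall y i, parabolic s F y -> F i -> nonneg (act y 'a_i) -> P y -> P (y * s i)%g) ->
  forall y, parabolic s F y -> P y.
Proof.
move=> P1 PS y; have [n] := ubnP (len y); elim: n y => // n IH y ly Fy.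
case: (pselect (y = 1%g)) => [->//|y1].
have [i [Fi lt]] := parabolic_descent Fy y1.
have Fyi : parabolic s F (y * s i)%g by apply: parabolicM => //; exact: parabolic_s.
rewrite -(mulg_sK hW i y); apply: PS => //.
  by apply: (len_nonneg hW); rewrite (mulg_sK hW).
apply: IH => //; exact: leq_trans lt _.
Qed.

(* For nu >= 0 this shows that no w makes a coefficient of nu negative, which replaces the positive
definiteness of spherical diagrams. *)
Lemma antidominant_act nu w : (forall i, root_form s 'a_i nu <= 0) -> nonneg (act w nu - nu).
Proof.
move=> anti; have [n] := ubnP (len w); elim: n w => // n IH w lw.
case: (pselect (w = 1%g)) => [->|/(len_descent hW) [i lt]].
  by rewrite (act1 hW) subrr; exact: nonneg0.
have := IH (w * s i)%g (leq_trans lt lw).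
have : nonneg (act (w * s i)%g 'a_i) by apply: (len_nonneg hW); rewrite (mulg_sK hW).
rewrite (actM hW w) (act_s hW) (srefl_self hW) => p q.
have -> : act w nu - nu = (act (w * s i)%g nu - nu) +
    (- (2 * root_form s 'a_i nu)) *: act w (- 'a_i).
  rewrite (actM hW) (act_s hW) /simple_reflection !(actD hW) !(actN hW) (actZ hW).
  by apply: vcoefP => k; rewrite !(vcoefD, vcoefN, vcoefZ); ring.
apply: nonnegD => //; apply: nonnegZ => //.
by rewrite oppr_ge0 pmulr_rle0.
Qed.

(** A simple root spans an extreme ray of the positive cone, so x a_l is a multiple of a_k for every
    l in the support of v; norm and sign make it equal to a_k. *)
Lemma simple_preimage x v k : act x v = 'a_k -> coxroot v -> nonneg v ->
  (forall l, vcoef l v != 0 -> nonneg (act x 'a_l)) -> exists2 l, vcoef l v != 0 & v = 'a_l.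
Proof.
move=> e rv pv h.
have [l vl] : exists l, vcoef l v != 0.
  apply: contrapT => n; apply: (root_neq0 rv); apply: vcoefP => l; rewrite vcoef0.
  by apply/eqP; apply: contrapT => /negP vl; apply: n; exists l.
exists l => //; apply: (act_inj hW (w := x)); rewrite e; symmetry.
have z j : j != k -> vcoef j (act x 'a_l) = 0.
  move=> jk; have := congr1 (vcoef j) e; rewrite act_expand vcoef_simple (negbTE jk) => /eqP.
  rewrite psumr_eq0 => [/allP|i _]; last first.
    by case: (eqVneq (vcoef i v) 0) => [->|/h hi]; rewrite ?mul0r // mulr_ge0.
  have lv : l \in msupp v by rewrite -mcoeff_neq0.
  by move=> /(_ l lv) /=; rewrite mulf_eq0 (negbTE vl) => /eqP.
have {}e : act x 'a_l = vcoef k (act x 'a_l) *: 'a_k.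
  apply: vcoefP => j; rewrite vcoefZ vcoef_simple.
  by case: (eqVneq j k) => [->|/z->]; rewrite ?mulr1 ?mulr0.
have := root_norm (root_act x (root_simple l)); rewrite e rformZl.
rewrite rformZr; last exact: gen_sq hW.
rewrite (root_norm (root_simple k)) mulr1 => /eqP.
rewrite -expr2 sqrf_eq1 => /orP[/eqP->|/eqP n1]; first by rewrite scale1r.
by have := h _ vl k; rewrite n1 oppr_ge0 ler10.
Qed.

(** By injectivity x a_t is not in the span of the simple roots x a_k with k in K, so it has a
    nonzero coordinate i off them. At i no node contributes positively, and t contributes
    negatively. *)
Lemma descent_negative x F K t v : (forall k, K k -> exists k', act x 'a_k = 'a_k') ->
  (forall d, F d -> nonpos (act x 'a_d)) -> ~ K t -> F t ->
  supported (K `|` F) v -> nonneg v -> 0 < vcoef t v ->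
  exists i, vcoef i (act x v) < 0.
Proof.
move=> hK hF Kt Ft sv pv vt.
have [i ni] : exists i, vcoef i (act x 'a_t) != 0 /\ forall k, K k -> act x 'a_k <> 'a_i.
  apply: contrapT => n.
  have h i : vcoef i (act x 'a_t) != 0 -> exists2 k, K k & act x 'a_k = 'a_i.
    move=> vi; apply: contrapT => nk; apply: n; exists i; split=> // k Kk e.
    by apply: nk; exists k.
  pose g i := xget t [set k | K k /\ act x 'a_k = 'a_i].
  have gP i : vcoef i (act x 'a_t) != 0 -> K (g i) /\ act x 'a_(g i) = 'a_i.
    by move=> /h [k Kk e]; apply: (@xgetPex _ t [set k | K k /\ act x 'a_k = 'a_i]); exists k.
  have e : 'a_t = \sum_(i <- msupp (act x 'a_t)) vcoef i (act x 'a_t) *: 'a_(g i).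
    apply: (act_inj hW (w := x)); rewrite (act_sum hW) {1}(rootspaceE (act x 'a_t)).
    rewrite !big_seq; apply: eq_bigr => i; rewrite -mcoeff_neq0 => /gP [_ ei].
    by rewrite (actZ hW) ei.
  have := congr1 (vcoef t) e; rewrite vcoef_simple eqxx vcoef_sum big_seq big1.
    by move/eqP; rewrite oner_eq0.
  move=> i; rewrite -mcoeff_neq0 => /gP [Kg _]; rewrite vcoefZ vcoef_simple.
  by case: eqP => [et|_]; [case: Kt; rewrite et|rewrite mulr0].
case: ni => ni nK; exists i; rewrite act_expand.
have tv : t \in msupp v by rewrite -mcoeff_neq0; exact: lt0r_neq0.
have le j : vcoef j v * vcoef i (act x 'a_j) <= 0.
  case: (eqVneq (vcoef j v) 0) => [->|vj]; first by rewrite mul0r.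
  case: (supportedP sv vj) => [Kj|/hF nj].
    have [k' ek] := hK _ Kj; rewrite ek vcoef_simple; case: eqP => [e|_]; rewrite ?mulr0 //.
    by case: (nK _ Kj); rewrite ek e.
  by rewrite mulr_ge0_le0.
rewrite (big_rem t) //=; apply: ltr_wnDr; first by apply: sumr_le0.
rewrite pmulr_rlt0 // lt_neqAle ni /=; exact: hF.
Qed.

End Roots.

(** * Chambers in the fixed subspace of J *)

Section Crossing.
Context {R : realType} {Pi : choiceType} {W : groupType} (s : Pi -> W).
Hypothesis hW : is_coxeter_system s.
Notation V := (@rootspace R Pi).
Notation "''a_' i" := (simple_root R i) (at level 8, i at level 2, format "''a_' i").
Notation len := (len s).
Notation act := (act s).
Context (m : nat).
Implicit Types (u v : V) (w x y z : W) (i j t : Pi) (c : R) (k : 'I_m -> Pi).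

Definition with_node k t : set Pi := range k `|` [set t].

(* The chambers w C_k and (w y) C_k' of J^perp share the wall of w C_k on which the root w a_t
vanishes. *)
Definition crossing k t y k' : Prop :=
  [/\ ~ range k t, parabolic s (with_node k t) y, nonpos (act y^-1%g 'a_t)
    & forall a, act y 'a_(k' a) = 'a_(k a)].

Lemma crossing_simple k t y k' a : crossing k t y k' -> act y^-1%g 'a_(k a) = 'a_(k' a).
Proof. by case=> _ _ _ <-; rewrite (actK hW). Qed.

Lemma crossing_sub k t y k' a : crossing k t y k' -> with_node k t (k' a).
Proof.
move=> cr; apply: (@supportedP _ _ _ 'a_(k' a)); last by rewrite vcoef_simple eqxx oner_eq0.
rewrite -(crossing_simple a cr); case: cr => _ py _ _.
apply: (parabolic_supported hW); first exact: parabolicV.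
by apply: supported_simple; left; exists a.
Qed.

Lemma crossing_inj k t y k' : injective k -> crossing k t y k' -> injective k'.
Proof.
move=> ik [_ _ _ h] a b e; apply: ik; apply: (@simple_root_inj R).
by rewrite -!h e.
Qed.

Lemma crossing_negative k t y k' v : crossing k t y k' ->
  supported (with_node k t) v -> nonneg v -> 0 < vcoef t v ->
  exists i, vcoef i (act y^-1%g v) < 0.
Proof.
move=> cy sv pv vt; have [kt _ ny hy] := cy.
apply: (descent_negative hW (K := range k) (F := [set t]) (t := t)) => //.
  by move=> _ [a _ <-]; exists (k' a); exact: crossing_simple cy.
by move=> _ ->.
Qed.

Lemma crossing_nonneg k t y k' v : crossing k t y k' ->
  supported (with_node k t) v -> nonneg v -> vcoef t v <= 0 -> nonneg (act y^-1%g v).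
Proof.
move=> cy sv pv vt; apply: (act_nonneg hW) => // i vi.
case: (supportedP sv vi) => [[a _ <-]|it].
  by rewrite (crossing_simple a cy); exact: nonneg_simple.
by move: vi; rewrite it eq_le vt pv.
Qed.

(** The inverse of a crossing makes a positive root of L = K + t negative exactly when the root
    involves a_t. So both crossings give the same signs on L, while a descent of y2^-1 y1 would
    yield a root on which they differ. *)
Lemma crossing_uniq k t y1 y2 k1 k2 : crossing k t y1 k1 -> crossing k t y2 k2 -> y1 = y2.
Proof.
move=> c1 c2; have [kt p1 n1 h1] := c1; have [_ p2 n2 h2] := c2.
apply: contrapT => ne.
have p : parabolic s (with_node k t) (y2^-1 * y1)%g.
  by apply: parabolicM => //; exact: parabolicV.
have [|l [Ll lt]] := parabolic_descent (R := R) hW p.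
  by move=> /(congr1 (fun x => y2 * x)%g); rewrite mulVKg mulg1 => e; apply: ne.
have := len_nonpos (R := R) hW lt; rewrite (actM hW) => n.
set d := act y1 'a_l in n.
have rd : coxroot s d by apply: (root_act hW); exact: root_simple.
have sd : supported (with_node k t) d.
  by apply: (parabolic_supported hW p1); exact: supported_simple.
have rn : coxroot s (act y2^-1%g d) by exact: root_act.
case: (root_sign hW rd) => [pd|/nonnegN nd].
  have [dt|dt] := ltP 0 (vcoef t d).
    have [i] := crossing_negative c1 sd pd dt; rewrite /d (actK hW) vcoef_simple.
    by rewrite ltNge ler0n.
  by apply: (root_not_both hW rn) => //; exact: crossing_nonneg c2 sd pd dt.
have [dt|dt] := ltP 0 (vcoef t (- d)).
  have [i] := crossing_negative c2 (supportedN sd) nd dt; rewrite (actN hW) vcoefN oppr_lt0.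
  by rewrite ltNge n.
have := crossing_nonneg c1 (supportedN sd) nd dt.
by rewrite (actN hW) /d (actK hW) nonnegN => /(simple_not_nonpos hW).
Qed.

Lemma crossing_new_node k t y k' : injective k -> crossing k t y k' ->
  exists2 t', ~ range k' t' & with_node k t = with_node k' t'.
Proof.
move=> ik cr; have ik' := crossing_inj ik cr; have [kt _ _ _] := cr.
pose S := t :: codom k; pose S' := codom k'.
have uS : uniq S.
  rewrite /= (map_inj_uniq ik) enum_uniq andbT; apply/negP => /codomP[a e].
  by apply: kt; exists a.
have memS i : (i \in S) <-> with_node k t i.
  rewrite inE; split=> [/orP[/eqP->|/codomP[a ->]]|[[a _ <-]|->]]; first by right.
  - by left; exists a.
  - by rewrite codom_f orbT.
  - by rewrite eqxx.
have szS' : size S' = m by rewrite size_codom card_ord.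
have [t' t'S t'S'] : exists2 t', t' \in S & t' \notin S'.
  apply: contrapT => n; have : (size S <= size S')%N.
    apply: uniq_leq_size => // i iS; apply: contrapT => /negP iS'; apply: n.
    by exists i.
  by rewrite /= size_codom card_ord szS' ltnn.
exists t'; first by move=> [a _ e]; case/negP: t'S'; rewrite -e codom_f.
have [_ eqS] : (size (t' :: S') = size S) * (t' :: S' =i S).
  apply: uniq_min_size.
  - by rewrite /= t'S' (map_inj_uniq ik') enum_uniq.
  - move=> i; rewrite inE => /orP[/eqP->//|/codomP[a ->]].
    by apply/memS; exact: crossing_sub cr.
  - by rewrite /= size_codom card_ord szS'.
apply/seteqP; split=> i.
  move=> /memS; rewrite -eqS inE => /orP[/eqP->|/codomP[a ->]]; first by right.
  by left; exists a.
by move=> [[a _ <-]|->]; apply/memS; rewrite -eqS inE ?eqxx // codom_f orbT.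
Qed.

(** The node t' is the one of L left out by [k']. If y a_t' were positive, y would be nonnegative on
    all simple roots of L, hence on - y^-1 a_t, whose image is - a_t. *)
Lemma crossing_sym k t y k' : injective k -> crossing k t y k' ->
  exists2 t', crossing k' t' y^-1%g k & with_node k t = with_node k' t'.
Proof.
move=> ik cr; have [t' kt' eL] := crossing_new_node ik cr.
have [kt py ny hy] := cr.
exists t' => //; split=> //; rewrite -?eL; first exact: parabolicV.
  rewrite invgK.
  have rt : coxroot s (act y 'a_t') by apply: (root_act hW); exact: root_simple.
  case: (root_sign hW rt) => // pt.
  have : nonneg (act y (- act y^-1%g 'a_t)).
    apply: (act_nonneg hW); first by rewrite nonnegN.
    move=> i; rewrite vcoefN oppr_eq0 => vi.
    have st : supported (with_node k t) (act y^-1%g 'a_t).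
      by apply: (parabolic_supported hW); [exact: parabolicV|apply: supported_simple; right].
    have := supportedP st vi; rewrite eL => -[[a _ <-]|->] //.
    by rewrite hy; exact: nonneg_simple.
  by rewrite (actN hW) (actKV hW) nonnegN => /(simple_not_nonpos hW).
by move=> a; rewrite (crossing_simple a cr).
Qed.

Lemma crossing_exists k t x k' : ~ range k t -> nonpos (act x^-1%g 'a_t) ->
  (forall a, act x^-1%g 'a_(k a) = 'a_(k' a)) ->
  exists y k1, [/\ crossing k t y k1, (len (y^-1 * x)%g < len x)%N
    & forall i, with_node k t i -> nonneg (act (y^-1 * x)^-1%g 'a_i)].
Proof.
move=> kt nt hx.
pose P n := `[< exists2 y, parabolic s (with_node k t) y & len (y^-1 * x)%g = n >].
have exP : exists n, P n.
  by exists (len x); apply/asboolP; exists 1%g; [exact: parabolic1|rewrite invg1 mul1g].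
case: (ex_minnP exP) => n /asboolP[y py ly] nmin.
set z := (y^-1 * x)%g in ly.
have pz i : with_node k t i -> nonneg (act z^-1%g 'a_i).
  move=> Li; apply: (len_nonneg hW).
  have : (n <= len (s i * z)%g)%N.
    apply: nmin; apply/asboolP; exists (y * s i)%g.
      by apply: parabolicM => //; exact: parabolic_s.
    by rewrite invgM (gen_inv hW) mulgA.
  have := len_mulg_s hW z^-1%g i.
  have -> : (z^-1 * s i = (s i * z)^-1)%g by rewrite [RHS]invgM (gen_inv hW).
  by rewrite !(lenV hW) ly; lia.
have xE v : act x^-1%g v = act z^-1%g (act y^-1%g v).
  by rewrite -(actM hW) /z invgM invgK mulgK.
have sL i : with_node k t i -> supported (with_node k t) (act y^-1%g 'a_i).
  by move=> Li; apply: (parabolic_supported hW);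
    [exact: parabolicV|exact: supported_simple].
have posL v : supported (with_node k t) v -> nonneg v -> nonneg (act z^-1%g v).
  by move=> sv pv; apply: (act_nonneg hW) => // i /(supportedP sv); exact: pz.
have ry i : coxroot s (act y^-1%g 'a_i) by apply: (root_act hW); exact: root_simple.
have rz i : coxroot s (act x^-1%g 'a_i) by apply: (root_act hW); exact: root_simple.
have hk a : exists k1 : Pi, act y^-1%g 'a_(k a) = 'a_k1.
  have La : with_node k t (k a) by left; exists a.
  case: (root_sign hW (ry (k a))) => [pa|/nonnegN na]; last first.
    have := posL _ (supportedN (sL _ La)) na; rewrite (actN hW) -xE hx nonnegN.
    by move/(simple_not_nonpos hW).
  have e : act z^-1%g (act y^-1%g 'a_(k a)) = 'a_(k' a) by rewrite -xE.
  have [|l _ ->] := simple_preimage hW e (ry _) pa; last by exists l.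
  by move=> l /(supportedP (sL _ La)); exact: pz.
have [k1 hk1] := choice hk.
have Lt : with_node k t t by right.
exists y, k1; split=> //.
  split=> //; last by move=> a; rewrite -hk1 (actKV hW).
  case: (root_sign hW (ry t)) => // pt; case: (root_not_both hW (rz t)) => //.
  by rewrite xE; apply: posL => //; exact: sL.
(* Strictness: s_t x lies in the same coset and is already shorter than x. *)
have lt : (len (s t * x)%g < len x)%N.
  rewrite -lenV // -(lenV hW x) invgM (gen_inv hW).
  have := len_mulg_s hW x^-1%g t => -[] e; last by rewrite e.
  case: (root_not_both hW (rz t)) => //.
  by apply: (len_nonneg hW); rewrite e.
have : (n <= len (s t * x)%g)%N.
  apply: nmin; apply/asboolP; exists (s t); first exact: parabolic_s.
  by rewrite (gen_inv hW).
by rewrite -/z ly => /leq_ltn_trans; apply.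
Qed.

Lemma crossing_closer k t y k1 x k' : crossing k t y k1 ->
  (forall a, act x^-1%g 'a_(k a) = 'a_(k' a)) -> nonpos (act x^-1%g 'a_t) ->
  (len (y^-1 * x)%g < len x)%N /\
  forall i, with_node k t i -> nonneg (act (y^-1 * x)^-1%g 'a_i).
Proof.
move=> cr hx nt; have [kt _ _ _] := cr.
have [y2 [k2 [c2 lt pz]]] := crossing_exists kt nt hx.
by rewrite (crossing_uniq cr c2).
Qed.

(** The wall does not separate the chamber from x, so it separates the neighbour from x, and
    crossing back is a step closer. *)
Lemma crossing_farther k t y k1 x k' : injective k -> crossing k t y k1 ->
  (forall a, act x^-1%g 'a_(k a) = 'a_(k' a)) -> nonneg (act x^-1%g 'a_t) ->
  (len x < len (y^-1 * x)%g)%N.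
Proof.
move=> ik cr hx pt; have [t' ct' eL] := crossing_sym ik cr.
have [kt py ny hy] := cr; have [kt' _ nt' _] := ct'.
have xE v : act (y^-1 * x)^-1%g v = act x^-1%g (act y v).
  by rewrite -(actM hW) invgM invgK.
have [||lt _] := crossing_closer ct' (x := (y^-1 * x)%g) (k' := k').
- by move=> a; rewrite xE hy hx.
- rewrite xE -nonnegN -(actN hW); apply: (act_nonneg hW).
    by rewrite nonnegN; rewrite invgK in nt'.
  move=> i; rewrite vcoefN oppr_eq0 => vi.
  have st : supported (with_node k t) (act y 'a_t').
    by apply: (parabolic_supported hW) => //; rewrite eL; apply: supported_simple; right.
  case: (supportedP st vi) => [[a _ <-]|-> //].
  by rewrite hx; exact: nonneg_simple.
by move: lt; rewrite invgK mulVKg.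
Qed.

(* A wall whose crossing does not change the type carries a reflection. *)
Lemma crossing_involution k t y k' : injective k -> crossing k t y k' ->
  range k' = range k -> (y * y = 1)%g.
Proof.
move=> ik cr e; have [t' [kt' py' ny' hy'] eL] := crossing_sym ik cr.
have [kt py ny hy] := cr.
have et : t' = t.
  have : with_node k t t' by rewrite eL; right.
  by case=> [[a _ ea]|//]; case: kt'; rewrite e; exists a.
have h a : exists b, act y^-1%g 'a_b = 'a_(k a).
  have [b _ <-] : range k' (k a) by rewrite e; exists a.
  by exists (k b); exact: crossing_simple cr.
have [k2 hk2] := choice h.
have c2 : crossing k t y^-1%g k2.
  split=> //; first exact: parabolicV.
  by rewrite -et.
by have := crossing_uniq cr c2 => {2}->; rewrite mulgV.
Qed.

End Crossing.

(** * The chambers on one side of all mirrors *)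

Section Chambers.
Context {R : realType} {Pi : choiceType} {W : groupType} (s : Pi -> W).
Hypothesis hW : is_coxeter_system s.
Notation V := (@rootspace R Pi).
Notation "''a_' i" := (simple_root R i) (at level 8, i at level 2, format "''a_' i").
Notation len := (len s).
Notation act := (act s).
Notation crossing := (@crossing R Pi W s _).
Context (m : nat) (phi : 'I_m -> Pi).
Hypothesis phi_inj : injective phi.
Implicit Types (u v w x y z : W) (b : V) (i j t : Pi) (c : R) (k : 'I_m -> Pi).

(* w C_K is a chamber of J^perp; k labels the simple roots in K by the roots of J they come from. *)
Definition tile w k : Prop := forall a, act w 'a_(k a) = 'a_(phi a).

Lemma tileV w k a : tile w k -> act w^-1%g 'a_(phi a) = 'a_(k a).
Proof. by move=> <-; rewrite (actK hW). Qed.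

Lemma tile_inj w k : tile w k -> injective k.
Proof.
by move=> h a b e; apply: phi_inj; apply: (@simple_root_inj R); rewrite -!h e.
Qed.

Lemma tile_uniq w k k' : tile w k -> tile w k' -> k = k'.
Proof.
move=> h h'; apply/funext => a; apply: (@simple_root_inj R).
by rewrite -(tileV a h) -(tileV a h').
Qed.

Lemma tile_diff w u k k' a : tile w k -> tile u k' ->
  act (w^-1 * u)^-1%g 'a_(k a) = 'a_(k' a).
Proof. by move=> h h'; rewrite invgM invgK (actM hW) h (tileV a h'). Qed.

Lemma tile_crossing w k t y k' : tile w k -> crossing k t y k' -> tile (w * y)%g k'.
Proof. by move=> h [_ _ _ hy] a; rewrite (actM hW) hy h. Qed.

(** The root of a wall crossed without change of type. The conjugated crossing w y w^-1 then acts on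
    J^perp as the reflection in that wall. *)
Definition mirror_root b : Prop := exists w k t y k',
  [/\ tile w k, crossing k t y k', range k' = range k & b = act w 'a_t].

Lemma mirror_root_coxroot b : mirror_root b -> coxroot s b.
Proof.
case=> w [k [t [y [k' [_ _ _ ->]]]]]; apply: (root_act hW); exact: root_simple.
Qed.

Definition same_side w u : Prop :=
  forall b, mirror_root b -> nonneg (act w^-1%g b) <-> nonneg (act u^-1%g b).

(** The combinatorial counterpart of C_max: the chambers that no mirror separates from the chamber
    of w0. *)
Definition region w0 : set W := [set u | (exists k, tile u k) /\ same_side w0 u].

Definition adjacent w w' : Prop :=
  exists k k' t, [/\ tile w k, tile w' k' & crossing k t (w^-1 * w')%g k'].

Lemma region_same_side w0 w u : region w0 w -> region w0 u -> same_side w u.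
Proof. by move=> [_ hw] [_ hu] b mb; rewrite -hw // hu. Qed.

Lemma region_not_mirror w0 w u k t y k' : region w0 w -> region w0 u ->
  tile w k -> crossing k t y k' -> nonpos (act (w^-1 * u)^-1%g 'a_t) -> range k' <> range k.
Proof.
move=> Xw Xu hk cr nt e.
have mb : mirror_root (act w 'a_t) by exists w, k, t, y, k'.
have := region_same_side Xw Xu mb; rewrite (actK hW) => -[+ _] => /(_ (@nonneg_simple _ _ _)).
rewrite -(actM hW) -{1}(invgK w) -invgM => p.
by apply: (root_not_both hW _ p nt); apply: (root_act hW); exact: root_simple.
Qed.

(** Cross a wall t with x^-1 a_t negative. A root with different signs at w and w y lies in the span
    of L, where the shortest representative keeps signs, so it also separates w from u. Mirror roots
    do not, hence w y stays in the region. *)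
Lemma region_next w0 w u : region w0 w -> region w0 u -> w <> u ->
  exists w', [/\ region w0 w', adjacent w w' & (len (w'^-1 * u)%g < len (w^-1 * u)%g)%N].
Proof.
move=> Xw Xu ne; have [[k hk] sw] := Xw; have [[k' hk'] su] := Xu.
set x := (w^-1 * u)%g.
have x1 : x^-1%g <> 1%g.
  move=> /(congr1 (fun z => z^-1)%g); rewrite invgK invg1 => /(congr1 (fun z => w * z)%g).
  by rewrite mulVKg mulg1 => e; apply: ne.
have [t /(len_nonpos (R := R) hW) nt] := len_descent hW x1.
have hx a : act x^-1%g 'a_(k a) = 'a_(k' a) by exact: tile_diff.
have kt : ~ range k t.
  by case=> a _ e; move: nt; rewrite -e hx => /(simple_not_nonpos hW).
have [y [k1 [cr lt pz]]] := crossing_exists hW kt nt hx.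
have tw : tile (w * y)%g k1 by exact: tile_crossing cr.
have e1 : ((w * y)^-1 * u = y^-1 * x)%g by rewrite invgM mulgA.
exists (w * y)%g; split; last by rewrite e1.
  split; first by exists k1.
  have side b : nonneg b -> nonpos (act y^-1%g b) -> nonpos (act x^-1%g b).
    move=> pb nb; have [_ py _ _] := cr; have py' := parabolicV py.
    have sb : supported (with_node k t) (act y^-1%g b).
      move=> i Li; apply/eqP; rewrite eq_le nb /= (parabolic_vcoef hW b py' Li); exact: pb.
    have -> : act x^-1%g b = act (y^-1 * x)^-1%g (act y^-1%g b).
      by rewrite -(actM hW) [((y^-1 * x)^-1)%g]invgM invgK mulgK.
    rewrite -nonnegN -(actN hW); apply: (act_nonneg hW); first by rewrite nonnegN.
    by move=> i; rewrite vcoefN oppr_eq0 => /(supportedP sb); exact: pz.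
  move=> b mb; rewrite sw //.
  have rb := root_act hW w^-1%g (mirror_root_coxroot mb).
  have E1 : act (w * y)^-1%g b = act y^-1%g (act w^-1%g b) by rewrite invgM (actM hW).
  have E2 : act u^-1%g b = act x^-1%g (act w^-1%g b).
    by rewrite -(actM hW) /x invgM invgK mulgK.
  have [s1 s2] := region_same_side Xw Xu mb; rewrite E1; rewrite E2 in s1 s2.
  have ry := root_act hW y^-1%g rb; have rx := root_act hW x^-1%g rb.
  split=> p.
    case: (root_sign hW ry) => // n; case: (root_not_both hW rx); first exact: s1.
    exact: side.
  case: (root_sign hW rb) => // /nonnegN n; apply: s2.
  have := side _ n; rewrite !(actN hW) !nonposN; exact.
by exists k, k1, t; split; rewrite ?mulKg.
Qed.

Lemma adjacent_sym w w' : adjacent w w' -> adjacent w' w.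
Proof.
case=> k [k' [t [hw hw' cr]]]; have [t' ct' _] := crossing_sym hW (tile_inj hw) cr.
by exists k', k, t'; split=> //; rewrite invgM invgK in ct'.
Qed.

Lemma adjacent_sign w w' u k t k' k1 : tile w k -> tile u k1 ->
  crossing k t (w^-1 * w')%g k' ->
  ((len (w'^-1 * u)%g < len (w^-1 * u)%g)%N /\ nonpos (act (w^-1 * u)^-1%g 'a_t)) \/
  (len (w^-1 * u)%g < len (w'^-1 * u)%g)%N.
Proof.
move=> hw hu cr.
have e : ((w^-1 * w')^-1 * (w^-1 * u) = w'^-1 * u)%g.
  by rewrite invgM invgK mulgA mulgK.
have hx a : act (w^-1 * u)^-1%g 'a_(k a) = 'a_(k1 a) by exact: tile_diff.
have rt : coxroot s (act (w^-1 * u)^-1%g 'a_t).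
  by apply: (root_act hW); exact: root_simple.
case: (root_sign hW rt) => h.
  by right; rewrite -e; apply: (crossing_farther hW (tile_inj hw) cr hx h).
by left; split=> //; rewrite -e; have [] := crossing_closer hW cr hx h.
Qed.

(* Two walls i and t of a chamber of type k, both separating it from a chamber at x, cannot both be
type-changing if t stays so once i has been crossed. *)
Definition no_diamond : Prop :=
  forall k k1 k2 k3 k' i t y1 y2 y3 x, injective k ->
  (forall a c : 'I_m, gram R s (k a) (k c) = gram R s (phi a) (phi c)) -> i <> t ->
  crossing k i y1 k1 -> range k1 <> range k ->
  crossing k t y2 k2 -> range k2 <> range k ->
  crossing k1 t y3 k3 -> range k3 <> range k1 ->
  (forall a, act x^-1%g 'a_(k a) = 'a_(k' a)) ->
  nonpos (act x^-1%g 'a_i) -> nonpos (act x^-1%g 'a_t) -> False.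

Hypothesis nodiam : no_diamond.

Lemma tile_gram w k (a b : 'I_m) : tile w k -> gram R s (k a) (k b) = gram R s (phi a) (phi b).
Proof. by move=> h; rewrite -!rform_simple -!h (act_form hW). Qed.

(** Two distinct walls i and t towards u would form the configuration excluded by [no_diamond]:
    after crossing i, the wall t still separates from u and so still changes the type. *)
Lemma region_next_uniq w0 w u w1 w2 : region w0 w -> region w0 u ->
  region w0 w1 -> adjacent w w1 -> (len (w1^-1 * u)%g < len (w^-1 * u)%g)%N ->
  region w0 w2 -> adjacent w w2 -> (len (w2^-1 * u)%g < len (w^-1 * u)%g)%N ->
  w1 = w2.
Proof.
move=> Xw Xu Xw1 [k [k1 [i [hk hk1 c1]]]] lt1 Xw2 [k_ [k2 [t [hk_ hk2 c2]]]] lt2.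
rewrite (tile_uniq hk_ hk) {k_ hk_} in c2.
have [[k' hk'] _] := Xu.
have [ni nt] : nonpos (act (w^-1 * u)^-1%g 'a_i) /\ nonpos (act (w^-1 * u)^-1%g 'a_t).
  by split; [case: (adjacent_sign hk hk' c1) => [[]//|]|
    case: (adjacent_sign hk hk' c2) => [[]//|]]; lia.
have ik := tile_inj hk.
case: (pselect (i = t)) => [eit|it].
  by rewrite eit in c1; have := crossing_uniq hW c1 c2 => /mulgI.
have hx a : act (w^-1 * u)^-1%g 'a_(k a) = 'a_(k' a) by exact: tile_diff.
have [kt _ _ _] := c2.
have Lt : ~ with_node k i t by case=> // e; apply: it.
have k1t : ~ range k1 t.
  by case=> a _ e; apply: Lt; rewrite -e; exact: (crossing_sub hW a c1).
have hx1 a : act (w1^-1 * u)^-1%g 'a_(k1 a) = 'a_(k' a) by exact: tile_diff.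
have nt1 : nonpos (act (w1^-1 * u)^-1%g 'a_t).
  have [_ p1 _ _] := c1.
  (* The root of the wall t of w1, seen from w. Its coefficient at t is still 1, so it is positive,
     and [descent_negative] makes it negative at u. *)
  set d := act (w^-1 * w1)%g 'a_t.
  have rd : coxroot s d by apply: (root_act hW); exact: root_simple.
  have dt : vcoef t d = 1 by rewrite (parabolic_vcoef hW _ p1 Lt) vcoef_simple eqxx.
  have pd : nonneg d.
    by case: (root_sign hW rd) => // /(_ t); rewrite dt ler10.
  have e : act (w1^-1 * u)^-1%g 'a_t = act (w^-1 * u)^-1%g d.
    by rewrite /d -(actM hW) !invgM !invgK mulgA mulgK.
  rewrite e; have rx := root_act hW (w^-1 * u)^-1%g rd.
  case: (root_sign hW rx) => // p.
  have [|||||||j] := @descent_negative _ _ _ _ hW (w^-1 * u)^-1%g [set i; t] (range k) t d.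
  - by move=> _ [a _ <-]; exists (k' a).
  - by move=> _ [->|->].
  - by [].
  - by right.
  - move=> j nj; rewrite (parabolic_vcoef hW _ p1); last first.
      by move=> [Kj|ej]; apply: nj; [left|right; left].
    by rewrite vcoef_simple; case: eqP => // ej; case: nj; right; right.
  - by [].
  - by rewrite dt ltr01.
  by rewrite ltNge p.
have [y3 [k3 [c3 _ _]]] := crossing_exists hW k1t nt1 hx1.
case: (nodiam (x := (w^-1 * u)%g) ik _ it c1 _ c2 _ c3 _ hx ni nt).
- by move=> a b; exact: tile_gram hk.
- exact: (region_not_mirror Xw Xu hk c1 ni).
- exact: (region_not_mirror Xw Xu hk c2 nt).
- exact: (region_not_mirror Xw1 Xu hk1 c3 nt1).
Qed.

Lemma tile_fix h w k : (forall a, act h 'a_(phi a) = 'a_(phi a)) -> tile w k -> tile (h * w)%g k.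
Proof. by move=> hh hk a; rewrite (actM hW) hk hh. Qed.

Lemma mirror_root_fix h b : (forall a, act h 'a_(phi a) = 'a_(phi a)) ->
  mirror_root b -> mirror_root (act h b).
Proof.
move=> hh [w [k [t [y [k' [hk cr e ->]]]]]]; exists (h * w)%g, k, t, y, k'.
by split=> //; [exact: tile_fix|rewrite (actM hW)].
Qed.

Theorem chamber_group_free w0 (H : set W) : is_subgroup H ->
  (exists k, tile w0 k) ->
  (forall h a, H h -> act h 'a_(phi a) = 'a_(phi a)) ->
  (forall h, H h -> same_side w0 (h * w0)%g) -> is_free_group H.
Proof.
move=> sH tw0 Hfix Hside.
apply: (@tree_action_free _ H (region w0) w0 adjacent (fun w u => len (w^-1 * u)%g)) => //.
- move=> h x Hh [[k hk] sx]; split; first by exists k; apply: tile_fix => // a; exact: Hfix.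
  move=> b mb; rewrite (Hside h Hh b mb) !invgM !(actM hW).
  apply: sx; apply: mirror_root_fix => // a; apply: Hfix.
  by case: sH => _ _; apply.
- by move=> w w' _ _; exact: adjacent_sym.
- move=> h w w' Hh [k [k' [t [hk hk' cr]]]]; exists k, k', t; split.
  + by apply: tile_fix => // a; exact: Hfix.
  + by apply: tile_fix => // a; exact: Hfix.
  + by rewrite invgM mulgA mulgVK.
- by move=> h w w' _; rewrite invgM mulgA mulgVK.
- by move=> w; rewrite mulVg len1.
- move=> w u Xw Xu; exact: region_next.
- by move=> u w w1 w2 Xw Xu [? ? ?] [? ? ?]; apply: (region_next_uniq Xw Xu).
- move=> w w' u _ _ [[k1 hk1] _] [k [k' [t [hk hk' cr]]]].
  by case: (adjacent_sign hk hk1 cr) => [[]|]; lia.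
(* No inversions: h w has the same type as w, while an edge inside the region changes the type. *)
- move=> h w Hh Xw [k [k' [t [hk hk' cr]]]].
  have hk2 : tile (h * w)%g k by apply: tile_fix => // a; exact: Hfix.
  have Xhw : region w0 (h * w)%g.
    split; first by exists k.
    move=> b mb; rewrite (Hside h Hh b mb) !invgM !(actM hW).
    case: Xw => _; apply; apply: mirror_root_fix => // a; apply: Hfix.
    by case: sH => _ _; apply.
  rewrite (tile_uniq hk' hk2) in cr; have [_ _ nt _] := cr.
  exact: (region_not_mirror Xw Xhw hk cr nt).
Qed.

End Chambers.

(** * Diagrams that cannot occur *)

Section Affine.
Context {R : realType} {Pi : choiceType} {W : groupType} (s : Pi -> W).
Hypothesis hW : is_coxeter_system s.
Notation V := (@rootspace R Pi).
Notation "''a_' i" := (simple_root R i) (at level 8, i at level 2, format "''a_' i").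
Notation act := (act s).
Notation G := (gram R s).
Implicit Types (u v w x y z : W) (i j t : Pi) (c : R).

(** The triple angle formula turns cos(3x) = -1 into (c + 1)(2c - 1)^2 = 0. *)
Lemma cos_pi3 : cos (pi / 3 : R) = 1 / 2.
Proof.
set x : R := pi / 3; set c := cos x.
have c0 : 0 < c.
  apply: cos_gt0_pihalf; have := pi_gt0 R; rewrite /x => p; apply/andP; split; lra.
have e : cos (x + (x + x)) = -1.
  have -> : x + (x + x) = pi by rewrite /x; field.
  exact: cospi.
move: e; rewrite cosD cosD sinD -/c => e.
have s2 : sin x * sin x = 1 - c * c.
  by have := cos2Dsin2 x; rewrite -/c => h; rewrite -h; ring.
have e3 : (c + 1) * (2 * c - 1) ^+ 2 = 0.
  have : c * (c * c - sin x * sin x) - (sin x * sin x) * (c + c) = -1 by rewrite -e; ring.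
  rewrite s2 => h.
  have -> : (c + 1) * (2 * c - 1) ^+ 2 =
    c * (c * c - (1 - c * c)) - (1 - c * c) * (c + c) + 1 by ring.
  by rewrite h addNr.
move/eqP: e3; rewrite mulf_eq0 sqrf_eq0 => /orP[/eqP h|/eqP h]; lra.
Qed.

(** Every edge, whatever its label, counts at least as much as a simple one; this lets arbitrary
    Coxeter diagrams be compared with simply laced affine ones. *)
Lemma gram_offdiag i j : i != j -> G i j = 0 \/ G i j <= - (1 / 2).
Proof.
move=> ij; have := coxeter_matrix_neq1 hW ij.
rewrite /gram; case: (coxeter_matrix s i j) => [_|[//|[_|n _]]].
- by right; lra.
- by left; rewrite cos_pihalf oppr0.
right; rewrite lerN2 -cos_pi3.
have p0 := pi_gt0 R.
rewrite leNgt ltr_cos -?leNgt ?in_itv /=.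
- by rewrite ler_pM2l // lef_pV2 ?posrE // ler_nat.
- apply/andP; split; first by rewrite divr_ge0 // ltW.
  by rewrite ler_pdivrMr // ler_pMr ?pi_gt0 // ler1n.
- apply/andP; split; first by rewrite divr_ge0 // ltW.
  by rewrite ler_pdivrMr // ler_pMr ?pi_gt0 // ler1n.
Qed.

Lemma gram_le0 i j : i != j -> G i j <= 0.
Proof. by move=> /gram_offdiag [->//|h]; lra. Qed.

Lemma gram_neq0 i j : i != j -> G i j != 0 -> G i j <= - (1 / 2).
Proof. by move=> /gram_offdiag [->|//]; rewrite eqxx. Qed.

Lemma gram_matrix2 i j : coxeter_matrix s i j = 2%N -> G i j = 0.
Proof. by rewrite /gram => ->; rewrite cos_pihalf oppr0. Qed.

Lemma gram_matrix3 i j : coxeter_matrix s i j = 3%N -> G i j = - (1 / 2).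
Proof. by rewrite /gram => ->; rewrite cos_pi3. Qed.

(** All walls F of a chamber of type K separate it from the chamber at x. *)
Definition descends (K F : set Pi) x : Prop :=
  (forall k, K k -> exists k', act x^-1%g 'a_k = 'a_k') /\
  (forall t, F t -> nonpos (act x^-1%g 'a_t)).

(* The vector sum_i (c i) a_(v i) is antidominant when twice the weight of each node is at most the
weight of its neighbours, as for affine diagrams. *)
Lemma descends_no_affine (K F : set Pi) x n (v : 'I_n -> Pi) (c : 'I_n -> nat) (E : rel 'I_n) :
  descends K F x -> injective v ->
  (forall a b, E a b -> a != b /\ G (v a) (v b) <= - (1 / 2)) ->
  (forall a, 2 * c a <= \sum_(b | E a b) c b)%N ->
  (forall a, (K `|` F) (v a)) -> (exists a, [/\ F (v a), ~ K (v a) & (0 < c a)%N]) -> False.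
Proof.
move=> [hK hF] iv hE hc hv [a0 [Fa Ka ca]].
pose nu : V := \sum_a (c a)%:R *: 'a_(v a).
have nuE k : vcoef k nu = \sum_a (c a)%:R * (k == v a)%:R.
  by rewrite vcoef_sum; apply: eq_bigr => a _; rewrite vcoefZ vcoef_simple.
have pnu : nonneg nu.
  by move=> k; rewrite nuE; apply: sumr_ge0 => a _; rewrite mulr_ge0 ?ler0n.
have anti j : root_form s 'a_j nu <= 0.
  rewrite (rform_sumr (gen_sq hW)).
  have -> : \sum_a root_form s 'a_j ((c a)%:R *: 'a_(v a)) = \sum_a (c a)%:R * G j (v a).
    by apply: eq_bigr => a _; rewrite (rformZr (gen_sq hW)) rform_simple.
  case: (pselect (exists a, j = v a)) => [[a ->]|n']; last first.
    apply: sumr_le0 => a _; rewrite mulr_ge0_le0 ?ler0n // gram_le0 //.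
    by apply/eqP => e; apply: n'; exists a.
  rewrite (bigD1 a) //= (gram_diag (gen_sq hW)) mulr1.
  rewrite (bigID (fun b => E a b)) /= addrA.
  have h1 : \sum_(b | (b != a) && ~~ E a b) (c b)%:R * G (v a) (v b) <= 0.
    apply: sumr_le0 => b /andP[ba _]; rewrite mulr_ge0_le0 ?ler0n // gram_le0 //.
    by apply: contra ba => /eqP/iv->.
  have h2 : \sum_(b | (b != a) && E a b) (c b)%:R * G (v a) (v b) <=
      - (1 / 2) * (\sum_(b | E a b) c b)%:R.
    rewrite natr_sum mulr_sumr [X in _ <= X](eq_bigl (fun b => (b != a) && E a b)).
      apply: ler_sum => b /andP[_ /hE [_ h]].
      by rewrite mulrC; apply: ler_wpM2r => //; rewrite ler0n.
    move=> b; case Eab: (E a b); rewrite ?andbF //.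
    by have [ab _] := hE _ _ Eab; rewrite eq_sym ab.
  have h3 : (2 * c a)%:R <= (\sum_(b | E a b) c b)%:R :> R by rewrite ler_nat.
  rewrite natrM in h3; lra.
(* The contradiction: x^-1 makes some coordinate of [nu] negative, while antidominance keeps x^-1 nu
   above [nu]. *)
have [|||i] := descent_negative hW (x := x^-1%g) (K := K) (F := F) (t := v a0) (v := nu)
  hK hF Ka Fa.
- move=> k nk; rewrite nuE big1 // => a _; case: eqP => [e|_]; rewrite ?mulr0 //.
  by case: nk; rewrite e.
- by [].
- rewrite nuE (bigD1 a0) //= eqxx mulr1 ltr_wpDr ?ltr0n //.
  by apply: sumr_ge0 => a _; rewrite mulr_ge0 ?ler0n.
have := antidominant_act hW x^-1%g anti i; rewrite vcoefB => h1 h2.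
have := pnu i; lra.
Qed.

(** Type A~ with all weights 1; the bound n > 2 makes the two neighbours of a node distinct. *)
Lemma descends_no_cycle (K F : set Pi) x n (v : nat -> Pi) :
  descends K F x -> (2 < n)%N ->
  (forall a b, (a < n)%N -> (b < n)%N -> v a = v b -> a = b) ->
  (forall a, (a.+1 < n)%N -> G (v a) (v a.+1) <= - (1 / 2)) ->
  G (v n.-1) (v 0%N) <= - (1 / 2) ->
  (forall a, (a < n)%N -> (K `|` F) (v a)) ->
  (exists2 a, (a < n)%N & F (v a) /\ ~ K (v a)) -> False.
Proof.
case: n => [//|[//|[//|n]]] hd _ iv hs hn hv [a0 la [Fa Ka]]; set N := n.+3 in la iv hs hn hv.
have gC := gram_sym (R := R) (gen_sq hW).
pose E (a b : 'I_N) := (b == ordS a) || (a == ordS b).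
have hS (a : 'I_N) : a != ordS a /\ G (v a) (v (ordS a)) <= - (1 / 2).
  split.
    rewrite -val_eqE /=; have := ltn_ord a; rewrite leq_eqVlt => /orP[/eqP e|lt].
      by rewrite e modnn; case: (nat_of_ord a) e.
    by rewrite modn_small // neq_ltn leqnn.
  rewrite /=; have := ltn_ord a; rewrite leq_eqVlt => /orP[/eqP e|lt].
    by rewrite e modnn; have -> : nat_of_ord a = N.-1 by move: e; rewrite /N; lia.
  by rewrite modn_small //; exact: hs.
apply: (descends_no_affine hd (v := fun a : 'I_N => v a) (c := fun=> 1%N) (E := E)).
- by move=> a b e; apply: val_inj; apply: iv => //; exact: ltn_ord.
- move=> a b /orP[/eqP->|/eqP->]; first exact: hS.
  by have [h1 h2] := hS b; rewrite eq_sym gC.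
- move=> a; rewrite muln1 sum1_card.
  have -> : 2%N = #|[set ordS a; ord_pred a]%SET|.
    rewrite cards2; have -> // : ordS a != ord_pred a.
    rewrite -val_eqE /=; have := ltn_ord a; case: (val a) => [|i] lt.
      by rewrite add0n /= (@modn_small n.+2) // modn_small.
    rewrite addSn /= modnDr (modn_small (ltnW lt)).
    move: (lt); rewrite leq_eqVlt => /orP[/eqP e|lt2].
      by rewrite e modnn; case: i e {lt}.
    by rewrite modn_small // neq_ltn; apply/orP; right; lia.
  apply: subset_leq_card; apply/fintype.subsetP => b.
  rewrite !inE unfold_in /E => /orP[/eqP->|/eqP->].
    by rewrite eqxx.
  by rewrite ord_predK eqxx orbT.
- by move=> a; apply: hv; exact: ltn_ord.
- by exists (Ordinal la).
Qed.

End Affine.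

(** * Type A *)

Section CrossingFacts.
Context {R : realType} {Pi : choiceType} {W : groupType} (s : Pi -> W).
Hypothesis hW : is_coxeter_system s.
Notation V := (@rootspace R Pi).
Notation "''a_' i" := (simple_root R i) (at level 8, i at level 2, format "''a_' i").
Notation act := (act s).
Notation G := (gram R s).
Context (m : nat).
Notation crossing := (@crossing R Pi W s m).
Implicit Types (x y z : W) (i j t : Pi) (c : R) (k : 'I_m -> Pi).

Lemma crossing_gram k t y k' a b : crossing k t y k' -> G (k' a) (k' b) = G (k a) (k b).
Proof. by case=> _ _ _ h; rewrite -!rform_simple -!h (act_form hW). Qed.

Lemma crossing_descends k t y k' : crossing k t y k' ->
  descends (R := R) s (range k) [set t] y.
Proof.
move=> cr; split=> [_ [a _ <-]|_ ->]; last by case: cr.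
by exists (k' a); exact: crossing_simple cr.
Qed.

Lemma crossing_nodes k t y k' : injective k -> crossing k t y k' -> range k' <> range k ->
  exists t', [/\ range k t', ~ range k' t', range k' t & with_node k t = with_node k' t'].
Proof.
move=> ik cr ne; have [t' kt' eL] := crossing_new_node hW ik cr; have [kt _ _ _] := cr.
have mem i : (range k i \/ i = t) <-> (range k' i \/ i = t').
  by have : with_node k t i <-> with_node k' t' i by rewrite eL.
have tt' : t <> t'.
  move=> e; apply: ne; apply/seteqP; split=> i hi.
    by have [//|it] := (mem i).2 (or_introl hi); case: kt'; rewrite -e -it.
  by have [//|it] := (mem i).1 (or_introl hi); case: kt; rewrite e -it.
exists t'; split=> //.
  by have [//|e] := (mem t').2 (or_intror erefl); case: tt'.
by have [//|e] := (mem t).1 (or_intror erefl).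
Qed.

(** Here s_t is itself a crossing, and it fixes every a_(k a). *)
Lemma crossing_orthogonal k t y k' : injective k -> crossing k t y k' ->
  (forall a, G t (k a) = 0) -> range k' = range k.
Proof.
move=> ik cr o; have [kt _ _ hy] := cr.
have ct : crossing k t (s t) k.
  split=> //.
  - by apply: parabolic_s; right.
  - by rewrite (gen_inv hW) (act_s hW) (srefl_self hW) nonposN; exact: nonneg_simple.
  - by move=> a; rewrite (act_s hW) srefl_orthogonal // rform_simple o.
have e := crossing_uniq hW cr ct.
apply/seteqP; split=> _ [a _ <-]; exists a => //; apply: (@simple_root_inj R).
  by rewrite -(crossing_simple hW a cr) e (crossing_simple hW a ct).
by rewrite -(crossing_simple hW a cr) e (crossing_simple hW a ct).
Qed.

Lemma parabolic_integral (L : set Pi) y i j : (forall a b, L a -> L b -> 2 * G a b \is a Num.int) ->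
  parabolic s L y -> L j -> vcoef i (act y 'a_j) \is a Num.int.
Proof.
move=> hL py; move: j i; elim/(parabolic_ind (R := R) hW): py => [j i Lj|{}y l py Ll _ IH j i Lj].
  by rewrite (act1 hW) vcoef_simple; case: eqP; rewrite ?rpred1 ?rpred0.
rewrite (actM hW) (act_s hW) /simple_reflection rform_simple -scaleNr addrC (act_linear hW) vcoefD vcoefZ.
by rewrite rpredD ?IH // mulNr rpredN rpredM ?IH // hL.
Qed.

(* In a simply laced diagram W_L acts trivially on the weights modulo the root lattice; with v twice
a weight this is a congruence modulo 2. *)
Lemma parabolic_even (L : set Pi) y v i : (forall a b, L a -> L b -> 2 * G a b \is a Num.int) ->
  (forall a, L a -> root_form s 'a_a v \is a Num.int) -> parabolic s L y ->
  exists2 n : R, n \is a Num.int & vcoef i (act y v - v) = 2 * n.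
Proof.
move=> hL hv py; elim/(parabolic_ind (R := R) hW): py => [|{}y l py Ll _ [n nI e]].
  by exists 0; rewrite ?rpred0 // (act1 hW) subrr vcoef0 mulr0.
exists (n - root_form s 'a_l v * vcoef i (act y 'a_l)).
  by rewrite rpredB // rpredM ?hv // (parabolic_integral _ hL).
rewrite (actM hW) (act_s hW) /simple_reflection (actD hW) (actN hW) (actZ hW).
by move: e; rewrite !vcoefB vcoefZ => e; rewrite mulrBr -e; ring.
Qed.

End CrossingFacts.

Section TypeA.
Context {R : realType} {Pi : choiceType} {W : groupType} (s : Pi -> W).
Hypothesis hW : is_coxeter_system s.
Notation V := (@rootspace R Pi).
Notation "''a_' i" := (simple_root R i) (at level 8, i at level 2, format "''a_' i").
Notation act := (act s).
Notation G := (gram R s).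
Context (m : nat).
Hypothesis m_odd : odd m.
Notation crossing := (@crossing R Pi W s m).
Implicit Types (x y z : W) (i j t : Pi) (k : 'I_m -> Pi) (p q : nat -> Pi).

Let gC := gram_sym (R := R) (gen_sq hW).
Let gD := gram_diag (R := R) (gen_sq hW).

Definition path_gram a b : R :=
  if a == b then 1 else if (a.+1 == b) || (b.+1 == a) then - (1 / 2) else 0.

Definition is_path p : Prop := forall a b, (a < m)%N -> (b < m)%N ->
  G (p a) (p b) = path_gram a b.

Lemma path_gram_adj a b : path_gram a b = - (1 / 2) -> a.+1 = b \/ b.+1 = a.
Proof.
rewrite /path_gram; case: eqP => _; first by move=> h; exfalso; lra.
case: ifP => [/orP[/eqP->|/eqP->]|_ h]; [by left|by right|exfalso; lra].
Qed.

Lemma mhalf_lt0 : - (1 / 2) < 0 :> R.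
Proof. lra. Qed.

Lemma mhalf_lt1 : - (1 / 2) < 1 :> R.
Proof. lra. Qed.

Lemma path_gramS a : path_gram a a.+1 = - (1 / 2).
Proof. by rewrite /path_gram eqn_leq ltnn andbF eqxx. Qed.

Lemma path_gramC a b : path_gram a b = path_gram b a.
Proof. by rewrite /path_gram eq_sym orbC. Qed.

Lemma is_path_inj p a b : is_path p -> (a < m)%N -> (b < m)%N -> p a = p b -> a = b.
Proof.
move=> hp la lb e; have := hp a b la lb; rewrite e gD /path_gram; case: eqP => // _.
by case: ifP => _ /eqP; rewrite ?oner_eq0 // (gt_eqF mhalf_lt1).
Qed.

Definition rev_path p a := p (m.-1 - a)%N.

Lemma is_path_rev p : is_path p -> is_path (rev_path p).
Proof.
move=> hp a b la lb; rewrite /rev_path hp; try lia.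
rewrite /path_gram.
have -> : (m.-1 - a == m.-1 - b)%N = (a == b) by lia.
by have -> : ((m.-1 - a).+1 == m.-1 - b)%N || ((m.-1 - b).+1 == m.-1 - a)%N =
  (a.+1 == b) || (b.+1 == a) by lia.
Qed.

Definition nodes p : set Pi := [set p a | a in [set a | (a < m)%N]].

Lemma nodes_rev p : nodes (rev_path p) = nodes p.
Proof.
apply/seteqP; split=> _ [a /= la <-].
  by exists (m.-1 - a)%N => //=; lia.
by exists (m.-1 - a)%N; rewrite /= /rev_path; [lia|congr p; lia].
Qed.

(** Once q follows an edge of p it must go on along p, as turning back would repeat a node. At a = m
    - 2 the bound j + a < m leaves only j = 0 and j = 1. *)
Lemma path_shift p q (j : nat) : is_path p -> is_path q -> (2 < m)%N -> (j < m)%N ->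
  (forall a, (0 < a < m)%N -> exists2 b, (b < m)%N & q a = p b) ->
  q 1%N = p j -> q 2%N = p j.+1 -> (j.+1 < m)%N ->
  forall a, (a.+1 < m)%N -> (j + a < m)%N /\ q a.+1 = p (j + a)%N.
Proof.
move=> hp hq m2 jm qp q1 q2 j1m a; have [n] := ubnP a; elim: n a => // n IH [|[|a]] lt am.
- by rewrite addn0.
- by rewrite addn1.
have [||la ea] := IH a.+1; [lia|lia|].
have [||la' ea'] := IH a; [lia|lia|].
have [b lb eb] := qp a.+3 am.
have := hq a.+2 a.+3 (ltnW am) am; rewrite path_gramS ea eb hp // => /path_gram_adj [e|e].
  have eb2 : (j + a.+2)%N = b by lia.
  by rewrite eb2.
have : a.+3 = a.+1; last by lia.
apply: (is_path_inj hq) => //; first by lia.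
by rewrite eb ea'; congr p; lia.
Qed.

Lemma no_cycle_on_path (K F : set Pi) x p t a b : descends (R := R) s K F x ->
  (forall a, (a < m)%N -> K (p a)) -> F t -> ~ K t ->
  is_path p -> (a < b < m)%N -> G t (p a) != 0 -> G t (p b) != 0 -> False.
Proof.
move=> hd Kp Ft Kt hp /andP[ab bm] ta tb.
have tp (c : nat) : (c < m)%N -> t != p c.
  by move=> cm; apply/eqP => e; apply: Kt; rewrite e; exact: Kp.
pose v c := if c is c'.+1 then p (a + c')%N else t.
apply: (descends_no_cycle hW (n := (b - a).+2) (v := v) hd).
- by lia.
- move=> [|c] [|d] //= lc ld e.
  + by have := tp (a + d)%N; rewrite e eqxx => /(_ ltac:(lia)).
  + by have := tp (a + c)%N; rewrite e eqxx => /(_ ltac:(lia)).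
  + have := is_path_inj hp (a := a + c) (b := a + d) _ _ e; lia.
- move=> [|c] /= lc; first by rewrite addn0; apply: (gram_neq0 hW) => //; apply: tp; lia.
  by rewrite hp; [rewrite addnS path_gramS|lia|lia].
- rewrite /= gC; have -> : (a + (b - a))%N = b by lia.
  by apply: (gram_neq0 hW) => //; apply: tp; lia.
- move=> [|c] /= lc; first by right.
  by left; apply: Kp; lia.
- by exists 0%N.
Qed.

(* With nodes numbered from 0 this is the sum over the end nodes and every second node between them:
twice the weight that tells apart the two half-spin classes of D_(m+1). *)
Definition evensum p : V := \sum_(a < m | ~~ odd a) 'a_(p a).

Lemma evensum_rev p : evensum (rev_path p) = evensum p.
Proof.
rewrite /evensum (reindex_inj rev_ord_inj) /=; apply: eq_big => [a|a _].
  by have := ltn_ord a; lia.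
by congr simple_root; rewrite /rev_path; congr p; have := ltn_ord a; lia.
Qed.

(** As m is odd, a node at an odd position has both neighbours, and they contribute -1/2 each. *)
Lemma path_evensum_int p b : is_path p -> (b < m)%N ->
  root_form s 'a_(p b) (evensum p) \is a Num.int.
Proof.
move=> hp lb; rewrite (rform_sumr (gen_sq hW)).
under eq_bigr => a _ do rewrite rform_simple hp //.
have [ob|eb] := boolP (odd b); last first.
  rewrite (bigD1 (Ordinal lb)) //= big1 ?addr0.
    by rewrite /path_gram eqxx rpred1.
  move=> a /andP[ea]; rewrite -val_eqE /= => ab; rewrite /path_gram eq_sym (negbTE ab).
  by case: ifP => //; lia.
have l1 : (b.-1 < m)%N by lia.
have l2 : (b.+1 < m)%N by lia.
rewrite (bigD1 (Ordinal l1)) /=; last by lia.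
rewrite (bigD1 (Ordinal l2)) /=; last by rewrite -val_eqE /=; lia.
rewrite big1 ?addr0; last first.
  move=> a /andP[/andP[ea]]; rewrite -!val_eqE /= => a1 a2; rewrite /path_gram.
  by case: ifP => [|_]; [lia|case: ifP => //; lia].
have -> : path_gram b b.-1 = - (1 / 2).
  have e : b = b.-1.+1 by lia.
  by rewrite path_gramC [X in path_gram _ X]e path_gramS.
rewrite path_gramS; have -> : - (1 / 2) + - (1 / 2) = -1 :> R by field.
by rewrite rpredN rpred1.
Qed.

(** This excludes D_(m+1), where t and p 0 are the short arms that the crossing would exchange. The
    two values of [evensum] differ by 1 at t, but W_L changes coefficients of [evensum p] by even
    integers only. *)
Lemma no_fork p q t y : is_path p -> (2 < m)%N -> (forall a, (a < m)%N -> p a != t) ->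
  G t (p 1%N) = - (1 / 2) -> (forall a, (a < m)%N -> a != 1%N -> G t (p a) = 0) ->
  parabolic s (nodes p `|` [set t]) y -> q 0%N = t ->
  (forall a, (a.+1 < m)%N -> q a.+1 = p a.+1) -> act y (evensum p) = evensum q -> False.
Proof.
move=> hp m2 pt t1 t0 py q0 qp e.
have tI a : (a < m)%N -> 2 * G t (p a) \is a Num.int.
  move=> la; have [->|a1] := eqVneq a 1%N.
    by rewrite t1 mulrN mul1r divff ?pnatr_eq0 // rpredN rpred1.
  by rewrite t0 // mulr0 rpred0.
have LI i j : (nodes p `|` [set t]) i -> (nodes p `|` [set t]) j -> 2 * G i j \is a Num.int.
  case=> [[a la <-]|->]; case=> [[b lb <-]|->].
  - rewrite hp // /path_gram; case: ifP => _; first by rewrite mulr1 rpred_nat.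
    by case: ifP => _; rewrite ?mulr0 ?rpred0 // mulrN mul1r divff ?pnatr_eq0 // rpredN rpred1.
  - by rewrite gC; exact: tI.
  - exact: tI.
  - by rewrite gD mulr1 rpred_nat.
have LE i : (nodes p `|` [set t]) i -> root_form s 'a_i (evensum p) \is a Num.int.
  case=> [[a la <-]|->]; first exact: path_evensum_int.
  rewrite (rform_sumr (gen_sq hW)) big1 ?rpred0 // => a ea; rewrite rform_simple t0 //.
  by apply: contra ea => /eqP ->.
have [n nI] := parabolic_even hW t LI LE py; rewrite e.
have m0 : (0 < m)%N by lia.
rewrite vcoefB !vcoef_sum (bigD1 (Ordinal m0)) //= q0 vcoef_simple eqxx.
rewrite big1 => [|a /andP[_]]; last first.
  rewrite -val_eqE /=; have := ltn_ord a; case: (nat_of_ord a) => // b lb _.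
  by rewrite qp // vcoef_simple eq_sym (negbTE (pt _ _)).
rewrite big1 => [|a _]; last by rewrite vcoef_simple eq_sym (negbTE (pt _ _)).
rewrite addr0 subr0; case/intrP: nI => z -> /eqP.
by rewrite -[2]/(2%:~R) -[1]/(1%:~R) -intrM eqr_int => /eqP; lia.
Qed.

Definition path_of k t a : Pi := oapp k t (insub a).

Lemma path_ofE k t a (la : (a < m)%N) : path_of k t a = k (Ordinal la).
Proof. by rewrite /path_of insubT. Qed.

Lemma path_of_ord k t (a : 'I_m) : path_of k t a = k a.
Proof. by rewrite /path_of valK. Qed.

Lemma nodes_path_of k t : nodes (path_of k t) = range k.
Proof.
apply/seteqP; split=> [_ [a /= la <-]|_ [a _ <-]]; first by rewrite path_ofE; exists (Ordinal la).
by exists (nat_of_ord a); rewrite /= ?path_of_ord.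
Qed.

Definition cons_path t p a : Pi := if a is a'.+1 then p a' else t.

(** The node t has a neighbour on the path by [crossing_orthogonal], and only one since there are no
    cycles. The new path starts at t and then follows the old one, so t is attached at an end or
    next to an end; the latter is D_(m+1). *)
Lemma typeA_crossing k t y k' : (forall a b, G (k a) (k b) = path_gram a b) ->
  crossing k t y k' -> range k' <> range k ->
  exists p, [/\ is_path p, nodes p = range k, G t (p 0%N) <= - (1 / 2),
    (forall a, (0 < a < m)%N -> G t (p a) = 0) &
    is_path (cons_path t p) /\ nodes (cons_path t p) = range k'].
Proof.
move=> hk cr ne.
have m0 : (0 < m)%N by lia.
set p0 := path_of k t; set q0 := path_of k' t.
have hp0 : is_path p0 by move=> a b la lb; rewrite /p0 !path_ofE hk.
have hq0 : is_path q0 by move=> a b la lb; rewrite /q0 !path_ofE (crossing_gram hW _ _ cr) hk.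
have np0 : nodes p0 = range k := nodes_path_of k t.
have nq0 : nodes q0 = range k' := nodes_path_of k' t.
have ik : injective k.
  move=> a b e; apply: val_inj; apply: (is_path_inj hp0); rewrite ?ltn_ord //.
  by rewrite /p0 !path_of_ord.
have e0 : act y^-1%g (evensum p0) = evensum q0.
  rewrite (act_sum hW); apply: eq_bigr => a _.
  by rewrite /p0 /q0 !path_of_ord (crossing_simple hW a cr).
have [t' [kt' k't' k't eL]] := crossing_nodes hW ik cr ne.
have [kt py _ _] := cr.
have p0t a : (a < m)%N -> p0 a != t.
  by move=> la; apply/eqP => e; apply: kt; rewrite -np0 -e; exists a.
have [j lj tj] : exists2 j, (j < m)%N & G t (p0 j) != 0.
  apply: contrapT => n; apply: ne; apply: (crossing_orthogonal hW ik cr) => a.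
  apply/eqP; apply: contrapT => /negP ta; apply: n; exists (nat_of_ord a) => //.
  by rewrite /p0 path_of_ord.
have tju b : (b < m)%N -> G t (p0 b) != 0 -> b = j.
  have nc a c : (a < c < m)%N -> G t (p0 a) != 0 -> G t (p0 c) != 0 -> False.
    move=> ac; apply: (no_cycle_on_path (crossing_descends hW cr)) => //.
    by move=> d ld; rewrite -np0; exists d.
  move=> lb tb; case: (ltngtP b j) => // lt.
    by case: (nc b j) => //; rewrite lt.
  by case: (nc j b) => //; rewrite lt.
have tj0 b : (b < m)%N -> b != j -> G t (p0 b) = 0.
  by move=> lb bj; apply/eqP; apply: contraNT bj => /(tju b lb) ->.
(* For m = 1 the edge may carry any label, which is why the conclusion at [p 0] is an inequality. *)
have [m1|m2] : m = 1%N \/ (2 < m)%N by lia.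
  have j0 : j = 0%N by lia.
  exists p0; split=> //; first by apply: (gram_neq0 hW); rewrite -?j0 // eq_sym p0t.
    by move=> a; rewrite m1; lia.
  split; first by move=> a b; rewrite m1 !ltnS !leqn0 => /eqP-> /eqP->; rewrite gD.
  rewrite -nq0; have t0 : q0 0%N = t.
    by move: k't; rewrite -nq0 => -[a /=]; rewrite m1 ltnS leqn0 => /eqP->.
  apply/seteqP; split=> _ [a /= la <-]; exists 0%N => //=; rewrite ?t0;
    by move: la; rewrite m1 ltnS leqn0 => /eqP->.
have half0 : - (1 / 2) != 0 :> R by rewrite lt_eqF // mhalf_lt0.
(* t is an end of the new path: both neighbours of an inner node t would be p0 j. *)
have [q [hq nq q0t eq]] : exists q, [/\ is_path q, nodes q = range k', q 0%N = t &
    evensum q = evensum q0].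
  have q0p a : (a < m)%N -> q0 a != t -> exists2 b, (b < m)%N & q0 a = p0 b.
    move=> la at'; have := crossing_sub hW (Ordinal la) cr.
    rewrite -(path_ofE k' t) -/q0 => -[]; last by move/eqP; rewrite (negbTE at').
    by rewrite -np0 => -[b lb <-]; exists b.
  move: (k't); rewrite -nq0 => -[a0 /= la0 ea0].
  have nb a : (a < m)%N -> path_gram a0 a = - (1 / 2) -> q0 a = p0 j.
    move=> la h; have gt : G t (q0 a) = - (1 / 2) by rewrite -ea0 hq0.
    have [|b lb eb] := q0p a la.
      by apply/eqP => e; have := gD t; rewrite -{2}e gt => /eqP; rewrite (lt_eqF mhalf_lt1).
    by rewrite eb (tju b lb) // -eb gt.
  have [z|[z|z]] : (a0 = 0 \/ a0 = m.-1 \/ (0 < a0 < m.-1))%N by lia.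
  - by exists q0; rewrite -z.
  - exists (rev_path q0); rewrite nodes_rev evensum_rev; split=> //.
      exact: is_path_rev.
    by rewrite /rev_path subn0 -z.
  - have : a0.-1 = a0.+1; last by lia.
    apply: (is_path_inj hq0); [lia|lia|].
    rewrite !nb //; [lia|by rewrite path_gramS|lia|].
    have e : a0 = a0.-1.+1 by lia.
    by rewrite path_gramC [X in path_gram _ X]e path_gramS.
have qp a : (0 < a < m)%N -> exists2 b, (b < m)%N & q a = p0 b.
  move=> /andP[a0 la]; have : range k' (q a) by rewrite -nq; exists a.
  case=> c _ ec; have := crossing_sub hW c cr; rewrite ec => -[|et].
    by rewrite -np0 => -[b lb <-]; exists b.
  have : a = 0%N by apply: (is_path_inj hq) => //; rewrite et q0t.
  by lia.
have [q1 tjE] : q 1%N = p0 j /\ G t (p0 j) = - (1 / 2).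
  have [|b lb eb] := qp 1%N; first by lia.
  have gb : G t (p0 b) = - (1 / 2) by rewrite -eb -q0t hq ?path_gramS //; lia.
  have bj : b = j by apply: tju => //; rewrite gb.
  by rewrite -bj.
(* orient p so that q runs along it in increasing order *)
have [p [i [hp np ep [li ti ti0] [q1p q2p]]]] : exists p (i : nat),
    [/\ is_path p, nodes p = range k, evensum p = evensum p0,
     [/\ (i.+1 < m)%N, G t (p i) = - (1 / 2) & forall b, (b < m)%N -> b != i -> G t (p b) = 0]
     & q 1%N = p i /\ q 2%N = p i.+1].
  have [|b lb eb] := qp 2%N; first by lia.
  have : path_gram j b = - (1 / 2) by rewrite -hp0 // -eb -q1 hq ?path_gramS //; lia.
  case/path_gram_adj => e.
    by exists p0, j; rewrite e; split.
  exists (rev_path p0), (m.-1 - j)%N; rewrite nodes_rev evensum_rev.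
  have r1 : rev_path p0 (m.-1 - j)%N = p0 j by rewrite /rev_path; congr p0; lia.
  have r2 : rev_path p0 (m.-1 - j).+1 = p0 b by rewrite /rev_path; congr p0; lia.
  split=> //; rewrite ?r1 ?r2 //; first exact: is_path_rev.
  split=> //; first by lia.
  by move=> c lc cj; rewrite /rev_path tj0 //; lia.
have qp' a : (0 < a < m)%N -> exists2 b, (b < m)%N & q a = p b.
  move=> /qp [b lb ->]; have : nodes p (p0 b) by rewrite np -np0; exists b.
  by case=> c lc <-; exists c.
have shift := path_shift hp hq m2 (ltnW li) qp' q1p q2p li.
have pt a : (a < m)%N -> p a != t.
  by move=> la; apply/eqP => e; apply: kt; rewrite -np -e; exists a.
have [i0|i1] : (i = 0 \/ i = 1)%N by have [|+ _] := shift m.-2; lia.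
  rewrite i0 in shift ti ti0; have cq a : (a < m)%N -> cons_path t p a = q a.
    by case: a => [|a] la; rewrite ?q0t //=; have [_ ->] := shift a la.
  exists p; split=> //; first by rewrite ti.
    by move=> a /andP[a0 la]; apply: ti0 => //; lia.
  split; first by move=> a b la lb; rewrite !cq // hq.
  by rewrite -nq; apply/seteqP; split=> _ [a /= la <-]; exists a; rewrite //= cq.
exfalso; rewrite i1 in shift ti ti0.
apply: (no_fork hp m2 pt ti ti0 (y := y^-1%g) (q := q)) => //.
- by rewrite np; exact: parabolicV.
- by move=> a la; have [_ ->] := shift a la; rewrite add1n.
- by rewrite ep e0 eq.
Qed.

(** The same for a numbering p fixed in advance, so that two walls of one chamber can be
    compared. *)
Lemma typeA_end k t y k' p : (forall a b, G (k a) (k b) = path_gram a b) ->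
  crossing k t y k' -> range k' <> range k -> is_path p -> nodes p = range k ->
  exists b, [/\ (b < m)%N, b = 0%N \/ b = m.-1, G t (p b) <= - (1 / 2) &
    forall c, (c < m)%N -> c <> b -> G t (p c) = 0].
Proof.
move=> hk cr ne hp np.
have [p2 [hp2 np2 t0 ta _]] := typeA_crossing hk cr ne.
have m0 : (0 < m)%N by lia.
have in2 a : (a < m)%N -> exists2 b, (b < m)%N & p a = p2 b.
  by move=> la; have : nodes p2 (p a); [rewrite np2 -np; exists a|case=> b lb <-; exists b].
have [b lb eb] : exists2 b, (b < m)%N & p b = p2 0%N.
  by have : nodes p (p2 0%N); [rewrite np -np2; exists 0%N|case=> b lb <-; exists b].
exists b; split=> //; first last.
- move=> c lc cb; have [d ld ed] := in2 c lc; rewrite ed ta // ld andbT lt0n.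
  by apply/eqP => d0; apply: cb; apply: (is_path_inj hp) => //; rewrite ed d0 eb.
- by rewrite eb.
have nb a : (a < m)%N -> path_gram b a = - (1 / 2) -> p a = p2 1%N.
  move=> la h; have [d ld ed] := in2 a la; rewrite ed.
  have : path_gram 0 d = - (1 / 2) by rewrite -hp2 // -eb -ed hp.
  by case/path_gram_adj => [<-|].
have [|[|z]] : (b = 0 \/ b = m.-1 \/ (0 < b < m.-1))%N by lia.
- by left.
- by right.
have : b.-1 = b.+1; last by lia.
apply: (is_path_inj hp); [lia|lia|].
rewrite !nb //; [lia|by rewrite path_gramS|lia|].
have e : b = b.-1.+1 by lia.
by rewrite path_gramC [X in path_gram _ X]e path_gramS.
Qed.

(** Crossing i turns p 0, ..., p (m-1) into i, p 0, ..., p (m-2). The node t is attached at an end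
    of both paths, and p (m-2) is not an end of the first one. So t is joined to i, and t, i, p 0,
    ..., p b is a cycle. *)
Theorem typeA_no_diamond (phi : 'I_m -> Pi) :
  (forall a b, G (phi a) (phi b) = path_gram a b) -> no_diamond (R := R) s phi.
Proof.
move=> hphi k k1 k2 k3 k' i t y1 y2 y3 x ik gk it c1 n1 c2 n2 c3 n3 hx ni nt.
have hk a b : G (k a) (k b) = path_gram a b by rewrite gk.
have hk1 a b : G (k1 a) (k1 b) = path_gram a b by rewrite (crossing_gram hW _ _ c1).
have [p [hp np ip0 ipa [hq nq]]] := typeA_crossing hk c1 n1.
have [b [lb b0 tb tc]] := typeA_end hk c2 n2 hp np.
have [d [ld d0 td _]] := typeA_end hk1 c3 n3 hq nq.
have [ki _ _ _] := c1; have [kt _ _ _] := c2.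
have pK a : (a < m)%N -> range k (p a) by move=> la; rewrite -np; exists a.
have pn a j : (a < m)%N -> ~ range k j -> p a <> j.
  by move=> la kj e; apply: kj; rewrite -e; exact: pK.
have hd : descends (R := R) s (range k) [set i; t] x.
  split; first by move=> _ [a _ <-]; exists (k' a).
  by move=> _ [->|->].
case: d ld d0 td => [|d] ld d0 /= td; last first.
  have dm : d.+1 = m.-1 by case: d0.
  have : d = b; last by lia.
  apply: contrapT => db; move: td; rewrite tc //; last by lia.
  by rewrite leNgt mhalf_lt0.
pose v c := if c is c'.+1 then cons_path i p c' else t.
apply: (descends_no_cycle hW (n := b.+3) (v := v) hd) => //.
- move=> [|[|a]] [|[|c]] //= la lc e.
  + by case: it.
  + by case: (pn c t) => //; lia.
  + by case: (pn c i) => //; lia.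
  + by case: (pn a t) => //; lia.
  + by case: (pn a i) => //; lia.
  + have := is_path_inj hp (a := a) (b := c) _ _ e; lia.
- move=> [|[|a]] /= la //; rewrite hp; [|lia|lia].
  by rewrite path_gramS.
- by rewrite /= gC.
- move=> [|[|a]] /= la; [by right; right|by right; left|left; apply: pK; lia].
- by exists 0%N => //; split=> //; right.
Qed.

End TypeA.

(** * Type D5 *)

Section TypeD5.
Context {R : realType} {Pi : choiceType} {W : groupType} (s : Pi -> W).
Hypothesis hW : is_coxeter_system s.
Notation V := (@rootspace R Pi).
Notation "''a_' i" := (simple_root R i) (at level 8, i at level 2, format "''a_' i").
Notation act := (act s).
Notation G := (gram R s).
Notation crossing := (@crossing R Pi W s 5).
Implicit Types (x y z : W) (i j t : Pi) (k : 'I_5 -> Pi) (f q : nat -> Pi) (a b : nat).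

Let gC := gram_sym (R := R) (gen_sq hW).
Let gD := gram_diag (R := R) (gen_sq hW).

Definition d5_edge (a b : nat) : bool :=
  (a, b) \in [:: (0, 1); (1, 0); (1, 2); (2, 1); (2, 3); (3, 2); (2, 4); (4, 2)]%N.

Definition d5_gram (a b : nat) : R :=
  if a == b then 1 else if d5_edge a b then - (1 / 2) else 0.

Definition is_d5 f : Prop := forall a b, (a < 5)%N -> (b < 5)%N ->
  G (f a) (f b) = d5_gram a b.

Lemma d5_gram_edge a b : d5_gram a b = - (1 / 2) -> d5_edge a b.
Proof.
rewrite /d5_gram; case: eqP => [_ /eqP|_]; first by rewrite gt_eqF // mhalf_lt1.
by case: ifP => // _ /eqP; rewrite gt_eqF // mhalf_lt0.
Qed.

Lemma d5_edge_gram a b : d5_edge a b -> d5_gram a b = - (1 / 2).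
Proof.
move=> e; rewrite /d5_gram e; case: eqP => // ab; move: e; rewrite ab /d5_edge.
by rewrite !inE !xpair_eqE; case: b {ab} => [|[|[|[|[|]]]]].
Qed.

Lemma is_d5_inj f a b : is_d5 f -> (a < 5)%N -> (b < 5)%N -> f a = f b -> a = b.
Proof.
move=> hf la lb e; have := hf a b la lb; rewrite e gD /d5_gram; case: eqP => // _.
by case: ifP => _ /eqP; rewrite ?oner_eq0 // (gt_eqF mhalf_lt1).
Qed.

(** The nodes 0 to 4 are those of D5, and 5 + r is the r-th extra node. No edges between extra nodes
    are recorded. *)
Definition ext_edge (N : nat -> nat -> bool) a b : bool :=
  if (a < 5)%N then if (b < 5)%N then d5_edge a b else N (b - 5)%N a
  else if (b < 5)%N then N (a - 5)%N b else false.

Definition ext_check N n (c : seq nat) : bool :=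
  all (fun a => 2 * nth 0 c a <= sumn [seq nth 0 c b | b <- iota 0 n & ext_edge N a b])%N
    (iota 0 n).

(* N r a states that the r-th extra node is joined to the node a of the diagram D5, and c lists the
weights. *)
Lemma d5_no_affine (K F : set Pi) x f (es : seq Pi) (N : nat -> nat -> bool) (c : seq nat) :
  descends (R := R) s K F x -> is_d5 f -> (forall a, (a < 5)%N -> K (f a)) ->
  (forall e, e \in es -> F e /\ ~ K e) -> uniq es ->
  (forall (r a : nat) d, (r < size es)%N -> (a < 5)%N -> N r a ->
    G (nth d es r) (f a) <= - (1 / 2)) ->
  ext_check N (5 + size es) c ->
  (exists2 r, (r < size es)%N & (0 < nth 0 c (5 + r))%N) -> False.
Proof.
move=> hd hf Kf hes ues hN hc [r0 lr0 cr0].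
pose v (a : 'I_(5 + size es)) := if (a < 5)%N then f a else nth (f 0%N) es (a - 5).
have lts (a : 'I_(5 + size es)) : (a < 5)%N = false -> (a - 5 < size es)%N.
  by have := ltn_ord a; lia.
apply: (descends_no_affine hW hd (v := v) (c := fun a : 'I__ => nth 0%N c a)
  (E := fun a b : 'I__ => ext_edge N a b)).
- move=> a b; rewrite /v; case: ifP => la; case: ifP => lb e; apply: val_inj => /=.
  + exact: (is_d5_inj hf).
  + by have [_ []] := hes _ (mem_nth (f 0%N) (lts _ lb)); rewrite -e; exact: Kf.
  + by have [_ []] := hes _ (mem_nth (f 0%N) (lts _ la)); rewrite e; exact: Kf.
  + move/eqP: e; rewrite nth_uniq ?lts // => /eqP e.
    by move: la lb e; lia.
- move=> a b; rewrite /ext_edge /v; case: ifP => la; case: ifP => lb // e.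
  + split; last by rewrite hf // d5_edge_gram.
    apply: contraTneq e => ->; rewrite /d5_edge !inE !xpair_eqE.
    by case: (nat_of_ord b) => [|[|[|[|[|]]]]].
  + split; first by apply: contraFneq lb => <-.
    by rewrite gC; apply: hN => //; exact: lts.
  + split; first by apply: contraFneq la => ->.
    by apply: hN => //; exact: lts.
- move=> a; move/allP: hc => /(_ (nat_of_ord a)); rewrite mem_iota leq0n add0n ltn_ord => /(_ isT).
  move=> /leq_trans; apply; rewrite sumnE big_map big_filter.
  by rewrite -(big_mkord (ext_edge N a) (fun b => nth 0%N c b)) /index_iota subn0.
- move=> a; rewrite /v; case: ifP => la; first by left; exact: Kf.
  by right; have [] := hes _ (mem_nth (f 0%N) (lts _ la)).
- have l0 : (5 + r0 < 5 + size es)%N by lia.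
  have vE : v (Ordinal l0) = nth (f 0%N) es r0.
    have lF : (Ordinal l0 < 5)%N = false by rewrite /=; lia.
    rewrite /v lF.
    by apply: (congr1 (nth (f 0%N) es)); rewrite /=; lia.
  exists (Ordinal l0); rewrite vE.
  by have [? ?] := hes _ (mem_nth (f 0%N) lr0); split.
Qed.

Lemma d5_one_neighbour k t y k' f a b : crossing k t y k' -> is_d5 f ->
  nodes 5 f = range k -> (a < b < 5)%N -> G t (f a) != 0 -> G t (f b) != 0 -> False.
Proof.
move=> cr hf nf /andP[ab lb] ta tb; have [kt _ _ _] := cr.
have fk c : (c < 5)%N -> range k (f c) by move=> lc; rewrite -nf; exists c.
have tf c : (c < 5)%N -> t != f c.
  by move=> lc; apply/eqP => e; apply: kt; rewrite e; exact: fk.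
have la := ltn_trans ab lb.
have ga := gram_neq0 hW (tf _ la) ta; have gb := gram_neq0 hW (tf _ lb) tb.
pose N (r c : nat) := (c == a) || (c == b).
(* Weight 1 on the nodes between a and b in the tree D5, which form a cycle with t. This is the
   interval from a to b, except that 3 is not on the way to 4 and that 3 and 4 are joined through
   2. *)
pose on_path (c : nat) : nat := ((a <= c <= b) && ~~ [&& c == 3, b == 4 & a != 3] ||
  (c == 2) && (a == 3))%N.
apply: (d5_no_affine (c := [:: on_path 0; on_path 1; on_path 2; on_path 3; on_path 4; 1]%N)
  (es := [:: t]) (N := N) (crossing_descends hW cr) hf fk) => //.
- by move=> e; rewrite inE => /eqP ->; split.
- by move=> [|//] c d _ lc /orP[/eqP->|/eqP->].
- rewrite /ext_check /on_path /N; clear -ab lb.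
  by move: a b ab lb => [|[|[|[|[|a]]]]] [|[|[|[|[|b]]]]].
- by exists 0%N.
Qed.

Definition d5_swap (a : nat) : nat := nth 0%N [:: 0; 1; 2; 4; 3]%N a.

Lemma is_d5_swap f : is_d5 f -> is_d5 (f \o d5_swap).
Proof.
move=> hf a b la lb; rewrite /= hf.
- by move: a b la lb => [|[|[|[|[|//]]]]] [|[|[|[|[|//]]]]].
- by move: a la => [|[|[|[|[|//]]]]].
- by move: b lb => [|[|[|[|[|//]]]]].
Qed.

Lemma nodes5E f : nodes 5 f = [set i | [\/ i = f 0, i = f 1 | i = f 2]%N \/ i = f 3%N \/ i = f 4%N].
Proof.
apply/seteqP; split=> [_ [[|[|[|[|[|//]]]]] /= _ <-]|i].
- by left; apply: Or31.
- by left; apply: Or32.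
- by left; apply: Or33.
- by right; left.
- by right; right.
by case=> [[]|[]] ->; [exists 0%N|exists 1%N|exists 2%N|exists 3%N|exists 4%N].
Qed.

Lemma nodes_d5_swap f : nodes 5 (f \o d5_swap) = nodes 5 f.
Proof. by rewrite !nodes5E /=; apply/seteqP; split=> i /=; tauto. Qed.

(** The other subdiagram D5 of E6: its long arm is t, f 3, the branch node stays, and f 0 drops
    out. *)
Definition d5_next t f a : Pi := nth t [:: t; f 3; f 2; f 1; f 4]%N a.

(* Only the extension E6, joined to a short arm, changes the type: the other ways of joining t
contain a cycle or an affine diagram, or are of type D6. *)
Lemma d5_crossing k t y k' : (forall a b : 'I_5, G (k a) (k b) = d5_gram a b) ->
  crossing k t y k' -> range k' <> range k ->
  exists f, [/\ is_d5 f, nodes 5 f = range k, G t (f 3%N) = - (1 / 2),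
    (forall a, (a < 5)%N -> a != 3%N -> G t (f a) = 0) &
    is_d5 (d5_next t f) /\ nodes 5 (d5_next t f) = range k'].
Proof.
move=> hk cr ne.
set f0 := path_of k t; set q := path_of k' t.
have hf0 : is_d5 f0 by move=> a b la lb; rewrite /f0 !path_ofE hk.
have hq : is_d5 q by move=> a b la lb; rewrite /q !path_ofE (crossing_gram hW _ _ cr) hk.
have nf0 : nodes 5 f0 = range k := nodes_path_of k t.
have nq : nodes 5 q = range k' := nodes_path_of k' t.
have ik : injective k.
  move=> a b e; apply: val_inj; apply: (is_d5_inj hf0); rewrite ?ltn_ord //.
  by rewrite /f0 !path_of_ord.
have [t' [kt' k't' k't eL]] := crossing_nodes hW ik cr ne.
have [kt py _ _] := cr.
have [f [j [hf nf j4 tj tj0]]] : exists f (j : nat), [/\ is_d5 f, nodes 5 f = range k, (j < 4)%N,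
    G t (f j) != 0 & forall b, (b < 5)%N -> G t (f b) != 0 -> b = j].
  have [j lj tj] : exists2 j : nat, (j < 5)%N & G t (f0 j) != 0.
    apply: contrapT => n; apply: ne; apply: (crossing_orthogonal hW ik cr) => a.
    apply/eqP; apply: contrapT => /negP ta; apply: n; exists (nat_of_ord a) => //.
    by rewrite /f0 path_of_ord.
  have uniq_j f b c : is_d5 f -> nodes 5 f = range k -> (b < 5)%N -> (c < 5)%N ->
      G t (f b) != 0 -> G t (f c) != 0 -> b = c.
    move=> hf nf lb lc tb tc; case: (ltngtP b c) => // lt.
      by case: (@d5_one_neighbour k t y k' f b c cr hf nf) => //; rewrite lt.
    by case: (@d5_one_neighbour k t y k' f c b cr hf nf) => //; rewrite lt.
  case: (eqVneq j 4%N) => [j4|j4]; last first.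
    by exists f0, j; split=> //; [lia|move=> b lb tb; apply: (uniq_j f0)].
  rewrite j4 in tj; exists (f0 \o d5_swap), 3%N; split=> //.
  - exact: is_d5_swap.
  - by rewrite nodes_d5_swap.
  - move=> b lb tb; apply: (uniq_j (f0 \o d5_swap)) => //; first exact: is_d5_swap.
    by rewrite nodes_d5_swap.
have half0 : - (1 / 2) != 0 :> R by rewrite lt_eqF // mhalf_lt0.
have fk c : (c < 5)%N -> range k (f c) by move=> lc; rewrite -nf; exists c.
have qf a : (a < 5)%N -> q a != t -> exists2 b, (b < 5)%N & q a = f b.
  move=> la at'; have := crossing_sub hW (Ordinal la) cr.
  rewrite -(path_ofE k' t) -/q => -[]; last by move/eqP; rewrite (negbTE at').
  by rewrite -nf => -[b lb <-]; exists b.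
move: (k't); rewrite -nq => -[a0 /= la0 ea0].
have step a b c : (a < 5)%N -> (b < 5)%N -> (c < 5)%N -> d5_edge a b -> b != a0 -> q a = f c ->
    exists d, [/\ (d < 5)%N, q b = f d & d5_edge c d].
  move=> la lb lc ab ba0 e; have [|d ld ed] := qf b lb.
    by rewrite -ea0; apply: contra ba0 => /eqP /(is_d5_inj hq lb la0) ->.
  exists d; split=> //; apply: d5_gram_edge; by rewrite -hf // -e -ed hq // d5_edge_gram.
have nb a : (a < 5)%N -> d5_edge a0 a -> q a = f j /\ G t (f j) = - (1 / 2).
  move=> la h; have gt : G t (q a) = - (1 / 2) by rewrite -ea0 hq // d5_edge_gram.
  have [|b lb eb] := qf a la.
    by apply/eqP => e; have := gD t; rewrite -{2}e gt => /eqP; rewrite (lt_eqF mhalf_lt1).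
  by rewrite -(tj0 b lb) -eb gt.
have inj a b : (a < 5)%N -> (b < 5)%N -> a != b -> q a = q b -> False.
  by move=> la lb ab e; move/eqP: ab; apply; apply: (is_d5_inj hq).
have aff (c : seq nat) : ext_check (fun _ a => a == j) 6 c -> (0 < nth 0%N c 5)%N ->
    G t (f j) = - (1 / 2) -> False.
  move=> hc c5 g; apply: (@d5_no_affine (range k) [set t] y f [:: t] (fun _ a => a == j) c
    (crossing_descends hW cr) hf fk) => //.
  - by move=> e; rewrite inE => /eqP ->; split.
  - by move=> [|//] a d _ la /eqP ->; rewrite g.
  - by exists 0%N.
have e2 d : d5_edge 0 d -> d = 1%N by rewrite /d5_edge !inE !xpair_eqE; case: d => [|[|]].
have e3 d : d5_edge 3 d -> d = 2%N by rewrite /d5_edge !inE !xpair_eqE; case: d => [|[|[|]]].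
(* two neighbours of a node of valency three cannot both map to the only neighbour of an end *)
have stuck c b b' : (c < 5)%N -> q 2%N = f c -> (forall d, d5_edge c d -> d = 1%N) \/
    (forall d, d5_edge c d -> d = 2%N) ->
    (b < 5)%N -> (b' < 5)%N -> d5_edge 2 b -> d5_edge 2 b' ->
    b != b' -> b != a0 -> b' != a0 -> False.
  move=> lc qc hc lb lb' eb eb' bb' ba ba'.
  have [d [_ qd /= ed]] := step 2%N b c isT lb lc eb ba qc.
  have [d' [_ qd' ed']] := step 2%N b' c isT lb' lc eb' ba' qc.
  apply: (inj b b') => //; rewrite qd qd'.
  by case: hc => h; rewrite (h _ ed) (h _ ed').
(* t is an end of the new diagram: at position 1 or 2 it would have two neighbours, both equal to f
   j. *)
have la0' : [\/ a0 = 0, a0 = 3 | a0 = 4]%N.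
  move: (a0) la0 nb => [|[|[|[|[|//]]]]] _ nb'; try by [apply: Or31|apply: Or32|apply: Or33].
  - exfalso; apply: (inj 0%N 2%N) => //.
    by have [-> _] := nb' 0%N isT isT; have [-> _] := nb' 2%N isT isT.
  - exfalso; apply: (inj 1%N 3%N) => //.
    by have [-> _] := nb' 1%N isT isT; have [-> _] := nb' 3%N isT isT.
have tjE : G t (f j) = - (1 / 2).
  by case: la0' => e; rewrite e in nb; [have [] := nb 1%N isT isT|have [] := nb 2%N isT isT
    |have [] := nb 2%N isT isT].
have [j0|[j1|[j2|j3]]] : (j = 0 \/ j = 1 \/ j = 2 \/ j = 3)%N by lia.
(* For j = 0 the extended diagram is D6, whose only subdiagram of type D5 is the one without t. *)
- exfalso; have he : forall d, d5_edge j d -> d = 1%N by rewrite j0.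
  case: la0' => a0E; rewrite a0E in nb step stuck.
  + have [q1 _] := nb 1%N isT isT.
    have [d [ld qd /he ed]] := step 1%N 2%N j isT isT (ltnW j4) isT isT q1.
    rewrite ed in qd.
    have sub b : d5_edge 2 b -> (b < 5)%N -> b != 0%N -> b != 1%N -> q b = f 2%N.
      move=> eb lb b0 b1; have [c [lc qc]] := step 2%N b 1%N isT lb isT eb b0 qd.
      rewrite /d5_edge !inE !xpair_eqE; case: c lc qc => [|[|[|c]]] // _ qc _.
      by case: (inj b 1%N) => //; rewrite qc q1 j0.
    by apply: (inj 3%N 4%N) => //; rewrite !sub.
  + have [q2 _] := nb 2%N isT isT.
    by apply: (stuck j 1%N 4%N) => //; [exact: ltnW|left].
  + have [q2 _] := nb 2%N isT isT.
    by apply: (stuck j 1%N 3%N) => //; [exact: ltnW|left].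
(* With t at node 1 the diagram is D5~, and with t at node 2 it contains D4~; the lists are their
   marks. *)
- by case: (aff [:: 1; 2; 2; 1; 1; 1]%N) => //; rewrite j1.
- by case: (aff [:: 0; 1; 2; 1; 1; 1]%N) => //; rewrite j2.
(* E6 remains. On a short arm of the new diagram t would run into [stuck], so t ends the long
   arm. *)
have he : forall d, d5_edge j d -> d = 2%N by rewrite j3.
have q0 : a0 = 0%N.
  case: la0' => // a0E; exfalso; rewrite a0E in nb step stuck; have [q2 _] := nb 2%N isT isT.
    by apply: (stuck j 1%N 4%N) => //; [exact: ltnW|right].
  by apply: (stuck j 1%N 3%N) => //; [exact: ltnW|right].
rewrite q0 in nb step ea0.
have [q1 _] := nb 1%N isT isT.
have [d [_ q2 /he ed]] := step 1%N 2%N j isT isT (ltnW j4) isT isT q1.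
rewrite {d}ed in q2; rewrite j3 in q1 tjE.
have sub b : d5_edge 2 b -> (b < 5)%N -> b != 0%N -> b != 1%N -> q b = f 1%N \/ q b = f 4%N.
  move=> eb lb b0 b1; have [c [lc qc]] := step 2%N b 2%N isT lb isT eb b0 q2.
  rewrite /d5_edge !inE !xpair_eqE; case: c lc qc => [|[|[|[|[|c]]]]] // _ qc _.
  - by left.
  - by case: (inj b 1%N) => //; rewrite qc q1.
  - by right.
have t0 a : (a < 5)%N -> a != 3%N -> G t (f a) = 0.
  by move=> la a3; apply/eqP; apply: contraNT a3 => /(tj0 a la) ->; rewrite j3.
exists f; split=> //; split.
  move=> [|[|[|[|[|//]]]]] [|[|[|[|[|//]]]]] _ _; rewrite /d5_next /= ?gD //;
    first [by rewrite hf|by rewrite ?tjE // t0|by rewrite gC ?tjE // t0].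
rewrite !nodes5E /d5_next /= ea0 q1 q2.
have n34 : q 3%N <> q 4%N by exact: (inj 3%N 4%N).
case: (sub 3%N isT isT isT isT) => h3; case: (sub 4%N isT isT isT isT) => h4;
  rewrite h3 h4 in n34 *; try (by case: n34); by apply/seteqP; split=> i /=; tauto.
Qed.

End TypeD5.

Section TypeD5Diamond.
Context {R : realType} {Pi : choiceType} {W : groupType} (s : Pi -> W).
Hypothesis hW : is_coxeter_system s.
Notation V := (@rootspace R Pi).
Notation "''a_' i" := (simple_root R i) (at level 8, i at level 2, format "''a_' i").
Notation act := (act s).
Notation G := (gram R s).
Notation crossing := (@crossing R Pi W s 5).
Notation is_d5 := (@is_d5 R Pi W s).
Implicit Types (x y z : W) (i j t : Pi) (k : 'I_5 -> Pi) (f q : nat -> Pi) (a b : nat).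

Let gC := gram_sym (R := R) (gen_sq hW).
Let gD := gram_diag (R := R) (gen_sq hW).

(** With i at f 3, the node t is attached to a short arm of f, and after the crossing to a short arm
    of i, f 3, f 2, f 1, f 4. At f 3 this fails, as f 3 is then on the long arm. So t is at f 4 and
    the diagram is E6~, whose marks are the weights used. *)
Theorem typeD5_no_diamond (phi : 'I_5 -> Pi) :
  (forall a b : 'I_5, G (phi a) (phi b) = d5_gram a b) -> no_diamond (R := R) s phi.
Proof.
move=> hphi k k1 k2 k3 k' i t y1 y2 y3 x ik gk it c1 n1 c2 n2 c3 n3 hx ni nt.
have hk (a b : 'I_5) : G (k a) (k b) = d5_gram a b by rewrite gk.
have hk1 (a b : 'I_5) : G (k1 a) (k1 b) = d5_gram a b by rewrite (crossing_gram hW _ _ c1).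
have [f [hf nf i3 ia [hf1 nf1]]] := d5_crossing hW hk c1 n1.
have [g [hg ng t3 ta _]] := d5_crossing hW hk c2 n2.
have [h [hh nh u3 ua _]] := d5_crossing hW hk1 c3 n3.
have [ki _ _ _] := c1; have [kt _ _ _] := c2.
have half0 : - (1 / 2) != 0 :> R by rewrite lt_eqF // mhalf_lt0.
have fk c : (c < 5)%N -> range k (f c) by move=> lc; rewrite -nf; exists c.
have one (p q : nat -> Pi) : (forall a, (a < 5)%N -> a != 3%N -> G t (p a) = 0) -> is_d5 q ->
    nodes 5 p = nodes 5 q -> forall a b, (a < 5)%N -> (b < 5)%N ->
    G t (q a) != 0 -> G t (q b) != 0 -> a = b.
  move=> hp hq e a b la lb ga gb; apply: (is_d5_inj hW hq) => //.
  have aux c : (c < 5)%N -> G t (q c) != 0 -> q c = p 3%N.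
    move=> lc gc; have : nodes 5 p (q c) by rewrite e; exists c.
    by case=> d ld ed; move: gc; rewrite -ed; case: (eqVneq d 3%N) => [->//|d3]; rewrite hp ?eqxx.
  by rewrite (aux a la ga) (aux b lb gb).
(* Two numberings of the same D5 differ at most by the swap of the short arms, so the node p 3 has
   position 3 or 4 in q. *)
have end_node (p q : nat -> Pi) : is_d5 p -> is_d5 q -> nodes 5 p = nodes 5 q ->
    forall a, (a < 5)%N -> q a = p 3%N -> (2 < a)%N.
  move=> hp hq e.
  have nb a b : (a < 5)%N -> (b < 5)%N -> q a = p 3%N -> d5_edge a b -> q b = p 2%N.
    move=> la lb qa eab; have : nodes 5 p (q b) by rewrite e; exists b.
    case=> d ld ed; have : d5_edge 3 d.
      by apply: (@d5_gram_edge R); rewrite -hp // -qa ed hq // d5_edge_gram.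
    by rewrite -ed /d5_edge !inE !xpair_eqE; case: d ld ed => [|[|[|[|]]]].
  move=> [|[|[|a]]] la qa //; exfalso.
  - have q1 := nb 0%N 1%N isT isT qa isT.
    have aux c : (c < 5)%N -> d5_edge 2 c -> c != 3%N -> p c = q 2%N.
      move=> lc ec cn3; have : nodes 5 q (p c) by rewrite -e; exists c.
      case=> d ld ed; have : d5_edge 1 d.
        by apply: (@d5_gram_edge R); rewrite -hq // q1 ed hp // d5_edge_gram.
      rewrite /d5_edge !inE !xpair_eqE; case: d ld ed => [|[|[|d]]] // _ ed _.
      by case/eqP: cn3; apply: (is_d5_inj hW hp) => //; rewrite -ed qa.
    have : 1%N = 4%N; last by [].
    by apply: (is_d5_inj hW hp) => //; rewrite (aux 1%N) // (aux 4%N).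
  - have : 0%N = 2%N; last by [].
    apply: (is_d5_inj hW hq) => //.
    by rewrite (nb 1%N 0%N isT isT qa isT) (nb 1%N 2%N isT isT qa isT).
  have : 1%N = 3%N; last by [].
  apply: (is_d5_inj hW hq) => //.
  by rewrite (nb 2%N 1%N isT isT qa isT) (nb 2%N 3%N isT isT qa isT).
have [b [lb gb eb]] : exists b, [/\ (b < 5)%N, f b = g 3%N & G t (f b) = - (1 / 2)].
  have : nodes 5 f (g 3%N) by rewrite nf -ng; exists 3%N.
  by case=> b lb e; exists b; rewrite e.
have [d [ld gd ed]] : exists d, [/\ (d < 5)%N, d5_next i f d = h 3%N &
    G t (d5_next i f d) = - (1 / 2)].
  have : nodes 5 (d5_next i f) (h 3%N) by rewrite nf1 -nh; exists 3%N.
  by case=> d l e; exists d; rewrite e.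
have ubn := one g f ta hf _ _ b; have udn := one h (d5_next i f) ua hf1 _ _ d.
have {}ubn c : (c < 5)%N -> G t (f c) != 0 -> c = b.
  by move=> lc gc; apply: ubn => //; [rewrite ng nf|rewrite eb].
have {}udn c : (c < 5)%N -> G t (d5_next i f c) != 0 -> c = d.
  by move=> lc gc; apply: udn => //; [rewrite nh nf1|rewrite ed].
have d2 := end_node _ _ hh hf1 (etrans nh (esym nf1)) d ld gd.
have b2 := end_node _ _ hg hf (etrans ng (esym nf)) b lb gb.
have b4 : b = 4%N.
  have [b3|//] : (b = 3 \/ b = 4)%N by lia.
  have : 1%N = d by apply: udn => //; rewrite /d5_next /= -b3 eb.
  by lia.
have hd : descends (R := R) s (range k) [set i; t] x.
  split; first by move=> _ [a _ <-]; exists (k' a).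
  by move=> _ [->|->].
pose N (r a : nat) := (a == r + 3)%N.
apply: (@d5_no_affine _ _ _ _ hW (range k) [set i; t] x f [:: i; t] N
  [:: 1; 2; 3; 2; 2; 1; 1]%N hd hf fk) => //.
- by move=> e; rewrite !inE => /orP[] /eqP->; split=> //; [left|right].
- by rewrite /= inE andbT; apply/eqP.
- move=> [|[|//]] a e _ la /eqP ->; first by rewrite /= i3.
  by rewrite /= -[(1 + 3)%N]b4 eb.
- by exists 0%N.
Qed.

End TypeD5Diamond.

(** * The Tits cone and C_max *)

Section DualTopology.
Context {R : realType} {Pi : choiceType}.
Notation D := (dualspace R Pi).

Lemma pairing_continuous (v : @rootspace R Pi) : continuous (fun f : D => pairing f v).
Proof.
move: v; apply: rootspace_ind => [|c i v IH].
  under eq_fun do rewrite pairing0; exact: cst_continuous.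
under eq_fun do rewrite pairingD pairingZ pairing_simple.
move=> f.
have hi : (fun g : D => g i) @ f --> f i by exact: (@proj_continuous Pi (fun=> R) i f).
have h1 : (fun g : D => c * g i) @ f --> c * f i by exact: (cvgM (cvg_cst c) hi).
exact: (cvgD h1 (IH f)).
Qed.

Lemma dual_segment_continuous (f g : D) :
  continuous (fun x : R => (fun i => (1 - x) * f i + x * g i) : D).
Proof.
move=> x; apply/cvg_sup => i.
apply: continuous_comp_initial => {}x /=.
have h1 : (fun y : R => (1 - y) * f i) @ x --> (1 - x) * f i.
  exact: (cvgM (cvgB (cvg_cst (1 : R)) cvg_id) (cvg_cst (f i))).
have h2 : (fun y : R => y * g i) @ x --> x * g i.
  exact: (cvgM cvg_id (cvg_cst (g i))).
exact: (cvgD h1 h2).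
Qed.

Lemma pairing_combination (f g : D) (c d : R) v :
  pairing ((fun i => c * f i + d * g i) : D) v = c * pairing f v + d * pairing g v.
Proof.
rewrite /pairing !mulr_sumr -big_split /=; apply: eq_bigr => i _; ring.
Qed.

(** The intermediate value theorem fixes the sign on C, and a closed half-space contains the
    closure. *)
Lemma connected_pairing_gt0 (C : set D) v f : connected C -> C f -> 0 < pairing f v ->
  (forall g, C g -> pairing g v <> 0) -> closure C `<=` [set g | 0 <= pairing g v].
Proof.
move=> cC Cf fv nz.
have /connected_intervalP itv : connected ((fun g => pairing g v) @` C).
  apply: connected_continuous_connected => //; apply: continuous_subspaceT.
  exact: pairing_continuous.
have sub : C `<=` [set g | 0 <= pairing g v].
  move=> g Cg /=; rewrite leNgt; apply/negP => gv.
  have [h Ch h0] : ((fun g => pairing g v) @` C) 0.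
    apply: (itv (pairing g v) (pairing f v)); [by exists g|by exists f|].
    by rewrite (ltW gv) (ltW fv).
  exact: nz h0.
have cl : closed [set g : D | 0 <= pairing g v].
  apply: (@closed_comp _ _ (fun g : D => pairing g v) [set x : R | 0 <= x]).
    by move=> g _; exact: pairing_continuous.
  exact: closed_ge.
by rewrite [X in _ `<=` X](closure_id _).1 //; exact: closureS.
Qed.

End DualTopology.

(** * The dual action and the reflections of J^perp *)

Section Dual.
Context {R : realType} {Pi : choiceType} {W : groupType} (s : Pi -> W).
Hypothesis hW : is_coxeter_system s.
Notation V := (@rootspace R Pi).
Notation D := (dualspace R Pi).
Notation "''a_' i" := (simple_root R i) (at level 8, i at level 2, format "''a_' i").
Notation act := (act s).
Notation dact := (@dual_act R Pi W s).
Context (m : nat) (phi : 'I_m -> Pi).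
Hypothesis phi_inj : injective phi.
Let J := range phi.
Notation crossing := (@crossing R Pi W s m).
Notation tile := (@tile R Pi W s m phi).
Notation mirror_root := (@mirror_root R Pi W s m phi).
Implicit Types (u v : V) (w x y z : W) (i j t : Pi) (c : R) (k : 'I_m -> Pi) (f g h : D).

Lemma pairing_dual_act w f v : pairing (dact w f) v = pairing f (act w^-1%g v).
Proof.
rewrite {2}(rootspaceE v) (act_sum hW) pairing_sum /pairing; apply: eq_bigr => i _.
by rewrite (actZ hW) -/(pairing f _) pairingZ.
Qed.

Lemma dual_eqP f g : (forall v, pairing f v = pairing g v) -> f = g.
Proof. by move=> h; apply/funext => i; have := h 'a_i; rewrite !pairing_simple. Qed.

Lemma dual_actM w x f : dact (w * x)%g f = dact w (dact x f).
Proof. by apply: dual_eqP => v; rewrite !pairing_dual_act invgM (actM hW). Qed.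

Lemma dual_act1 f : dact 1%g f = f.
Proof. by apply: dual_eqP => v; rewrite pairing_dual_act invg1 (act1 hW). Qed.

Lemma dual_actK w f : dact w^-1%g (dact w f) = f.
Proof. by rewrite -dual_actM mulVg dual_act1. Qed.

Lemma Jperp_zero f a : Jperp s J f -> f (phi a) = 0.
Proof.
case=> _ /(_ (phi a)) /= []; first by exists a.
move=> _ /(congr1 (fun g : D => g (phi a))); rewrite /dual_reflection reflE srefl_self // pairingN.
by rewrite pairing_simple => e; lra.
Qed.

Lemma JperpI f : tits_cone s f -> (forall a, f (phi a) = 0) -> Jperp s J f.
Proof.
move=> tf z; split=> // _ [a _ <-]; split=> //; apply: dual_eqP => v.
rewrite {2}(rootspaceE v) pairing_sum /pairing; apply: eq_bigr => i _.
rewrite /dual_reflection reflE /simple_reflection -/(pairing f _) pairingB !pairingZ !pairing_simple z.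
by rewrite mulr0 subr0.
Qed.

Lemma Jannihilator_zero f : Jannihilator J f <-> forall a, f (phi a) = 0.
Proof.
split=> [h a|h _ [a _ <-]]; last by rewrite pairing_simple.
by have := h (phi a); rewrite pairing_simple; apply; exists a.
Qed.

Lemma preserves_JP w : preserves_J R s J w ->
  exists p : 'I_m -> 'I_m, forall a, act w 'a_(phi a) = 'a_(phi (p a)).
Proof.
move=> e; suff h a : exists b : 'I_m, act w 'a_(phi a) = 'a_(phi b).
  by have [p hp] := choice h; exists p.
have : ((simple_root R) @` J) (act w 'a_(phi a)).
  by rewrite -e; exists 'a_(phi a) => //; exists (phi a) => //; exists a.
by case=> _ [b _ <-] <-; exists b.
Qed.

Lemma chamber_ge0 (c : D) v : (forall i, 0 <= c i) -> nonneg v -> 0 <= pairing c v.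
Proof. by move=> hc hv; apply: sumr_ge0 => i _; rewrite mulr_ge0 //; exact: hv. Qed.

Section MirrorRoot.
Context (w y : W) (k k' : 'I_m -> Pi) (t : Pi).
Hypotheses (hk : tile w k) (cr : crossing k t y k') (ekk' : range k' = range k).

Let r := (w * y * w^-1)%g.
Let b := act w 'a_t.
Let yy : (y * y = 1)%g.
Proof. exact: (crossing_involution hW (tile_inj phi_inj hk) cr ekk'). Qed.
Let yV : (y^-1 = y)%g. Proof. exact: mulg1_eq. Qed.

Lemma mirror_reflection_inv : (r^-1 = r)%g.
Proof. by rewrite /r !invgM invgK yV mulgA. Qed.

Lemma mirror_reflection_involution : (r * r = 1)%g.
Proof. by rewrite -{1}mirror_reflection_inv mulVg. Qed.

Lemma mirror_reflection_preserves : preserves_J R s J r.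
Proof.
have sub v : ((simple_root R) @` J) v -> ((simple_root R) @` J) (act r v).
  case=> _ [a _ <-] <-; have [a' _ ea] : range k' (k a) by rewrite ekk'; exists a.
  exists (phi a'); first by exists a'.
  by rewrite /r !(actM hW) (tileV hW a hk) -ea; case: cr => _ _ _ ->; rewrite hk.
apply/seteqP; split=> [_ [v hv <-]|v hv]; first exact: sub.
exists (act r v); first exact: sub.
by rewrite -(actM hW) mirror_reflection_involution (act1 hW).
Qed.

(** y moves vectors only within the span of L = K + t, and w sends K to J, where f vanishes; only
    the multiple of a_t survives. *)
Lemma mirror_reflection_act f v : Jannihilator J f ->
  exists c, pairing f (act r v) = pairing f v + c * pairing f b.
Proof.
move=> /Jannihilator_zero f0; pose v' := act w^-1%g v; pose u := act y v' - v'.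
have su : supported (with_node k t) u.
  move=> i Li; rewrite /u vcoefB (parabolic_vcoef hW _ _ Li) ?subrr //.
  by case: cr.
have -> : act r v = v + act w u.
  by rewrite /u (actD hW) (actN hW) /r !(actM hW) -/v' (actKV hW) addrC subrK.
rewrite pairingD.
suff [c ->] : exists c, pairing f (act w u) = c * pairing f b by exists c.
rewrite (rootspaceE u) (act_sum hW) pairing_sum.
suff h i : exists c, pairing f (act w (vcoef i u *: 'a_i)) = c * pairing f b.
  have [c hc] := choice h; exists (\sum_(i <- msupp u) c i).
  by rewrite mulr_suml; apply: eq_bigr => i _; rewrite hc.
rewrite (actZ hW) pairingZ; case: (eqVneq (vcoef i u) 0) => [->|iu].
  by exists 0; rewrite !mul0r.
case: (supportedP su iu) => [[a _ <-]|->]; last by exists (vcoef t u).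
by exists 0; rewrite hk pairing_simple f0 mulr0 mul0r.
Qed.

Lemma mirror_reflection_fix f : Jannihilator J f -> pairing f b = 0 -> dact r f = f.
Proof.
move=> hf fb; apply: dual_eqP => v; rewrite pairing_dual_act mirror_reflection_inv.
by have [c ->] := mirror_reflection_act v hf; rewrite fb mulr0 addr0.
Qed.

Lemma mirror_reflectionP : acts_by_reflection R s J r.
Proof.
(* The coordinate functional at t. Its translate by w vanishes on J and is 1 on b, so it spans a
   complement of the fixed space. *)
pose g : D := fun i => (i == t)%:R.
have gv v : pairing g v = vcoef t v.
  rewrite {1 2}(rootspaceE v) pairing_sum vcoef_sum; apply: eq_bigr => i _.
  by rewrite pairingZ pairing_simple vcoefZ vcoef_simple eq_sym.
have f0b : pairing (dact w g) b = 1.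
  by rewrite pairing_dual_act (actK hW) pairing_simple /g eqxx.
have f0J : Jannihilator J (dact w g).
  apply/Jannihilator_zero => a; rewrite -(pairing_simple (dact w g)).
  rewrite pairing_dual_act (tileV hW a hk).
  rewrite pairing_simple /g; case: eqP => // e; case: cr => + _ _ _; case; by exists a.
split; first exact: mirror_reflection_preserves.
  by move=> f _; rewrite -dual_actM mirror_reflection_involution dual_act1.
exists (dact w g); split=> //.
  move=> /(congr1 (fun f => pairing f b)); rewrite f0b !pairing_dual_act mirror_reflection_inv.
  have -> : act w^-1%g (act r b) = act y 'a_t by rewrite /r /b !(actM hW) !(actK hW).
  rewrite gv => e.
  case: cr => _ _ + _ => /(_ t); rewrite yV e; lra.
move=> f hf; exists (pairing f b) => /=.
have eg : (fun i => f i - pairing f b * dact w g i) =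
    (fun i => 1 * f i + - pairing f b * dact w g i) :> D.
  by apply/funext => i; rewrite mul1r mulNr.
rewrite eg; apply: mirror_reflection_fix.
  apply/Jannihilator_zero => a; move/Jannihilator_zero: hf => ->.
  by move/Jannihilator_zero: f0J => ->; rewrite !mulr0 addr0.
by rewrite pairing_combination f0b; ring.
Qed.

End MirrorRoot.

Lemma mirror_root_mirror b : mirror_root b -> exists r,
  acts_by_reflection R s J r /\ forall f, Jperp s J f -> pairing f b = 0 -> mirror s J r f.
Proof.
case=> w [k [t [y [k' [hk cr e ->]]]]]; exists (w * y * w^-1)%g; split.
  exact: mirror_reflectionP hk cr e.
move=> f hf fb; split=> //; apply: (mirror_reflection_fix hk cr e) fb.
by apply/Jannihilator_zero => a; exact: Jperp_zero.
Qed.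

End Dual.

(** * The base chamber and its position in C_max *)

Section BaseChamber.
Context {R : realType} {Pi : choiceType} {W : groupType} (s : Pi -> W).
Hypothesis hW : is_coxeter_system s.
Notation V := (@rootspace R Pi).
Notation D := (dualspace R Pi).
Notation "''a_' i" := (simple_root R i) (at level 8, i at level 2, format "''a_' i").
Notation act := (act s).
Notation dact := (@dual_act R Pi W s).
Context (m : nat) (phi : 'I_m -> Pi).
Hypothesis phi_inj : injective phi.
Let J := range phi.
Notation tile := (@tile R Pi W s m phi).
Notation mirror_root := (@mirror_root R Pi W s m phi).
Notation same_side := (@same_side R Pi W s m phi).
Implicit Types (u v : V) (w z : W) (i j t : Pi) (k : 'I_m -> Pi) (f g h c : D).

Lemma chamberE c : chamber s c <-> (forall i, 0 <= c i) /\ spherical s [set i | c i = 0].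
Proof.
rewrite /chamber /=; have -> : [set i | pairing c 'a_i = 0] = [set i | c i = 0].
  by apply/seteqP; split=> i /=; rewrite pairing_simple.
by split=> -[h1 h2]; split=> // i; have := h1 i; rewrite pairing_simple.
Qed.

Lemma dual_act_s_fix c i : c i = 0 -> dact (s i) c = c.
Proof.
move=> ci; apply: dual_eqP => v; rewrite (pairing_dual_act hW) (gen_inv hW) (act_s hW) /simple_reflection.
by rewrite pairingB pairingZ pairing_simple ci mulr0 subr0.
Qed.

Lemma pairing_eq0_supported c v : (forall i, 0 <= c i) -> nonneg v -> pairing c v = 0 ->
  supported [set i | c i = 0] v.
Proof.
move=> hc hv /eqP; rewrite /pairing psumr_eq0 => [/allP h i ci|i _]; last first.
  by rewrite mulr_ge0 //; exact: hv.
apply/eqP; apply: contrapT => /negP vi; apply: ci.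
have iv : i \in msupp v by rewrite -mcoeff_neq0.
by have := h i iv; rewrite /= mulf_eq0 (negbTE vi) => /eqP.
Qed.

(* Among the w with f = w c the shortest one maps the simple roots vanishing at c to positive roots,
which puts J into standard position. *)
Lemma Jperp_tile f : Jperp s J f ->
  exists w k c, [/\ tile w k, chamber s c, f = dact w c & forall a, c (k a) = 0].
Proof.
move=> hf; have [[w1 [c hc e1]] _] := hf.
pose P n := `[< exists2 w, f = dact w c & len s w = n >].
have exP : exists n, P n by exists (len s w1); apply/asboolP; exists w1.
case: (ex_minnP exP) => n /asboolP[w ew lw] nmin.
have [c0 _] := (chamberE c).1 hc.
have pos (z : Pi) : c z = 0 -> nonneg (act w 'a_z).
  move=> cz; apply: (len_nonneg hW).
  have : (n <= len s (w * s z)%g)%N.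
    by apply: nmin; apply/asboolP; exists (w * s z)%g => //; rewrite (dual_actM hW) dual_act_s_fix.
  by have := len_mulg_s hW w z; rewrite lw; lia.
have hk a : exists i, act w 'a_i = 'a_(phi a) /\ c i = 0.
  set b := act w^-1%g 'a_(phi a).
  have wb : act w b = 'a_(phi a) by rewrite /b (actKV hW).
  have rb : coxroot s b by apply: (root_act hW); exact: root_simple.
  have cb : pairing c b = 0.
    by rewrite /b -(pairing_dual_act hW) -ew pairing_simple (Jperp_zero hW _ hf).
  case: (root_sign hW rb) => [pb|/nonnegN nb].
    have sb := pairing_eq0_supported c0 pb cb.
    have [|l bl el] := simple_preimage hW wb rb pb.
      by move=> l /(supportedP sb); exact: pos.
    by exists l; rewrite -el; split=> //; exact: supportedP sb bl.
  have cb' : pairing c (- b) = 0 by rewrite pairingN cb oppr0.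
  have sb := pairing_eq0_supported c0 nb cb'.
  have : nonneg (act w (- b)).
    by apply: (act_nonneg hW) => // l /(supportedP sb); exact: pos.
  by rewrite (actN hW) wb nonnegN => /(simple_not_nonpos hW).
have [k hk'] := choice hk; exists w, k, c; split=> // a; first by have [] := hk' a.
by have [] := hk' a.
Qed.

Section Base.
Context (w0 : W) (k : 'I_m -> Pi) (c0 : D).
Hypotheses (hk : tile w0 k) (ch0 : chamber s c0) (c0k : forall a, c0 (k a) = 0).

(** A point where exactly the simple roots of K vanish; its image under w0 serves as the centre of
    the base chamber. *)
Definition indicator_off : D := fun i => if `[< range k i >] then 0 else 1.
Notation c1 := indicator_off.

Lemma indicator_off_ge0 i : 0 <= c1 i.
Proof. by rewrite /c1; case: asboolP. Qed.

Lemma indicator_off_node a : c1 (k a) = 0.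
Proof. by rewrite /c1; case: asboolP => // -[]; exists a. Qed.

(** The segment to the centre from the given point, which may lie on further walls; beyond its start
    the segment avoids them. *)
Definition blend (x : R) : D := fun i => (1 - x) * c0 i + x * c1 i.

Lemma blend_zero x i : 0 < x <= 1 -> blend x i = 0 -> range k i.
Proof.
move=> /andP[x0 x1]; have [h0 _] := (chamberE c0).1 ch0.
rewrite /blend /c1; case: asboolP => // _; have := h0 i => h e.
have : 0 <= (1 - x) * c0 i by rewrite mulr_ge0 // subr_ge0.
by move: e; rewrite mulr1 => e; lra.
Qed.

Lemma blend0 : blend 0 = c0.
Proof. by apply/funext => i; rewrite /blend subr0 mul1r mul0r addr0. Qed.

Lemma blend1 : blend 1 = c1.
Proof. by apply/funext => i; rewrite /blend subrr mul0r add0r mul1r. Qed.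

Lemma blend_ge0 x i : 0 <= x <= 1 -> 0 <= blend x i.
Proof.
move=> /andP[x0 x1]; have [h0 _] := (chamberE c0).1 ch0.
by rewrite addr_ge0 // mulr_ge0 ?subr_ge0 //; exact: indicator_off_ge0.
Qed.

Lemma blend_chamber x : 0 <= x <= 1 -> chamber s (blend x).
Proof.
move=> hx; apply/chamberE; split=> [i|]; first exact: blend_ge0.
have [_ sph] := (chamberE c0).1 ch0.
have [->|xn0] := eqVneq x 0; first by rewrite blend0.
apply: sub_finite_set sph; apply: parabolic_sub => i /= /blend_zero h.
have : range k i by apply: h; case/andP: hx => x0 ->; rewrite andbT lt_neqAle eq_sym xn0.
by case=> a _ <-.
Qed.

Lemma blend_node x a : blend x (k a) = 0.
Proof. by rewrite /blend c0k indicator_off_node !mulr0 addr0. Qed.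

Lemma blend_Jperp x : 0 <= x <= 1 -> Jperp s J (dact w0 (blend x)).
Proof.
move=> hx; apply: JperpI.
  by exists w0, (blend x) => //; exact: blend_chamber.
move=> a; rewrite -[LHS](pairing_simple (dact w0 (blend x))) (pairing_dual_act hW).
by rewrite (tileV hW a hk) pairing_simple blend_node.
Qed.

(* The stabilizer of c is the parabolic subgroup of range k, and no nontrivial element of it permutes
range k. *)
Lemma stabilizer_trivial (c : D) (x : W) :
  (forall i, 0 <= c i) -> (forall i, c i = 0 -> range k i) ->
  dact x c = c -> (forall a, exists a', act x 'a_(k a) = 'a_(k a')) -> x = 1%g.
Proof.
move=> c_ge0 cz fx hx; apply: contrapT => /(len_descent hW) [i].
move=> /(len_nonpos (R := R) hW) ni.
have ki : ~ range k i.
  by case=> a _ e; have [a' ea] := hx a; move: ni; rewrite -e ea => /(simple_not_nonpos hW).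
have ci : 0 < c i.
  by rewrite lt_neqAle c_ge0 andbT eq_sym; apply/eqP => /cz.
have e : pairing c (act x 'a_i) = c i.
  by rewrite -{1}fx (pairing_dual_act hW) (actK hW) pairing_simple.
have : 0 <= pairing c (- act x 'a_i) by apply: chamber_ge0 => //; rewrite nonnegN.
by rewrite pairingN e; lra.
Qed.

(** If r fixed a point past the start, w0^-1 r w0 would fix a functional vanishing only on K and
    would permute K. By [stabilizer_trivial] r would be 1, but a reflection moves some [f0]. *)
Lemma blend_complement x : 0 <= x <= 1 -> mirror_complement s J (dact w0 c0) ->
  mirror_complement s J (dact w0 (blend x)).
Proof.
move=> hx hc; have [->|xn0] := eqVneq x 0; first by rewrite blend0.
have hx' : 0 < x <= 1 by case/andP: hx => x0 ->; rewrite andbT lt_neqAle eq_sym xn0.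
split; first exact: blend_Jperp.
case=> r [_ [pr _ [f0 [_ nf0 _]]]] [_ fr]; apply: nf0.
suff -> : r = 1%g by rewrite (dual_act1 hW).
suff e : (w0^-1 * r * w0 = 1)%g.
  by apply: (mulgI w0^-1%g); rewrite mulg1 -{2}[w0^-1%g]mul1g -e mulgK.
apply: (@stabilizer_trivial (blend x)).
- by move=> i; exact: blend_ge0.
- by move=> i; exact: blend_zero.
- by rewrite !(dual_actM hW) fr (dual_actK hW).
have [p hp] := preserves_JP pr.
move=> a; exists (p a).
by rewrite !(actM hW) hk hp (tileV hW _ hk).
Qed.

Lemma indicator_off_pos v : coxroot s v -> ~ supported (range k) v -> nonneg v -> 0 < pairing c1 v.
Proof.
move=> rv sv pv; rewrite lt_neqAle (chamber_ge0 indicator_off_ge0 pv) andbT eq_sym.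
apply/eqP => /(pairing_eq0_supported indicator_off_ge0 pv) h; apply: sv => i ki.
by apply: h => /=; rewrite /c1; case: asboolP => // _ /eqP; rewrite oner_eq0.
Qed.

(** A mirror root is not in the span of J: in the chamber that defines it, it is a_t with t outside
    the type. Hence it does not vanish at the centre of any chamber. *)
Lemma mirror_root_not_supported w k' b : tile w k' -> mirror_root b ->
  ~ supported (range k') (act w^-1%g b).
Proof.
move=> hk' [w1 [k1 [t [y [k2 [hk1 [kt _ _ _] _ ->]]]]]] sv.
suff sx v : supported (range k') (act w^-1%g v) -> supported (range k1) (act w1^-1%g v).
  by have := sx _ sv t kt; rewrite (actK hW) vcoef_simple eqxx => /eqP; rewrite oner_eq0.
move=> {}sv i ki; rewrite -(actKV hW w v) -(actM hW) act_expand // big_seq big1 // => j.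
rewrite -mcoeff_neq0 => /(supportedP sv) [a _ <-].
rewrite (actM hW) hk' (tileV hW a hk1) vcoef_simple; case: eqP => [e|_]; rewrite ?mulr0 //.
by case: ki; rewrite e; exists a.
Qed.

Context (C0 : set D).
Hypothesis hC0 : C0 = connected_component (mirror_complement s J) (dact w0 c0).
Hypothesis hf0 : mirror_complement s J (dact w0 c0).

Lemma component_center : C0 (dact w0 c1).
Proof.
rewrite hC0 -blend1; set F := fun x : R => dact w0 (blend x).
have cF : continuous F.
  have -> : F = (fun x => (fun i => (1 - x) * dact w0 c0 i + x * dact w0 c1 i) : D).
    apply/funext => x; apply: dual_eqP => v.
    by rewrite pairing_combination !(pairing_dual_act hW) pairing_combination.
  exact: dual_segment_continuous.
have := @connected_component_max _ (mirror_complement s J) (F @` `[0, 1]%classic) (dact w0 c0).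
apply.
- by exists 0; [rewrite /= in_itv /= lexx ler01|rewrite /F blend0].
- move=> _ [x /= + <-]; rewrite in_itv /= => hx; exact: blend_complement.
- apply: connected_continuous_connected; first exact: segment_connected.
  exact: continuous_subspaceT.
- by exists 1 => //; rewrite /= in_itv /= lexx ler01.
Qed.

Lemma component_side v : (exists r, acts_by_reflection R s J r /\
    forall f, Jperp s J f -> pairing f v = 0 -> mirror s J r f) ->
  0 < pairing (dact w0 c0) v -> closure C0 `<=` [set g | 0 <= pairing g v].
Proof.
move=> [r [hr hm]] pv.
have f0C : C0 (dact w0 c0) by rewrite hC0; exact: connected_component_refl.
apply: connected_pairing_gt0 f0C pv _; first by rewrite hC0; exact: component_connected.
move=> g; rewrite {1}hC0 => /connected_component_sub [gJ gm] gv; apply: gm.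
exists r; last exact: hm.
by split=> // B [_]; apply.
Qed.

(** g sends the centre of the base chamber into the closure of C0, on which a mirror root keeps a
    weak sign; at the image of the centre the value is nonzero, so the sign is strict. Applying this
    to b and to - b gives both directions. *)
Lemma Gamma_vee_same_side (g : W) : Gamma_max_vee s J C0 g -> same_side w0 (g * w0)%g.
Proof.
case=> [[_ eC] gJ] b mb.
have hgk : tile (g * w0)%g k.
  by apply: (tile_fix hW) => // a; apply: gJ; exists a.
have [r [hr hm]] := mirror_root_mirror hW phi_inj mb.
have f0b : pairing (dact w0 c0) b <> 0.
  move=> e; have [fJ fm] := hf0; apply: fm; exists r; last exact: hm.
  by split=> // B [_]; apply.
have rb := mirror_root_coxroot hW mb.
have c0_ge0 : forall i, 0 <= c0 i by have [] := (chamberE c0).1 ch0.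
have clo : closure C0 (dact (g * w0)%g c1).
  have pC : C_max s J C0 (dact w0 c1).
    split; first by apply: subset_closure; exact: component_center.
    by rewrite -blend1; apply: blend_Jperp; rewrite ler01 lexx.
  have : (dact g @` C_max s J C0) (dact g (dact w0 c1)) by exists (dact w0 c1).
  by rewrite eC (dual_actM hW) => -[].
have key v : (exists r, acts_by_reflection R s J r /\
      forall f, Jperp s J f -> pairing f v = 0 -> mirror s J r f) ->
    pairing (dact w0 c0) v <> 0 -> nonneg (act w0^-1%g v) ->
    0 <= pairing c1 (act (g * w0)^-1%g v).
  move=> hv nv pv; rewrite -(pairing_dual_act hW); apply: (component_side hv) clo.
  rewrite lt_neqAle (pairing_dual_act hW) chamber_ge0 // andbT eq_sym; apply/eqP.
  by rewrite -(pairing_dual_act hW).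
have r0 := root_act hW w0^-1%g rb; have r1 := root_act hW (g * w0)^-1%g rb.
have ns := mirror_root_not_supported hgk mb.
split=> p.
  case: (root_sign hW r1) => // /nonnegN n.
  have : 0 < pairing c1 (- act (g * w0)^-1%g b).
    apply: indicator_off_pos => //.
      by rewrite -(actN hW); apply: (root_act hW); case: rb => x [i ->];
        exists (x * s i)%g, i; rewrite (actM hW) (act_s hW) (srefl_self hW) (actN hW).
    by move=> h; apply: ns; rewrite -[act _ b]opprK; exact: supportedN.
  have := key b (ex_intro _ r (conj hr hm)) f0b p; rewrite pairingN; lra.
case: (root_sign hW r0) => // /nonnegN n.
have : 0 < pairing c1 (act (g * w0)^-1%g b) by exact: indicator_off_pos.
have := key (- b); rewrite !(actN hW) !pairingN => h q.
have : 0 <= - pairing c1 (act (g * w0)^-1%g b).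
  apply: h => //; last by move/eqP; rewrite oppr_eq0 => /eqP.
  by exists r; split=> // f fJ /eqP; rewrite pairingN oppr_eq0 => /eqP; exact: hm.
by lra.
Qed.

End Base.

End BaseChamber.

(** * The index of Gamma_max^vee *)

Section Index.
Context {G : groupType}.
Implicit Types (H K : set G).

Lemma coset_subgroup H (g : G) : is_subgroup H -> H g -> [set (g * h)%g | h in H] = H.
Proof.
move=> [H1 HM HV] Hg; apply/seteqP; split=> [_ [h Hh <-]|h Hh]; first exact: HM.
by exists (g^-1 * h)%g; [apply: HM => //; exact: HV|rewrite mulVKg].
Qed.

Lemma has_index_le2 H K : is_subgroup H -> is_subgroup K -> H `<=` K ->
  (forall x y, K x -> K y -> ~ H x -> ~ H y -> H (x^-1 * y)%g) ->
  has_index H K 1 \/ has_index H K 2.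
Proof.
move=> sH [K1 KM KV] HK h; have [H1 HM HV] := sH.
have [KH|/existsNP [g /not_implyP [Kg Hg]]] := pselect (K `<=` H); [left|right].
  apply/eq_cardSP; exists H.
    by exists 1%g => //; exact: coset_subgroup.
  rewrite II0 card_eq0; apply/eqP; apply/seteqP; split=> // X [[g Kg <-]].
  by case; exact/coset_subgroup/KH.
have gH : [set (g * h)%g | h in H] <> H.
  by move=> e; apply: Hg; rewrite -e; exists 1%g; rewrite ?mulg1.
apply/eq_cardSP; exists H.
  by exists 1%g => //; exact: coset_subgroup.
apply/eq_cardSP; exists [set (g * h)%g | h in H]; first by split=> //; exists g.
rewrite II0 card_eq0; apply/eqP; apply/seteqP; split=> // X [[[x Kx <-]]].
move=> xH; case; have Hx : ~ H x by move=> Hx; apply: xH; exact: coset_subgroup.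
have Hgx := h g x Kg Kx Hg Hx.
apply/seteqP; split=> _ [y Hy <-].
  by exists ((g^-1 * x) * y)%g; [exact: HM|rewrite !mulgA mulgV mul1g].
exists ((g^-1 * x)^-1 * y)%g; first by apply: HM => //; exact: HV.
by rewrite invgM invgK !mulgA mulgV mul1g.
Qed.

End Index.

(** * Automorphisms of the diagrams A_m and D5 *)

Section Automorphisms.
Context {R : realType}.

(** An image of the end 0 strictly inside the path would have two neighbours, both coming from node
    1. If 0 is fixed, the nodes follow one by one. *)
Lemma path_automorphism m (p : 'I_m.+1 -> 'I_m.+1) : injective p ->
  (forall a b, path_gram (p a) (p b) = path_gram a b :> R) ->
  (p ord0 = ord0 \/ p ord0 = ord_max) /\ (p ord0 = ord0 -> p =1 id).
Proof.
move=> ip hp.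
have adj a b : (path_gram (p a) (p b) = - (1 / 2) :> R) <-> (path_gram a b = - (1 / 2) :> R).
  by rewrite hp.
split.
  have [b0|[bm|bi]] : (p ord0 = 0 :> nat \/ p ord0 = m :> nat \/ 0 < p ord0 < m)%N.
    by have := ltn_ord (p ord0); lia.
  - by left; exact: val_inj.
  - by right; exact: val_inj.
  have l1 : ((p ord0).-1 < m.+1)%N by lia.
  have l2 : ((p ord0).+1 < m.+1)%N by lia.
  have nb d : path_gram (p ord0) (p d) = - (1 / 2) :> R -> (d : nat) = 1%N.
    by rewrite hp => /path_gram_adj [<-|].
  have [q pq qp] := injF_bij ip.
  exfalso; have : (p ord0).-1 = (p ord0).+1; last by lia.
  have e1 : Ordinal l1 = p (q (Ordinal l1)) by rewrite qp.
  have e2 : Ordinal l2 = p (q (Ordinal l2)) by rewrite qp.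
  have q1 : (q (Ordinal l1) : nat) = 1%N.
    apply: nb; rewrite qp /= path_gramC; have e : nat_of_ord (p ord0) = (p ord0).-1.+1 by lia.
    by rewrite [X in path_gram _ X]e path_gramS.
  have q2 : (q (Ordinal l2) : nat) = 1%N by apply: nb; rewrite qp /= path_gramS.
  have e : q (Ordinal l1) = q (Ordinal l2) by apply: val_inj; rewrite /= q1 q2.
  by have := congr1 (fun a => nat_of_ord (p a)) e; rewrite !qp.
move=> p0 a; apply: val_inj; case: a => a la /=.
have [n] := ubnP a; elim: n a la => // n IH [|a] la lt.
  by rewrite (_ : Ordinal la = ord0) ?p0 //; exact: val_inj.
have la' : (a < m.+1)%N by exact: ltnW.
have ea := IH a la' ltac:(lia).
have := hp (Ordinal la') (Ordinal la); rewrite ea /= path_gramS.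
move=> /path_gram_adj [e|e]; first by rewrite -e.
case: a la lt la' ea e => [//|a] la lt la' ea [e].
have la'' : (a < m.+1)%N by lia.
have ea'' := IH a la'' ltac:(lia).
have : Ordinal la = Ordinal la'' by apply: ip; apply: val_inj; rewrite /= ea''.
by move/(congr1 val) => /=; lia.
Qed.

(** All 5^5 maps are tested. Node 3 is the probe because its image, 3 or 4, tells the identity from
    the swap of the short arms. *)
Definition d5_automorphism_check : bool :=
  let r := iota 0 5 in
  all (fun p0 => all (fun p1 => all (fun p2 => all (fun p3 => all (fun p4 =>
    let p := nth 0%N [:: p0; p1; p2; p3; p4] in
    (uniq [:: p0; p1; p2; p3; p4] &&
     all (fun a => all (fun b => d5_edge (p a) (p b) == d5_edge a b) r) r) ==>
    (((p 3 == 3) || (p 3 == 4)) && ((p 3 == 3) ==> all (fun a => p a == a) r))%N) r) r) r) r) r.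

Lemma d5_automorphism_checkP : d5_automorphism_check.
Proof. by vm_compute. Qed.

Lemma d5_automorphism (p : 'I_5 -> 'I_5) : injective p ->
  (forall a b, d5_gram (p a) (p b) = d5_gram a b :> R) ->
  (p (inord 3) = inord 3 \/ p (inord 3) = inord 4) /\ (p (inord 3) = inord 3 -> p =1 id).
Proof.
move=> ip hp; pose f n : nat := p (inord n).
have lf n : f n \in iota 0 5 by rewrite mem_iota /= ltn_ord.
have edge a b : d5_edge (p a) (p b) = d5_edge a b.
  apply/idP/idP => e; apply: (@d5_gram_edge R).
    by rewrite -hp d5_edge_gram.
  by rewrite hp d5_edge_gram.
have chk := d5_automorphism_checkP.
move/allP: chk => /(_ _ (lf 0%N)) /allP /(_ _ (lf 1%N)) /allP /(_ _ (lf 2%N)).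
move=> /allP /(_ _ (lf 3%N)) /allP /(_ _ (lf 4%N)) /implyP chk.
have nthE n : (n < 5)%N -> nth 0%N [:: f 0; f 1; f 2; f 3; f 4]%N n = f n.
  by case: n => [|[|[|[|[|]]]]].
have hu : uniq [:: f 0; f 1; f 2; f 3; f 4]%N.
  rewrite -[[:: _; _; _; _; _]]/(map f (iota 0 5)) map_inj_in_uniq ?iota_uniq //.
  move=> a b; rewrite !mem_iota /= => la lb /val_inj /ip /(congr1 val) /=.
  by rewrite !inordK.
have he : all (fun a => all (fun b => d5_edge (nth 0%N [:: f 0; f 1; f 2; f 3; f 4]%N a)
    (nth 0%N [:: f 0; f 1; f 2; f 3; f 4]%N b) == d5_edge a b) (iota 0 5)) (iota 0 5).
  apply/allP => a; rewrite mem_iota => /andP[_ la].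
  apply/allP => b; rewrite mem_iota => /andP[_ lb].
  by rewrite !nthE // /f edge !inordK.
have {chk} /andP[h1 h2] := chk (introT andP (conj hu he)).
have f3 : f 3%N = p (inord 3) by [].
split.
  case/orP: h1 => /eqP /= e; [left|right]; apply: val_inj; rewrite /= inordK //.
move=> e a; apply: val_inj.
have /(implyP h2)/allP/(_ (a : nat)) : (nth 0%N [:: f 0; f 1; f 2; f 3; f 4]%N 3 == 3)%N.
  by rewrite /= f3 e inordK.
by rewrite mem_iota /= ltn_ord nthE // /f inord_val => /(_ isT) /eqP.
Qed.

End Automorphisms.

(** * Freeness and index for both types *)

Section Structure.
Context {R : realType} {Pi : choiceType} {W : groupType} (s : Pi -> W).
Hypothesis hW : is_coxeter_system s.
Notation "''a_' i" := (simple_root R i) (at level 8, i at level 2, format "''a_' i").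
Notation act := (act s).
Notation D := (dualspace R Pi).
Notation G := (gram R s).

Lemma setwise_stabilizer_subgroup (T : Type) (F : W -> T -> T) (S : set T) :
  (forall u, F 1%g u = u) -> (forall x y u, F (x * y)%g u = F x (F y u)) ->
  is_subgroup [set w | F w @` S = S].
Proof.
move=> F1 FM; split=> [|x y /= ex ey|x /= ex].
- by apply/seteqP; split=> [_ [u Su <-]|u Su]; rewrite ?F1 //; exists u; rewrite ?F1.
- rewrite -[in RHS]ex -[in RHS]ey; apply/seteqP; split=> [_ [u Su <-]|_ [_ [u Su <-] <-]].
    by exists (F y u); [exists u|rewrite FM].
  by exists u; rewrite ?FM.
- rewrite -{1}ex; apply/seteqP; split=> [_ [_ [u Su <-] <-]|u Su].
    by rewrite -FM mulVg F1.
  by exists (F x u); [exists u|rewrite -FM mulVg F1].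
Qed.

Lemma Gamma_max_subgroup J (C0 : set D) : is_subgroup (Gamma_max s J C0).
Proof.
have [a1 aM aV] := setwise_stabilizer_subgroup (simple_root R @` J) (act1 hW) (actM hW).
have [b1 bM bV] := setwise_stabilizer_subgroup (C_max s J C0) (dual_act1 hW) (dual_actM hW).
split=> [|x y [h1 h2] [h3 h4]|x [h1 h2]]; split.
- exact: a1.
- exact: b1.
- exact: aM.
- exact: bM.
- exact: aV.
- exact: bV.
Qed.

Lemma Gamma_max_vee_subgroup J (C0 : set D) : is_subgroup (Gamma_max_vee s J C0).
Proof.
have [a1 aM aV] := Gamma_max_subgroup J C0.
split=> [|x y [h1 h2] [h3 h4]|x [h1 h2]]; split.
- exact: a1.
- by move=> i _; rewrite (act1 hW).
- exact: aM.
- by move=> i Ji; rewrite (actM hW) h4 // h2.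
- exact: aV.
- by move=> i Ji; rewrite -{1}(h2 i Ji) (actK hW).
Qed.

(** The node [a0] detects the automorphism of J: an end of the path, or a short arm of D5. Two
    elements outside the subgroup both send it to [b0], so their quotient fixes it and acts
    trivially on J. *)
Theorem Gamma_max_structure m (phi : 'I_m -> Pi) (C0 : set D) (a0 b0 : 'I_m) :
  injective phi -> no_diamond (R := R) s phi ->
  (forall p : 'I_m -> 'I_m, injective p ->
    (forall a b, G (phi (p a)) (phi (p b)) = G (phi a) (phi b)) ->
    (p a0 = a0 \/ p a0 = b0) /\ (p a0 = a0 -> p =1 id)) ->
  is_C_max_open s (range phi) C0 ->
  is_free_group (Gamma_max_vee s (range phi) C0) /\
  (has_index (Gamma_max_vee s (range phi) C0) (Gamma_max s (range phi) C0) 1 \/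
   has_index (Gamma_max_vee s (range phi) C0) (Gamma_max s (range phi) C0) 2).
Proof.
move=> ip nd rigid [f0 hf0 eC0]; split.
  have [w0 [k [c [hk hc ef ck]]]] := Jperp_tile hW (proj1 hf0).
  rewrite ef in hf0 eC0.
  apply: (chamber_group_free hW ip nd (w0 := w0)).
  - exact: Gamma_max_vee_subgroup.
  - by exists k.
  - by move=> h a [_]; apply; exists a.
  - by move=> h; exact: (Gamma_vee_same_side hW ip hk hc ck eC0 hf0).
have perm x : Gamma_max s (range phi) C0 x -> exists p : 'I_m -> 'I_m,
    [/\ forall a, act x 'a_(phi a) = 'a_(phi (p a)), p a0 = a0 \/ p a0 = b0 &
    p a0 = a0 -> Gamma_max_vee s (range phi) C0 x].
  move=> Gx; have [p hp] := preserves_JP (proj1 Gx).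
  have injp : injective p.
    move=> a b e; apply: ip; apply: (@simple_root_inj R).
      by apply: (act_inj hW (w := x)); rewrite !hp e.
  have gp a b : G (phi (p a)) (phi (p b)) = G (phi a) (phi b).
    by rewrite -!rform_simple -!hp (act_form hW).
  have [h1 h2] := rigid p injp gp; exists p; split=> // pa.
  by split=> // _ [a _ <-]; rewrite hp h2.
have [G1 GM GV] := Gamma_max_subgroup (range phi) C0.
apply: has_index_le2; [exact: Gamma_max_vee_subgroup|exact: Gamma_max_subgroup|by move=> x []|].
move=> x y Gx Gy nx ny.
have [px [hx ox vx]] := perm x Gx; have [py [hy oy vy]] := perm y Gy.
have ex : px a0 = b0 by case: ox => // /vx.
have ey : py a0 = b0 by case: oy => // /vy.
have [p [hp _ v]] := perm (x^-1 * y)%g (GM _ _ (GV _ Gx) Gy).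
apply: v; apply: ip; apply: (@simple_root_inj R).
by rewrite -hp (actM hW) hy ey -ex -hx (actK hW).
Qed.

Lemma diagram_gram n (e : rel 'I_n) (J : set Pi) : diagram_of_type s e J ->
  exists phi : 'I_n -> Pi, [/\ injective phi, range phi = J &
    forall a b, G (phi a) (phi b) =
      if a == b then 1 else if e a b then - (1 / 2) else 0].
Proof.
case=> phi [ip rp h]; exists phi; split=> // a b.
case: (eqVneq a b) => [->|ab]; first exact: gram_diag (gen_sq hW) _.
have := h a b ab; case: (e a b) => hab; first exact: gram_matrix3.
exact: gram_matrix2.
Qed.

Lemma typeA_structure m (J : set Pi) (C0 : set D) : odd m -> type_A s m J ->
  is_C_max_open s J C0 ->
  is_free_group (Gamma_max_vee s J C0) /\
  (has_index (Gamma_max_vee s J C0) (Gamma_max s J C0) 1 \/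
   has_index (Gamma_max_vee s J C0) (Gamma_max s J C0) 2).
Proof.
case: m => // m om /diagram_gram [phi [ip <- hp]] hC0.
have hpath a b : G (phi a) (phi b) = path_gram a b by rewrite hp.
apply: (Gamma_max_structure (a0 := ord0) (b0 := ord_max) ip _ _ hC0).
  exact: typeA_no_diamond.
move=> p injp hg; apply: (path_automorphism (R := R)) => // a b.
by rewrite -!hpath hg.
Qed.

Lemma typeD5_structure (J : set Pi) (C0 : set D) : type_D5 s J ->
  is_C_max_open s J C0 ->
  is_free_group (Gamma_max_vee s J C0) /\
  (has_index (Gamma_max_vee s J C0) (Gamma_max s J C0) 1 \/
   has_index (Gamma_max_vee s J C0) (Gamma_max s J C0) 2).
Proof.
case/diagram_gram => phi [ip <- hp] hC0.
have hd (a b : 'I_5) : G (phi a) (phi b) = d5_gram a b by rewrite hp.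
apply: (Gamma_max_structure (a0 := inord 3) (b0 := inord 4) ip _ _ hC0).
  exact: typeD5_no_diamond.
move=> p injp hg; apply: (d5_automorphism (R := R)) => // a b.
by rewrite -!hd hg.
Qed.

End Structure.

Theorem mainTheorem4 (R : realType) (Pi : choiceType) (W : groupType)
    (s : Pi -> W) (hW : is_coxeter_system s)
    (J : set Pi)
    (hJ : type_D5 s J \/ exists2 m : nat, odd m & type_A s m J)
    (C0 : set (dualspace R Pi)) (hC0 : is_C_max_open s J C0) :
  let Gamma := Gamma_max s J C0 in
  let Gamma_vee := Gamma_max_vee s J C0 in
  [/\ is_free_group Gamma_vee,
      has_index Gamma_vee Gamma 1 \/ has_index Gamma_vee Gamma 2
    & exists F : set W,
        [/\ is_subgroup F, (forall w, F w -> Gamma w), is_free_group F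
          & has_index F Gamma 1 \/ has_index F Gamma 2]].
Proof.
move=> Gamma Gamma_vee.
have [free index] : is_free_group Gamma_vee /\
    (has_index Gamma_vee Gamma 1 \/ has_index Gamma_vee Gamma 2).
  by case: hJ => [hJ|[m om hJ]]; [exact: typeD5_structure|exact: typeA_structure om hJ hC0].
split=> //; exists Gamma_vee; split=> //; last by move=> w [].
exact: Gamma_max_vee_subgroup.
Qed.
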